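(* Let $d\in\{2,3\}$, $a>0$, let $S:\Omega\to\Omega$ belong to $H^1(\Omega)$, and let $$\mathcal{L}(Z,q):=\tfrac12\|Z-S\|_{L^2(\Omega)}^2+\tfrac a2\|DZ-DS\|_{L^2(\Omega)}^2+\int_\Omega q(x)\big(|\det(DZ(x))|-1\big)\,dx .$$ Suppose that $Z^*\in\mathcal{D}\mathrm{iff}_{\mathbf{id}}(\Omega)$ and $q^*\in L^\infty(\Omega)$ solve $$(I-a\Delta)(Z^*-S)+D^T\big(\mathrm{cof}(DZ^* )q^*\big)=0,\qquad\det(DZ^* )=1,$$ and that the singular values of $DZ^*$ are uniformly bounded from below by some $\sigma>0$. Set $\bar q:=q^*-c$, where $c\in\mathbb{R}$ is the largest constant such that $\bar q\ge0$ (a.e.). If $$\|\bar q\|_{L^\infty(\Omega)}\le a\sigma^2\Big(1+\tfrac32(1+\sqrt3)\Big)^{-1},$$ then $Z^*$ is the unique global minimizer of $\mathcal{L}(\cdot,\bar q)$ among functions in $W^{1,d}_{\mathbf{id}}(\Omega)$.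
   Context: $\Omega\subset\mathbb{R}^d$ is a bounded open set with smooth boundary; $\mathbf{id}$ is the identity map. $\mathcal{D}\mathrm{iff}_{\mathbf{id}}(\Omega)$ is the set of volume preserving $C^1$-diffeomorphisms $X:\bar\Omega\to\bar\Omega$ (with $\det DX=1$) such that $X=\mathbf{id}$ on $\partial\Omega$. $W^{1,d}_{\mathbf{id}}(\Omega)$ is the set of $Z\in W^{1,d}(\Omega;\mathbb{R}^d)$ with $Z=\mathbf{id}$ on $\partial\Omega$ (in the trace sense). $\mathrm{cof}(M)$ is the cofactor matrix, $M^T\mathrm{cof}(M)=\det(M)I$. $L^2$ norms of matrix fields use the Frobenius norm. $D^T$ denotes the formal adjoint of $D$, so the first equation of the system is the Euler-Lagrange equation $\delta_Z\mathcal{L}(Z^*,q^* )=0$: $$\int_\Omega (Z^*-S)\cdot\phi+\big(a(DZ^*-DS)+q^*\,\mathrm{cof}(DZ^* )\big):D\phi\;dx=0\quad\text{for all }\phi\in C_c^\infty(\Omega;\mathbb{R}^d).$$ *)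

(* Defs.v *)
From HB Require Import structures.
From mathcomp Require Import all_boot all_order all_algebra.
From mathcomp Require Import all_classical all_reals all_analysis.

Set Implicit Arguments.
Unset Strict Implicit.
Unset Printing Implicit Defensive.

Import Order.TTheory GRing.Theory Num.Theory.
Import numFieldNormedType.Exports.

Local Open Scope classical_set_scope.
Local Open Scope ring_scope.

(* R^n is the type 'rV[R]_n.  Its sigma-algebra is generated by the coordinate
   maps, i.e. it is the Borel sigma-algebra. *)

Definition rV_display : measure_display.
Proof. exact: default_measure_display. Qed.

Definition rV_coord {R : realType} {n : nat} (i : 'I_n) (x : 'rV[R]_n) :
  measurableTypeR R := x ord0 i.

Section rV_measurable.
Context {R : realType} (n : nat).

Let rV_set0 : g_sigma_preimage (@rV_coord R n) set0.
Proof. exact: sigma_algebra0. Qed.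

Let rV_setC A :
  g_sigma_preimage (@rV_coord R n) A -> g_sigma_preimage (@rV_coord R n) (~` A).
Proof. exact: sigma_algebraC. Qed.

Let rV_bigcup (F : _^nat) : (forall i, g_sigma_preimage (@rV_coord R n) (F i)) ->
  g_sigma_preimage (@rV_coord R n) (\bigcup_i (F i)).
Proof. exact: sigma_algebra_bigcup. Qed.

HB.instance Definition _ := @isMeasurable.Build rV_display 'rV[R]_n
  (g_sigma_preimage (@rV_coord R n)) rV_set0 rV_setC rV_bigcup.

End rV_measurable.

Lemma measurable_rV_coord (R : realType) n (i : 'I_n) :
  measurable_fun [set: 'rV[R]_n] (rV_coord i).
Proof.
move=> _ Y mY; rewrite setTI; apply: sub_sigma_algebra => /=.
rewrite -bigcup_seq/=; exists i => /=; first by rewrite mem_index_enum.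
by exists Y => //; rewrite setTI.
Qed.

Lemma measurable_fun_rV_coordP (R : realType) d (T : measurableType d) n
    (f : T -> 'rV[R]_n) :
  measurable_fun [set: T] f <->
  forall i, measurable_fun [set: T] (rV_coord i \o f).
Proof.
split=> [mf i|mf]; first exact: measurableT_comp (measurable_rV_coord i) mf.
suff: g_sigma_preimage (fun i => rV_coord i \o f) `<=` measurable.
  rewrite g_sigma_preimage_comp => prefS _ A mA.
  by apply: prefS; exists A.
apply: smallest_sub; first exact: sigma_algebra_measurable.
case: n f mf => [|n] f mf; first by rewrite big_ord0.
rewrite -bigcup_mkord_ord; apply: bigcup_sub => i Ii.
by move=> A [B mB <-]; exact: mf.
Qed.

Section rV_lebesgue.
Context {R : realType}.

Definition rV_cons n (p : measurableTypeR R * 'rV[R]_n) : 'rV[R]_n.+1 :=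
  \row_i (if unlift ord0 i is Some j then p.2 ord0 j else p.1).

Definition rV_uncons n (x : 'rV[R]_n.+1) : measurableTypeR R * 'rV[R]_n :=
  (x ord0 ord0, \row_j x ord0 (lift ord0 j)).

Lemma rV_consK n : cancel (@rV_cons n) (@rV_uncons n).
Proof.
move=> [r x]; rewrite /rV_uncons /rV_cons mxE unlift_none; congr pair.
by apply/rowP => j; rewrite !mxE liftK.
Qed.

Lemma measurable_rV_cons n : measurable_fun setT (@rV_cons n).
Proof.
apply/measurable_fun_rV_coordP => i.
case: (unliftP ord0 i) => [j ->|->].
- rewrite (_ : _ \o _ = rV_coord j \o snd).
    exact: measurableT_comp (measurable_rV_coord j) measurable_snd.
  by apply/funext => p; rewrite /rV_coord /rV_cons /= mxE liftK.
- rewrite (_ : _ \o _ = fst); first exact: measurable_fst.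
  by apply/funext => p; rewrite /rV_coord /rV_cons /= mxE unlift_none.
Qed.

Lemma measurable_rV_uncons n : measurable_fun setT (@rV_uncons n).
Proof.
apply: measurable_fun_pair; first exact: measurable_rV_coord.
apply/measurable_fun_rV_coordP => i.
rewrite (_ : _ \o _ = rV_coord (lift ord0 i)); first exact: measurable_rV_coord.
by apply/funext => x; rewrite /rV_coord /= mxE.
Qed.

Section succ.
Context n (mu : {sigma_finite_measure set 'rV[R]_n -> \bar R}).
Local Open Scope ereal_scope.

Definition lebesgue_succ : set 'rV[R]_n.+1 -> \bar R :=
  pushforward (@lebesgue_measure R \x mu) (@rV_cons n).

Let push := measure_function_pushforward__canonical__measure_function_Measure
  (@lebesgue_measure R \x mu) (@measurable_rV_cons n).

HB.instance Definition _ := isMeasure.Build _ _ _ lebesgue_succ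
  (measure0 push) (measure_ge0 push) (@measure_semi_sigma_additive _ _ _ push).

Let lebesgue_succ_sigma_finite : sigma_finite setT lebesgue_succ.
Proof.
have /sigma_finiteP[F [FT ndF Foo]] := sigma_finiteT (@lebesgue_measure R).
have /sigma_finiteP[G [GT ndG Goo]] := sigma_finiteT mu.
exists (fun k => @rV_uncons n @^-1` (F k `*` G k)).
  apply/seteqP; split=> // x _.
  have [i _ Fi] : (\bigcup_i F i) (x ord0 ord0) by rewrite -FT.
  have [j _ Gj] : (\bigcup_i G i) (rV_uncons x).2 by rewrite -GT.
  exists (maxn i j) => //; split => /=.
    by apply: (subsetPset _ _ (ndF _ _ (leq_maxl i j))).
  by apply: (subsetPset _ _ (ndG _ _ (leq_maxr i j))).
move=> k; have [mF Fk] := Foo k; have [mG Gk] := Goo k; split.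
  rewrite -[X in measurable X]setTI; apply: measurable_rV_uncons => //.
  exact: measurableX.
rewrite /lebesgue_succ /pushforward -comp_preimage.
rewrite (_ : _ \o _ = id); last by apply/funext => p; exact: rV_consK.
by rewrite preimage_id product_measure1E// lte_mul_pinfty// ge0_fin_numE.
Qed.

HB.instance Definition _ := @Measure_isSigmaFinite.Build _ _ _ lebesgue_succ
  lebesgue_succ_sigma_finite.

End succ.

Fixpoint lebesgue n : {sigma_finite_measure set 'rV[R]_n -> \bar R} :=
  if n is n'.+1 then lebesgue_succ (lebesgue n') else \d_(0 : 'rV[R]_0).

End rV_lebesgue.
Arguments lebesgue {R} n.

Lemma lebesgue_box (R : realType) n (a b : 'rV[R]_n) :
  (forall i, a ord0 i <= b ord0 i) ->
  lebesgue n [set x | forall i, x ord0 i \in `[a ord0 i, b ord0 i]]%R =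
  (\prod_i (b ord0 i - a ord0 i))%:E.
Proof.
elim: n a b => [|n IH] a b ab.
  by rewrite big_ord0 /= diracE mem_set//=; case.
rewrite big_ord_recl.
change ((@lebesgue_measure R \x lebesgue n)%E (@rV_cons R n @^-1`
    [set x | forall i, x ord0 i \in `[a ord0 i, b ord0 i]]) =
  ((b ord0 ord0 - a ord0 ord0) *
   \prod_(i < n) (b ord0 (lift ord0 i) - a ord0 (lift ord0 i)))%:E).
rewrite (_ : @rV_cons R n @^-1` _ = `[a ord0 ord0, b ord0 ord0] `*`
    [set x : 'rV[R]_n | forall i : 'I_n, x ord0 i \in
      `[(\row_(j < n) a ord0 (lift ord0 j)) ord0 i,
        (\row_(j < n) b ord0 (lift ord0 j)) ord0 i]]); last first.
  apply/seteqP; split => -[r x] /=.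
    move=> H; split; first by have := H ord0; rewrite mxE unlift_none.
    by move=> i; have := H (lift ord0 i); rewrite !mxE liftK.
  move=> [H1 H2] i; case: (unliftP ord0 i) => [j ->|->]; rewrite !mxE.
    by rewrite liftK; have := H2 j; rewrite !mxE.
  by rewrite unlift_none.
rewrite product_measure1E//=; last first.
  rewrite (_ : [set _ | _] = \big[setI/setT]_(i < n) (rV_coord i @^-1`
      `[a ord0 (lift ord0 i), b ord0 (lift ord0 i)])).
    apply: bigsetI_measurable => i _; rewrite -[X in measurable X]setTI.
    exact: measurable_rV_coord.
  rewrite -bigcap_seq; apply/seteqP; split => x /=.
    by move=> H i _ /=; have := H i; rewrite !mxE.
  by move=> H i; have := H i; rewrite !mxE; apply; rewrite /= mem_index_enum.
rewrite [X in (X * _)%E]lebesgue_measure_itv /= lte_fin.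
rewrite IH; last by move=> i; rewrite !mxE.
rewrite EFinM; congr (_ * _)%E; last first.
  by congr EFin; apply: eq_bigr => i _; rewrite !mxE.
case: ltP => [_|ba]; first by rewrite EFinB.
by rewrite (_ : a ord0 ord0 = b ord0 ord0) ?subrr//; apply/eqP; rewrite eq_le ab ba.
Qed.

Section sobolev.
Context {R : realType} {d : nat}.
Implicit Types (Omega : set 'rV[R]_d) (f phi : 'rV[R]_d -> R)
  (Z : 'rV[R]_d -> 'rV[R]_d) (G : 'rV[R]_d -> 'M[R]_d) (p : \bar R).

Definition partial (j : 'I_d) f : 'rV[R]_d -> R := 'D_(delta_mx ord0 j) f.

Definition component Z (i : 'I_d) : 'rV[R]_d -> R := fun x => Z x ord0 i.

(* (DZ)_ij = d Z_i / d x_j *)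
Definition Dmx Z : 'rV[R]_d -> 'M[R]_d :=
  fun x => \matrix_(i, j) partial j (component Z i) x.

Fixpoint Ck (k : nat) f : Prop :=
  if k is k'.+1 then
    forall j, (forall x, derivable f x (delta_mx ord0 j)) /\ Ck k' (partial j f)
  else continuous f.

Definition smooth f := forall k, Ck k f.

Definition boundary Omega : set 'rV[R]_d := closure Omega `\` interior Omega.

Definition smooth_boundary Omega := forall x, boundary Omega x ->
  exists (U : set 'rV[R]_d) (rho : 'rV[R]_d -> R),
    [/\ open U, U x, smooth rho, exists j, partial j rho x != 0
      & Omega `&` U = [set y | rho y < 0] `&` U].

Definition test Omega phi := smooth phi /\
  exists K, [/\ compact K, K `<=` Omega & forall x, ~ K x -> phi x = 0].

Definition test_field Omega Z := forall i, test Omega (component Z i).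

Definition Lnorm_on Omega p f : \bar R :=
  'N[lebesgue d]_p[EFin \o (f \_ Omega)].

Definition Lp_on Omega p f :=
  measurable_fun Omega f /\ (Lnorm_on Omega p f < +oo)%E.

Definition dot m n (A B : 'M[R]_(m, n)) : R := \sum_i \sum_j A i j * B i j.

(* Euclidean norm of vectors, Frobenius norm of matrices *)
Definition frob m n (A : 'M[R]_(m, n)) : R := Num.sqrt (dot A A).

Definition Lnorm_mx m n Omega p (F : 'rV[R]_d -> 'M[R]_(m, n)) : \bar R :=
  Lnorm_on Omega p (fun x => frob (F x)).

Definition Lp_mx m n Omega p (F : 'rV[R]_d -> 'M[R]_(m, n)) :=
  (forall i j, measurable_fun Omega (fun x => F x i j)) /\
  (Lnorm_mx Omega p F < +oo)%E.

Definition L1loc Omega f := measurable_fun Omega f /\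
  forall K, compact K -> K `<=` Omega ->
    (lebesgue d).-integrable K (EFin \o f).

Definition weak_gradient Omega Z G :=
  [/\ forall i, L1loc Omega (component Z i),
      forall i j, L1loc Omega (fun x => G x i j)
    & forall i j phi, test Omega phi ->
        \int[lebesgue d]_(x in Omega) (Z x ord0 i * partial j phi x) =
        - \int[lebesgue d]_(x in Omega) (G x i j * phi x)].

(* A representative of the weak gradient, which is unique up to null sets. *)
Definition wD Omega Z : 'rV[R]_d -> 'M[R]_d := get (weak_gradient Omega Z).

Definition W1p Omega p Z :=
  Lp_mx Omega p Z /\ exists2 G, weak_gradient Omega Z G & Lp_mx Omega p G.

(* The closure of the test fields in the W^{1,p} norm, i.e. the functions
   with zero trace on the boundary. *)
Definition W1p0 Omega p Z := W1p Omega p Z /\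
  exists2 phi : nat -> 'rV[R]_d -> 'rV[R]_d,
    forall n, test_field Omega (phi n) &
    Lnorm_mx Omega p (fun x => phi n x - Z x) @[n --> \oo] --> 0%E /\
    Lnorm_mx Omega p (fun x => Dmx (phi n) x - wD Omega Z x) @[n --> \oo]
      --> 0%E.

Definition W1d_id Omega Z :=
  W1p Omega (d%:R%:E) Z /\ W1p0 Omega (d%:R%:E) (fun x => Z x - x).

(* C^1 up to the boundary: DX extends continuously to the closure. *)
Definition C1_closure Omega Z :=
  [/\ {within closure Omega, continuous Z},
      forall x, Omega x -> differentiable Z x
    & exists2 G : 'rV[R]_d -> 'M[R]_d, {within closure Omega, continuous G} &
        forall x, Omega x -> Dmx Z x = G x].

Definition Diff_id Omega (X : 'rV[R]_d -> 'rV[R]_d) :=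
  [/\ C1_closure Omega X,
      set_fun (closure Omega) (closure Omega) X,
      exists Y : 'rV[R]_d -> 'rV[R]_d,
        [/\ C1_closure Omega Y, set_fun (closure Omega) (closure Omega) Y,
            {in closure Omega, cancel X Y} & {in closure Omega, cancel Y X}],
      forall x, Omega x -> \det (Dmx X x) = 1
    & forall x, boundary Omega x -> X x = x].

Definition cof (A : 'M[R]_d) : 'M[R]_d := \matrix_(i, j) cofactor A i j.

Lemma mulmx_tr_cof (A : 'M[R]_d) : A^T *m cof A = (\det A)%:M.
Proof.
rewrite -[RHS]tr_scalar_mx -mul_adj_mx trmx_mul; congr (_ *m _).
by apply/matrixP => i j; rewrite !mxE.
Qed.

Definition singular_value (A : 'M[R]_d) (s : R) :=
  0 <= s /\ eigenvalue (A^T *m A) (s ^+ 2).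

(* The first two terms are 1/2 |Z - S|_2^2 and a/2 |DZ - DS|_2^2. *)
Definition Lagrangian Omega (a : R) (S Z : 'rV[R]_d -> 'rV[R]_d)
    (q : 'rV[R]_d -> R) : \bar R :=
  ((1 / 2)%:E * Lnorm_mx Omega 2%:E (fun x => (Z x - S x)%R) ^+ 2
   + (a / 2)%:E *
       Lnorm_mx Omega 2%:E (fun x => (wD Omega Z x - wD Omega S x)%R) ^+ 2
   + \int[lebesgue d]_(x in Omega) (q x * (`|\det (wD Omega Z x)| - 1))%:E)%E.

Definition solves Omega (a : R) (S Zs : 'rV[R]_d -> 'rV[R]_d)
    (qs : 'rV[R]_d -> R) :=
  (forall phi : 'rV[R]_d -> 'rV[R]_d, test_field Omega phi ->
    \int[lebesgue d]_(x in Omega)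
      (dot (Zs x - S x) (phi x) +
       dot (a *: (Dmx Zs x - wD Omega S x) + qs x *: cof (Dmx Zs x))
         (Dmx phi x)) = 0) /\
  (forall x, Omega x -> \det (Dmx Zs x) = 1).

Definition ae_on Omega (P : 'rV[R]_d -> Prop) :=
  {ae lebesgue d, forall x, Omega x -> P x}.

Definition minimizer (T : Type) (A : set T) (F : T -> \bar R) (z : T) :=
  A z /\ forall w, A w -> (F z <= F w)%E.

Definition unique_minimizer Omega (A : set ('rV[R]_d -> 'rV[R]_d)) F Z :=
  minimizer A F Z /\
  forall Z', minimizer A F Z' -> ae_on Omega (fun x => Z' x = Z x).

End sobolev.

(* Main.v *)
(* With W = Z - Z* and H = DZ - DZ*, the difference of the energies of Z and Z*
   is the sum of the first variation of L(., qbar) at Z* in direction W, of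
   |W|^2 / 2, and of a/2 |H|^2 + qbar (|det (DZ* + H)| - 1 - cof DZ* : H).  The
   last term is pointwise nonnegative: since det DZ* = 1, it is governed by
   |det (1 + M)| - 1 - tr M with M = DZ*^-1 H, which is at least
   -(1 + 3/2 (1 + sqrt 3)) |M|^2 / 2, while |M| <= |H| / sigma.  The first
   variation vanishes on test fields: by the Euler-Lagrange equation for q*,
   and because replacing q* by q* - c only subtracts c times the integral of
   cof DZ* : D phi, which is zero by Piola's identity.  It then vanishes for W by
   density, since Z - id and Z* - id have zero trace; for Z* - id, which is C^1
   and vanishes on the boundary, this is proved by truncation and mollification. *)

Require Import Defs.
From mathcomp Require Import all_boot all_order all_algebra.
From mathcomp Require Import all_classical all_reals all_analysis.
From mathcomp Require Import perm measurable_realfun ess_sup_inf ring lra.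

Import Order.TTheory GRing.Theory Num.Theory.
Import numFieldNormedType.Exports.

Set Implicit Arguments.
Unset Strict Implicit.
Unset Printing Implicit Defensive.

Local Open Scope classical_set_scope.
Local Open Scope ring_scope.

(** * Borel sets and Lebesgue measure on R^n *)

(** Two steps are delicate because [Zs] is only C^1. For u a component of [Zs - id] the cut-off acts
    on values: [trunc h] kills values of size at most h, so [trunc h] of u vanishes near the
    boundary. Its gradient tends to that of u only where u is nonzero, so one must show that the
    gradient of u vanishes a.e. on the zero set of u. Piola's identity is usually read off from
    second derivatives, which [Zs] need not have; for d = 3 one row of [DZs] is replaced by the
    gradient of a coordinate plus a test function, the derivatives of the other row are moved away
    by parts, and a limit is taken. The first variation is treated in L^2: on a bounded domain with
    d >= 2, L^d convergence implies L^2 convergence, and the field paired with the gradient is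
    square integrable because [DZs] and qbar are bounded. Half of 1 + 3/2 (1 + sqrt 3) exceeds 5/2 =
    1/2 + 2. For d = 3 the 1/2 pays for the second invariant of M, the 2 for det M >= - |M|^3 as
    long as |M| <= 2; beyond that only |det| >= 0 is used. *)

Section rV_norm.
Context {R : realType} {n : nat}.
Implicit Types x y : 'rV[R]_n.

Lemma ler_coord_norm x i : `|x ord0 i| <= `|x|.
Proof.
rewrite [leRHS]/Num.norm /= mx_normrE; apply/bigmax_geP; right.
by exists (ord0, i).
Qed.

Lemma ler_rV_norm x (M : R) :
  0 <= M -> (forall i, `|x ord0 i| <= M) -> `|x| <= M.
Proof.
move=> M0 xM; rewrite [leLHS]/Num.norm /= mx_normrE; apply/bigmax_leP; split => //.
by move=> [i j] _ /=; rewrite ord1.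
Qed.

Lemma ltr_rV_norm x (M : R) :
  0 < M -> (forall i, `|x ord0 i| < M) -> `|x| < M.
Proof.
move=> M0 xM; rewrite [ltLHS]/Num.norm /= mx_normrE; apply/bigmax_ltP; split => //.
by move=> [i j] _ /=; rewrite ord1.
Qed.

Lemma norm_delta_mx_le1 (j : 'I_n) : `|delta_mx ord0 j : 'rV[R]_n| <= 1.
Proof.
apply: ler_rV_norm => // i; rewrite mxE eqxx /=.
by case: eqP => _; rewrite ?normr1 ?normr0.
Qed.

End rV_norm.

Section rV_borel.
Context {R : realType}.
Implicit Types n : nat.

Lemma measurable_rV_box n (A : 'I_n -> set (measurableTypeR R)) :
  (forall i, measurable (A i)) ->
  measurable [set x : 'rV[R]_n | forall i, A i (x ord0 i)].
Proof.
move=> mA; rewrite (_ : [set _ | _] = \big[setI/setT]_(i < n) (rV_coord i @^-1` A i)).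
  apply: bigsetI_measurable => i _; rewrite -[X in measurable X]setTI.
  exact: measurable_rV_coord.
rewrite -bigcap_seq; apply/seteqP; split => x /=.
  by move=> H i _ /=; exact: H.
by move=> H i; have := H i; apply; rewrite /= mem_index_enum.
Qed.

Definition open_box n (a b : 'rV[R]_n) : set 'rV[R]_n :=
  [set x | forall i, a ord0 i < x ord0 i < b ord0 i].

Definition closed_box n (a b : 'rV[R]_n) : set 'rV[R]_n :=
  [set x | forall i, a ord0 i <= x ord0 i <= b ord0 i].

Lemma measurable_open_box n (a b : 'rV[R]_n) : measurable (open_box a b).
Proof.
rewrite (_ : open_box a b = [set x | forall i, [set` `]a ord0 i, b ord0 i[] (x ord0 i)]).
  apply: (@measurable_rV_box _ (fun i => [set` `]a ord0 i, b ord0 i[])) => i.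
  exact: measurable_itv.
by apply/seteqP; split => x H i; have := H i; rewrite /= in_itv.
Qed.

Lemma measurable_closed_box n (a b : 'rV[R]_n) : measurable (closed_box a b).
Proof.
rewrite (_ : closed_box a b = [set x | forall i, [set` `[a ord0 i, b ord0 i]] (x ord0 i)]).
  apply: (@measurable_rV_box _ (fun i => [set` `[a ord0 i, b ord0 i]])) => i.
  exact: measurable_itv.
by apply/seteqP; split => x H i; have := H i; rewrite /= in_itv.
Qed.

Lemma compact_closed_box n (a b : 'rV[R]_n) : compact (closed_box a b).
Proof.
rewrite (_ : closed_box a b = [set x | forall i, [set` `[a ord0 i, b ord0 i]] (x ord0 i)]).
  apply: (@rV_compact R n (fun i => [set` `[a ord0 i, b ord0 i]])) => i.
  exact: segment_compact.
by apply/seteqP; split => x H i; have := H i; rewrite /= in_itv.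
Qed.

Lemma open_box_closed_box n (a b : 'rV[R]_n) : open_box a b `<=` closed_box a b.
Proof. by move=> x H i; have /andP[ax xb] := H i; rewrite !ltW. Qed.

(** Boxes with rational centre and half-width 1/(k+1) are countably many. Asking that the closed
    boxes lie in U, while the open ones cover it, serves both measurability of open sets and
    arguments on compact pieces of U. *)
Lemma open_box_cover n (U : set 'rV[R]_n) : open U ->
  exists (D : set nat) (a b : nat -> 'rV[R]_n),
    (forall k, D k -> closed_box (a k) (b k) `<=` U) /\
    U `<=` \bigcup_(k in D) open_box (a k) (b k).
Proof.
move=> oU.
pose q0 : 'rV[rat]_n * nat := (0, 0%N).
(* [q0] is the value at numbers that code nothing; only boxes inside U are kept below, so it does no
   harm. *)
pose c k : 'rV[rat]_n * nat := odflt q0 (unpickle k).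
pose a k : 'rV[R]_n := \row_i (ratr ((c k).1 ord0 i) - (c k).2.+1%:R^-1).
pose b k : 'rV[R]_n := \row_i (ratr ((c k).1 ord0 i) + (c k).2.+1%:R^-1).
exists [set k | closed_box (a k) (b k) `<=` U], a, b; split => // x Ux.
have /nbhs_ballP[e /= e0 eU] := open_nbhs_nbhs (conj oU Ux).
near \oo => k.
have k2e : k.+1%:R^-1 < e / 2.
  near: k; have := @near_infty_natSinv_lt R (PosNum (divr_gt0 e0 (ltr0Sn R 1))).
  exact.
have k0 : 0 < k.+1%:R^-1 :> R by rewrite invr_gt0.
have qP i : exists q : rat, ratr q \in `](x ord0 i - k.+1%:R^-1), (x ord0 i + k.+1%:R^-1)[.
  by apply: rat_in_itvoo; rewrite ltrD2l gtrN.
pose q : 'rV[rat]_n := \row_i projT1 (cid (qP i)).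
have qx i : `|ratr (q ord0 i) - x ord0 i| < k.+1%:R^-1.
  rewrite mxE; case: cid => r /=; rewrite in_itv/= => rx.
  rewrite ltr_norml; move: rx; move: (_^-1) => h rx; lra.
move: q qx => q qx.
have cE : c (pickle (q, k)) = (q, k) by rewrite /c pickleK.
exists (pickle (q, k)) => /=.
- move=> y By; apply: eU.
  rewrite -ball_normE /ball_ /=; apply: ltr_rV_norm => // i.
  move: (By i) (qx i) k2e; rewrite /= !mxE cE /= ltr_norml.
  by move: (_^-1) (q ord0 i) => h r; rewrite ltr_norml; lra.
- move=> i; move: (qx i) => /=; rewrite !mxE cE /= ltr_norml.
  by move: (_^-1) => h; lra.
Unshelve. all: by end_near. Qed.

Lemma open_rV_measurable n (U : set 'rV[R]_n) : open U -> measurable U.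
Proof.
move=> oU; have [D [a [b [abU Uab]]]] := open_box_cover oU.
rewrite (_ : U = \bigcup_(k in D) open_box (a k) (b k)).
  by apply: bigcup_measurable => k _; exact: measurable_open_box.
apply/seteqP; split=> // x [k Dk] /open_box_closed_box; exact: abU.
Qed.

Lemma closed_rV_measurable n (U : set 'rV[R]_n) : closed U -> measurable U.
Proof.
move=> /closed_openC/open_rV_measurable/measurableC; by rewrite setCK.
Qed.

Lemma compact_rV_measurable n (U : set 'rV[R]_n) : compact U -> measurable U.
Proof.
by move=> /(compact_closed (@norm_hausdorff _ _)); exact: closed_rV_measurable.
Qed.

Lemma measurable_fun_continuous_on n (D : set 'rV[R]_n) (f : 'rV[R]_n -> R) :
  open D -> (forall x, D x -> {for x, continuous f}) -> measurable_fun D f.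
Proof.
move=> oD cf; apply: (measurability _ (measurable_realfun.RGenOpens.measurableE R)).
move=> _ [_ [a [b ->] <-]]; apply: open_rV_measurable.
rewrite openE => x [Dx fx] /=; apply: filterI; first exact: open_nbhs_nbhs.
by apply: (cf _ Dx); apply: open_nbhs_nbhs; split => //; exact: interval_open.
Qed.

Lemma measurable_fun_continuous_rV n (D : set 'rV[R]_n) (f : 'rV[R]_n -> R) :
  measurable D -> continuous f -> measurable_fun D f.
Proof.
move=> mD cf; apply: (@measurable_funS _ _ _ _ setT) => //.
by apply: measurable_fun_continuous_on => [|x _]; [exact: openT|exact: cf].
Qed.

Lemma lebesgue_bounded_ltoo n (A : set 'rV[R]_n) :
  measurable A -> bounded_set A -> (lebesgue n A < +oo)%E.
Proof.
move=> mA [M [Mr AM]].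
pose m := Num.max (M + 1) 1.
have m0 : 0 < m by rewrite lt_max ltr01 orbT.
apply: (@le_lt_trans _ _ (lebesgue n [set x : 'rV[R]_n | forall i,
   x ord0 i \in `[(const_mx (- m) : 'rV[R]_n) ord0 i,
                   (const_mx m : 'rV[R]_n) ord0 i]])); last first.
  rewrite lebesgue_box ?ltry//  => i; rewrite !mxE; lra.
apply: le_measure; rewrite ?inE//.
  apply: (@measurable_rV_box _ (fun i => [set` `[_, _]])) => i.
  exact: measurable_itv.
move=> x Ax i /=; rewrite !mxE in_itv/= -ler_norml.
apply: (le_trans (ler_coord_norm _ _)); apply: AM => //.
by rewrite lt_max ltrDl ltr01.
Qed.

End rV_borel.

(** * Partial derivatives and integration by parts *)

Section partial_line.
Context {R : realType} {n : nat}.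
Implicit Types (f : 'rV[R]_n -> R) (x : 'rV[R]_n) (j : 'I_n) (t : R).

Local Notation e := (@delta_mx R 1 n ord0).

Let line_quotient f j x t :
  (fun h : R => h^-1 *: ((fun s : R => f (s *: e j + x)) (h *: (1 : R^o) + t)
                         - f (t *: e j + x))) =
  (fun h => h^-1 *: (f (h *: e j + (t *: e j + x)) - f (t *: e j + x))).
Proof.
apply/funext => h; congr (_ *: (f _ - _)).
by rewrite addrA -scalerDl /GRing.scale /= mulr1.
Qed.

(** Turns partial derivatives into derivatives of functions of one real variable, where the chain
    rule, the mean value theorem and the fundamental theorem of calculus apply. *)
Lemma derivable_line f j x t :
  derivable (fun s : R => f (s *: e j + x)) t 1 = derivable f (t *: e j + x) (e j).
Proof. by rewrite /derivable line_quotient. Qed.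

Lemma derive_line f j x t :
  'D_1 (fun s : R => f (s *: e j + x)) t = partial j f (t *: e j + x).
Proof. by rewrite /partial /derive line_quotient. Qed.

Lemma is_derive_line f j x t : derivable f (t *: e j + x) (e j) ->
  is_derive t 1 (fun s : R => f (s *: e j + x)) (partial j f (t *: e j + x)).
Proof.
by move=> df; apply: DeriveDef; rewrite ?derivable_line ?derive_line.
Qed.

Lemma is_derive_line0 f j x : derivable f x (e j) ->
  is_derive (0 : R) 1 (fun s : R => f (s *: e j + x)) (partial j f x).
Proof.
by move=> df; have := @is_derive_line f j x 0; rewrite scale0r add0r; apply.
Qed.

Lemma line_is_derive f j x df :
  is_derive (0 : R) 1 (fun s : R => f (s *: e j + x)) df ->
  derivable f x (e j) /\ partial j f x = df.
Proof.
move=> [H1 H2]; rewrite derivable_line scale0r add0r in H1; split => //.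
by rewrite -H2 derive_line scale0r add0r.
Qed.

Lemma near_eq_partial f g j x : (\near x, f x = g x) ->
  (derivable f x (e j) <-> derivable g x (e j)) /\ partial j f x = partial j g x.
Proof.
move=> fg; have e0 : e j != 0.
  apply/eqP => /rowP/(_ j)/eqP; rewrite !mxE !eqxx /= oner_eq0//.
split; last exact: near_eq_derive.
by split; apply: near_eq_derivable => //; near do apply/esym.
Unshelve. all: by end_near. Qed.

Lemma partial_cst (c : R) j x :
  derivable (fun _ : 'rV[R]_n => c) x (e j) /\ partial j (fun=> c) x = 0.
Proof. by split; [exact: derivable_cst|exact: derive_cst]. Qed.

Lemma partial_coord (i j : 'I_n) x :
  derivable (fun y : 'rV[R]_n => y ord0 i) x (e j) /\
  partial j (fun y : 'rV[R]_n => y ord0 i) x = (i == j)%:R.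
Proof.
apply: line_is_derive; rewrite (_ : (fun s => _) = (fun s => s * (i == j)%:R + x ord0 i)).
  by apply: is_derive_eq; rewrite scaler0 add0r addr0 scaler1.
by apply/funext => s; rewrite !mxE eqxx.
Qed.

Lemma partialD f g j x : derivable f x (e j) -> derivable g x (e j) ->
  derivable (fun y => f y + g y) x (e j) /\
  partial j (fun y => f y + g y) x = partial j f x + partial j g x.
Proof. by move=> df dg; split; [exact: (derivableD df dg)|exact: (deriveD df dg)]. Qed.

Lemma partialB f g j x : derivable f x (e j) -> derivable g x (e j) ->
  derivable (fun y => f y - g y) x (e j) /\
  partial j (fun y => f y - g y) x = partial j f x - partial j g x.
Proof. by move=> df dg; split; [exact: (derivableB df dg)|exact: (deriveB df dg)]. Qed.

Lemma partialM f g j x : derivable f x (e j) -> derivable g x (e j) ->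
  derivable (fun y => f y * g y) x (e j) /\
  partial j (fun y => f y * g y) x = f x * partial j g x + partial j f x * g x.
Proof.
move=> df dg; split; first exact: (derivableM df dg).
rewrite /partial [LHS](deriveM df dg) /GRing.scale/=; congr (_ + _); exact: mulrC.
Qed.

Lemma partialZ (c : R) f j x : derivable f x (e j) ->
  derivable (fun y => c * f y) x (e j) /\
  partial j (fun y => c * f y) x = c * partial j f x.
Proof.
move=> df; have [c1 c2] := partial_cst c j x; have [d1 d2] := partialM c1 df.
by split => //; rewrite d2 c2 mul0r addr0.
Qed.

Lemma partial_comp1 (T : R -> R) (dT : R) f j x :
  is_derive (f x) 1 T dT -> derivable f x (e j) ->
  derivable (T \o f) x (e j) /\ partial j (T \o f) x = dT * partial j f x.
Proof.
move=> HT df; apply: line_is_derive.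
apply: (@is_derive1_comp _ T (fun s => f (s *: e j + x))).
  by rewrite scale0r add0r.
exact: is_derive_line0.
Qed.

End partial_line.

Lemma near_norm_gt {R : realType} (V : normedModType R) (x : V) (M : R) :
  M < `|x| -> \forall y \near x, M < `|y|.
Proof. by apply: cvgr_gt; exact: norm_continuous. Qed.

Section integral_partial.
Context {R : realType}.
Implicit Types n : nat.
Local Notation mu1 := (@lebesgue_measure R).

Lemma integrable_bounded_support n (f : 'rV[R]_n -> R) (M C : R) :
  measurable_fun setT f -> (forall x, M < `|x| -> f x = 0) ->
  (forall x, `|f x| <= C) -> (lebesgue n).-integrable setT (EFin \o f).
Proof.
move=> mf f0 fC.
pose A := [set x : 'rV[R]_n | `|x| <= M].
have cA : closed A.
  rewrite (_ : A = (fun x : 'rV[R]_n => `|x|) @^-1` [set r | r <= M]) //.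
  by apply: closed_comp => [x _|]; [exact: norm_continuous|exact: closed_le].
have mA : measurable A by exact: closed_rV_measurable.
have bA : bounded_set A.
  exists M; split; first exact: num_real.
  by move=> r Mr x Ax; rewrite /= (le_trans Ax)// ltW.
rewrite (_ : EFin \o f = (EFin \o f) \_ A); last first.
  apply/funext => x; rewrite patchE; case: ifPn => // /negP xA /=.
  by rewrite f0// ltNge; apply/negP => H; apply: xA; rewrite inE.
apply/integrable_restrict => //; rewrite setTI.
apply: measurable_bounded_integrable => //.
- exact: lebesgue_bounded_ltoo.
- exact: measurable_funTS.
- exists C; split; first exact: num_real.
  by move=> r Cr x _; rewrite /= (le_trans (fC x))// ltW.
Qed.

Lemma integral_derive0 (G g : R -> R) (M : R) :
  (forall t : R, is_derive t 1 G (g t)) -> continuous g ->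
  (forall t, M < `|t| -> G t = 0) -> (\int[mu1]_t (g t)%:E = 0)%E.
Proof.
move=> dG cg G0.
(* Strictly beyond M, so that [G] vanishes at both endpoints of [-a, a] and [g] vanishes outside. *)
pose a := `|M| + 1.
have a0 : 0 < a by rewrite ltr_wpDl.
have Ma : M < a by rewrite (le_lt_trans (ler_norm M))// ltrDl.
have g0 t : a < `|t| -> g t = 0.
  move=> at_; have <- : 'D_1 G t = g t by exact: derive_val.
  rewrite (@near_eq_derive _ _ _ G (cst 0)) ?derive_cst ?oner_eq0//.
  by apply: filterS (near_norm_gt (lt_trans Ma at_)) => s /G0.
rewrite (_ : (fun t => (g t)%:E) = (EFin \o g) \_ `[-a, a]); last first.
  apply/funext => t; rewrite patchE; case: ifPn => // /negP ta /=.
  rewrite g0// ltNge; apply/negP => H; apply: ta; rewrite inE/= in_itv/=.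
  by rewrite -ler_norml.
rewrite -integral_mkcond (@continuous_FTC2 _ g G).
- by rewrite !G0 ?normrN ?sube0// ?(lt_le_trans Ma (ler_norm _)).
- by rewrite gtrN.
- exact: continuous_subspaceT.
- have cG : continuous G.
    by move=> t; apply: differentiable_continuous; apply/derivable1_diffP.
  split; [by move=> t _; case: (dG t)|exact: (cvg_at_right_filter (cG _))|].
  exact: (cvg_at_left_filter (cG _)).
- by move=> t _; rewrite derive1E; exact: derive_val.
Qed.

Lemma rV_cons_continuous n (r : R) :
  continuous (fun x : 'rV[R]_n => rV_cons (r, x)).
Proof.
move=> x; apply/(@cvgrPdist_lt _ _ _ (nbhs x) _) => e e0; apply/nbhs_ballP; exists e => //= y.
rewrite -ball_normE /= => xy; apply: ltr_rV_norm => // i; rewrite !mxE.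
case: (unliftP ord0 i) => [j _|_] /=; last by rewrite subrr normr0.
rewrite (le_lt_trans (y := `|x - y|))//.
by have := ler_coord_norm (x - y) j; rewrite !mxE.
Qed.

Lemma ler_rV_cons_norm n (p : R * 'rV[R]_n) :
  `|p.1| <= `|rV_cons p| /\ `|p.2| <= `|rV_cons p|.
Proof.
split; first by have := ler_coord_norm (rV_cons p) ord0; rewrite mxE unlift_none.
apply: ler_rV_norm => // i.
by have := ler_coord_norm (rV_cons p) (lift ord0 i); rewrite mxE liftK.
Qed.

Lemma rV_consD n (h r : R) (x : 'rV[R]_n) :
  rV_cons (h + r, x) = h *: delta_mx ord0 ord0 + rV_cons (r, x).
Proof.
apply/rowP => i; rewrite !mxE !eqxx /=.
case: (unliftP ord0 i) => [j ->|->]; rewrite ?liftK ?unlift_none ?mulr1//.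
by rewrite mulr0 add0r.
Qed.

Lemma rV_cons_lift n (h r : R) (x : 'rV[R]_n) (j : 'I_n) :
  rV_cons (r, h *: delta_mx ord0 j + x) =
  h *: delta_mx ord0 (lift ord0 j) + rV_cons (r, x).
Proof.
apply/rowP => i; rewrite !mxE !eqxx /=.
case: (unliftP ord0 i) => [k ->|->]; rewrite ?liftK ?unlift_none ?mxE ?eqxx//=.
by rewrite mulr0 add0r.
Qed.

Lemma partial_rV_cons_lift n (g : 'rV[R]_n.+1 -> R) (k : 'I_n) r x :
  derivable g (rV_cons (r, x)) (delta_mx ord0 (lift ord0 k)) =
  derivable (fun x => g (rV_cons (r, x))) x (delta_mx ord0 k) /\
  partial (lift ord0 k) g (rV_cons (r, x)) =
  partial k (fun x => g (rV_cons (r, x))) x.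
Proof.
have E : (fun h : R => h^-1 *: (g (h *: delta_mx ord0 (lift ord0 k) +
      rV_cons (r, x)) - g (rV_cons (r, x)))) =
    (fun h => h^-1 *: (g (rV_cons (r, h *: delta_mx ord0 k + x)) -
      g (rV_cons (r, x)))).
  by apply/funext => h; rewrite rV_cons_lift.
by rewrite /partial /derive /derivable E.
Qed.

Lemma integral_rVS n (f : 'rV[R]_n.+1 -> R) :
  (lebesgue n.+1).-integrable setT (EFin \o f) ->
  (\int[lebesgue n.+1]_x (f x)%:E =
   \int[mu1]_r \int[lebesgue n]_x (f (rV_cons (r, x)))%:E /\
  \int[lebesgue n.+1]_x (f x)%:E =
   \int[lebesgue n]_x \int[mu1]_r (f (rV_cons (r, x)))%:E)%E.
Proof.
move=> fi.
have fi' : (mu1 \x lebesgue n)%E.-integrable setT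
    (fun p => (f (rV_cons p))%:E).
  apply/integrableP; split.
    apply/measurable_EFinP; apply: (measurableT_comp (f := f)) => //.
      by apply/measurable_EFinP; case/integrableP : fi.
    exact: measurable_rV_cons.
  have /integrableP[mf] := fi.
  rewrite [X in (X < _)%E -> _]ge0_integral_pushforward//.
    exact: measurable_rV_cons.
  exact: measurableT_comp.
have -> : (\int[lebesgue n.+1]_x (f x)%:E =
    \int[mu1 \x lebesgue n]_p (f (rV_cons p))%:E)%E.
  apply: (@integral_pushforward _ _ _ _ _ _ (@measurable_rV_cons R n) _ _
    (EFin \o f)) => //.
  by case/integrableP : fi.
split; [exact/esym/(integral12_prod_meas1 fi')|].
exact/esym/(integral21_prod_meas1 fi').
Qed.

(** [lebesgue n.+1] adds a coordinate in front. If j is that coordinate, Fubini with it innermost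
    reduces to the fundamental theorem of calculus; otherwise it is integrated last and induction
    applies to each slice. *)
Lemma integral_partial0 n (g : 'rV[R]_n -> R) (j : 'I_n) (M C : R) :
  (forall x, derivable g x (delta_mx ord0 j)) -> continuous (partial j g) ->
  (forall x, M < `|x| -> g x = 0) -> (forall x, `|partial j g x| <= C) ->
  (\int[lebesgue n]_x (partial j g x)%:E = 0)%E.
Proof.
elim: n g j => [|n IH] g j; first by case: j.
move=> dg cg g0 gC.
have gi : (lebesgue n.+1).-integrable setT (EFin \o partial j g).
  apply: (@integrable_bounded_support _ _ M C) => //.
    by apply: measurable_fun_continuous_rV.
  move=> x Mx; rewrite (near_eq_partial (g := fun=> 0) _ _).2 ?(partial_cst _ _ _).2//.
  by apply: filterS (near_norm_gt Mx) => s /g0.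
have [H1 H2] := integral_rVS gi.
case: (unliftP ord0 j) => [k|] ej; subst j.
- rewrite H1; apply: integral0_eq => r _.
  have E x : partial (lift ord0 k) g (rV_cons (r, x)) =
      partial k (fun x => g (rV_cons (r, x))) x.
    by rewrite (partial_rV_cons_lift _ _ _ _).2.
  under eq_integral do rewrite E.
  apply: IH => [x||x Mx|x].
  + by rewrite -(partial_rV_cons_lift _ _ _ _).1.
  + rewrite (_ : partial k _ =
        (fun x => partial (lift ord0 k) g (rV_cons (r, x)))); last exact/esym/funext.
    move=> x; apply: (@continuous_comp _ _ _ (fun x => rV_cons (r, x)) (partial _ g)).
      exact: rV_cons_continuous.
    exact: cg.
  + by apply: g0; rewrite (lt_le_trans Mx)//; case: (ler_rV_cons_norm (r, x)).
  + by rewrite -E.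
- rewrite H2; apply: integral0_eq => x _.
  pose G r := g (r *: delta_mx ord0 ord0 + rV_cons (0, x)).
  have E r : rV_cons (r, x) = r *: delta_mx ord0 ord0 + rV_cons (0, x).
    by rewrite -rV_consD addr0.
  under eq_integral do rewrite E.
  apply: (@integral_derive0 G _ M) => [t||t Mt].
  + exact: is_derive_line.
  + move=> t; apply: (@continuous_comp _ _ _
        (fun t : R => t *: delta_mx ord0 ord0 + rV_cons (0, x)) (partial _ g)); last exact: cg.
    apply: cvgD; last exact: cvg_cst.
    exact: scalel_continuous.
  + by rewrite /G -E g0// (lt_le_trans Mt)//; case: (ler_rV_cons_norm (t, x)).
Qed.

End integral_partial.

(** * Smooth bump functions *)

Section flat.
Context {R : realType}.
Implicit Types (f g : R -> R) (t x : R).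

(** One-variable counterpart of [Ck]. Carrying the derivative as a witness suits inductions on
    explicit derivatives, as for [flat]. *)
Fixpoint C1k (k : nat) f : Prop :=
  if k is k'.+1 then
    exists2 f', (forall t, is_derive t 1 f (f' t)) & C1k k' f'
  else continuous f.

Lemma is_derive1_continuous f (f' : R -> R) :
  (forall t, is_derive t 1 f (f' t)) -> continuous f.
Proof.
by move=> df t; apply/differentiable_continuous/derivable1_diffP; case: (df t).
Qed.

Lemma C1k_continuous k f : C1k k f -> continuous f.
Proof. by case: k => //= k [f' df _]; exact: is_derive1_continuous df. Qed.

Lemma C1kW k f : C1k k.+1 f -> C1k k f.
Proof.
elim: k f => [|k IH] f; first exact: C1k_continuous.
by move=> [f' df Cf']; exists f' => //; exact: IH.
Qed.

Lemma C1k_cst k (c : R) : C1k k (fun=> c).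
Proof.
elim: k c => [|k IH] c /=; first by move=> x; exact: cvg_cst.
by exists (fun=> 0) => // t; exact: is_derive_cst.
Qed.

Lemma C1kD k f g : C1k k f -> C1k k g -> C1k k (fun t => f t + g t).
Proof.
elim: k f g => [|k IH] f g /=.
  by move=> cf cg t; apply: cvgD; [exact: cf|exact: cg].
move=> [f' df Cf] [g' dg Cg]; exists (fun t => f' t + g' t); last exact: IH.
by move=> t; exact: (is_deriveD (df t) (dg t)).
Qed.

Lemma C1kM k f g : C1k k f -> C1k k g -> C1k k (fun t => f t * g t).
Proof.
elim: k f g => [|k IH] f g.
  by move=> cf cg t; apply: cvgM; [exact: cf|exact: cg].
move=> Cf Cg; have := Cf; have := Cg => -[g' dg Cg'] [f' df Cf'].
exists (fun t => f t * g' t + g t * f' t).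
  by move=> t; exact: (is_deriveM (df t) (dg t)).
by apply: C1kD; apply: IH => //; exact: C1kW.
Qed.

Lemma is_derive1_affine f (f' : R) (c d t : R) :
  is_derive (c * t + d) 1 f f' ->
  is_derive t 1 (fun s => f (c * s + d)) (c * f').
Proof.
move=> df; rewrite mulrC; apply: (@is_derive1_comp _ f (fun s : R => c * s + d)) => //.
have := is_deriveD (is_deriveZ c (is_derive_id t 1)) (is_derive_cst d t 1).
by move=> H; apply: (is_derive_eq H); rewrite addr0 /GRing.scale /= mulr1.
Qed.

Lemma C1k_affine k f (c d : R) : C1k k f -> C1k k (fun t => f (c * t + d)).
Proof.
elim: k f => [|k IH] f.
  move=> cf t; apply: (@continuous_comp _ _ _ (fun s : R => c * s + d) f); last exact: cf.
  by apply: cvgD; [exact: mulrl_continuous|exact: cvg_cst].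
move=> [f' df Cf']; exists (fun t => c * f' (c * t + d)).
  by move=> t; exact: is_derive1_affine.
by apply: C1kM; [exact: C1k_cst|exact: IH].
Qed.

(** Used at the point where two pieces of a function meet with slope 0: 0 for [flat k] and for the
    square of [posp]. *)
Lemma is_derive1_quadratic f (a C : R) :
  f a = 0 -> (forall t, `|f t| <= C * (t - a) ^+ 2) -> is_derive a 1 f 0.
Proof.
move=> fa fC.
have H : h^-1 *: (f (h *: 1 + a) - f a) @[h --> (0 : R)^'] --> (0 : R).
  apply/(@cvgrPdist_le _ _ _ _ _) => e e0.
  have C0 : 0 <= C.
    by have := fC (a + 1); rewrite [a + 1]addrC addrK expr1n mulr1; exact: le_trans.
  exists (e / (C + 1)) => /=; first by rewrite divr_gt0// ltr_wpDl.
  move=> h /=; rewrite sub0r normrN => he h0.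
  rewrite sub0r normrN fa subr0 /GRing.scale /= mulr1 normrM normfV.
  rewrite ler_pdivrMl ?normr_gt0//; apply: (le_trans (fC _)).
  rewrite addrK -real_normK ?num_real// expr2 mulrCA ler_wpM2l//.
  move: he; rewrite ltr_pdivlMr ?ltr_wpDl// => he.
  by apply: le_trans (ltW he); rewrite mulrC mulrDr mulr1 lerDl.
by apply: DeriveDef; [apply/cvg_ex; exists 0|exact: cvg_lim H].
Qed.

(** The powers of 1/x make the family closed under differentiation: the derivative of [flat k] is a
    combination of [flat k.+2] and [flat k.+1]. Smoothness is then an induction over all k at
    once. *)
Definition flat (k : nat) x : R := if 0 < x then x^-1 ^+ k * expR (- x^-1) else 0.

Lemma flat_ge0 k x : 0 <= flat k x.
Proof.
rewrite /flat; case: ifPn => // x0.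
by rewrite mulr_ge0 ?expR_ge0// exprn_ge0// invr_ge0 ltW.
Qed.

(** With y = 1/x this is y^(k+2) / (k+2)! <= exp y, one term of the exponential series. *)
Lemma flat_quadratic k x : `|flat k x| <= k.+2`!%:R * (x - 0) ^+ 2.
Proof.
rewrite ger0_norm ?flat_ge0// subr0 /flat; case: ifPn => x0; last first.
  by rewrite mulr_ge0// sqr_ge0.
have y0 : 0 < x^-1 by rewrite invr_gt0.
rewrite expRN -ler_pdivrMr ?exprn_gt0// -exprVn mulrAC -exprD addn2.
rewrite ler_pdivrMr ?expR_gt0// -ler_pdivrMl ?ltr0n ?fact_gt0// mulrC.
by apply: le_trans (expR_ge1Dxn k.+1 (ltW y0)); rewrite lerDr.
Qed.

Lemma is_derive_flat k x : is_derive x 1 (flat k) (flat k.+2 x - k%:R * flat k.+1 x).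
Proof.
have [x0|x0|->] := ltgtP x 0.
- rewrite /flat ltNge (ltW x0)/= mulr0 subr0.
  apply: (@near_eq_is_derive _ _ _ (cst 0)).
  near=> t; rewrite ifF//; apply/negbTE; rewrite -leNgt.
  by near: t; exact: lt_le_nbhsl.
- apply: (@near_eq_is_derive _ _ _ ((fun y => y ^+ k * expR (- y)) \o GRing.inv)).
    near=> t; rewrite /flat ifT//.
    by near: t; exact: lt_nbhsr.
  have dV : is_derive x 1 (@GRing.inv R) (- x ^- 2).
    have := @is_deriveV R id x 1 1 (lt0r_neq0 x0) (is_derive_id x 1).
    by move=> H; apply: (is_derive_eq H); rewrite /GRing.scale /= mulr1.
  have dE : is_derive (x^-1) 1 (fun y => expR (- y)) (- expR (- x^-1)).
    have := @is_derive1_comp _ expR (-%R) (x^-1) _ _ (is_derive_expR _) (is_deriveNid _ _).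
    by move=> H; apply: (is_derive_eq H); rewrite mulrN1.
  have dX : is_derive (x^-1) 1 (fun y : R => y ^+ k) (k%:R * x^-1 ^+ k.-1).
    have := is_deriveX k (is_derive_id (x^-1) 1).
    by rewrite exprfctE /GRing.scale /= mulr1.
  have := is_derive1_comp (is_deriveM dX dE) dV.
  move=> H; apply: (is_derive_eq H).
  rewrite /flat x0 /GRing.scale /=.
  have -> : k%:R * (x^-1 ^+ k.+1 * expR (- x^-1)) =
      (k%:R * x^-1 ^+ k.-1 * expR (- x^-1)) * x ^- 2.
    case: k {H dX} => [|k]; first by rewrite !mul0r.
    by rewrite -exprVn /= !exprS; ring.
  by rewrite -exprVn !exprS; ring.
- rewrite {2 3}/flat ltxx mulr0 subr0.
  apply: (is_derive1_quadratic (C := k.+2`!%:R)); first by rewrite /flat ltxx.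
  exact: flat_quadratic.
Unshelve. all: by end_near. Qed.

Lemma C1k_flat m k : C1k m (flat k).
Proof.
elim: m k => [|m IH] k.
  by apply: is_derive1_continuous => t; exact: is_derive_flat.
eexists; first by move=> t; exact: is_derive_flat.
have -> : (fun t => flat k.+2 t - k%:R * flat k.+1 t) =
          (fun t => flat k.+2 t + - k%:R * flat k.+1 t).
  by apply/funext => t; rewrite mulNr.
by apply: C1kD => //; apply: C1kM => //; exact: C1k_cst.
Qed.

Lemma flat0_le1 x : flat 0 x <= 1.
Proof.
rewrite /flat; case: ifPn => // x0; rewrite expr0 mul1r -expR0 ler_expR.
by rewrite oppr_le0 invr_ge0 ltW.
Qed.

Lemma flat_gt0 k x : 0 < x -> 0 < flat k x.
Proof.
by move=> x0; rewrite /flat x0 mulr_gt0 ?expR_gt0// exprn_gt0// invr_gt0.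
Qed.

Lemma flat_le0 k x : x <= 0 -> flat k x = 0.
Proof. by rewrite /flat leNgt => /negbTE ->. Qed.

Lemma cvg_flat0 x : flat 0 (m.+1%:R * x) @[m --> \oo] --> ((0 < x)%R%:R : R).
Proof.
have [x0|x0] := ltP 0 x; last first.
  rewrite (_ : (fun m => _) = (fun=> 0)); first exact: cvg_cst.
  by apply/funext => m; rewrite flat_le0// mulr_ge0_le0.
rewrite (_ : (fun m => _) = (fun m => expR (- (x^-1 * m.+1%:R^-1)))); last first.
  by apply/funext => m; rewrite /flat mulr_gt0// expr0 mul1r invfM mulrC.
rewrite -[X in _ --> X]expR0; apply: continuous_cvg; first exact: continuous_expR.
rewrite -oppr0 -[X in - X](mulr0 x^-1); apply: cvgN; apply: cvgMr.
exact: cvg_harmonic.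
Qed.

End flat.

Lemma cvg_prod_seq {R : realType} (T I : Type) (F : set_system T) (s : seq I)
    (f : I -> T -> R) (l : I -> R) : Filter F ->
  (forall i, f i t @[t --> F] --> l i) ->
  \prod_(i <- s) f i t @[t --> F] --> \prod_(i <- s) l i.
Proof.
move=> FF fl; elim: s => [|i s IH].
  by rewrite big_nil; under eq_fun do rewrite big_nil; exact: cvg_cst.
rewrite big_cons; under eq_fun do rewrite big_cons.
by apply: cvgM; [exact: fl|].
Qed.

Lemma cvg_sum_seq {R : realType} (T I : Type) (F : set_system T) (s : seq I)
    (f : I -> T -> R) (l : I -> R) : Filter F ->
  (forall i, f i t @[t --> F] --> l i) ->
  \sum_(i <- s) f i t @[t --> F] --> \sum_(i <- s) l i.
Proof.
move=> FF fl; elim: s => [|i s IH].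
  by rewrite big_nil; under eq_fun do rewrite big_nil; exact: cvg_cst.
rewrite big_cons; under eq_fun do rewrite big_cons.
by apply: cvgD; [exact: fl|].
Qed.

Section Ck_products.
Context {R : realType} {n : nat}.

Lemma partial_prod (f f' : 'I_n -> R -> R) (j : 'I_n) (x : 'rV[R]_n) :
  (forall t : R, is_derive t 1 (f j) (f' j t)) ->
  derivable (fun x : 'rV[R]_n => \prod_i f i (x ord0 i)) x (delta_mx ord0 j) /\
  partial j (fun x : 'rV[R]_n => \prod_i f i (x ord0 i)) x =
    \prod_i (if i == j then f' j else f i) (x ord0 i).
Proof.
move=> df; apply: line_is_derive.
pose c := \prod_(i | i != j) f i (x ord0 i).
rewrite (_ : (fun s => _) = (fun s => c *: f j (1 * s + x ord0 j))); last first.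
  apply/funext => s; rewrite (bigD1 j)//= !mxE !eqxx mulr1 mul1r mulrC.
  congr (_ * _); apply: eq_bigr => i /negbTE ij.
  by rewrite !mxE ij andbF mulr0 add0r.
have := is_deriveZ c (@is_derive1_affine _ (f j) (f' j (x ord0 j)) 1 (x ord0 j) 0 _).
move=> H; apply: (is_derive_eq (H _)).
  by rewrite mulr0 add0r; exact: df.
rewrite mul1r /GRing.scale /= [RHS](bigD1 j)//= eqxx mulrC; congr (_ * _).
by apply: eq_bigr => i /negbTE ->.
Qed.

Lemma Ck_prod k (f : 'I_n -> R -> R) : (forall i, C1k k (f i)) ->
  Ck k (fun x : 'rV[R]_n => \prod_i f i (x ord0 i)).
Proof.
elim: k f => [|k IH] f Cf.
  move=> x; apply: (@cvg_prod_seq R _ _ (nbhs x) (index_enum _)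
    (fun i y => f i (y ord0 i)) (fun i => f i (x ord0 i))) => i.
  apply: (@continuous_comp _ _ _ (fun x : 'rV[R]_n => x ord0 i) (f i)).
    exact: coord_continuous.
  exact: Cf.
move=> j; have [f' df Cf'] := Cf j.
pose F i := if i == j then f' else f i.
have H x := @partial_prod f (fun=> f') j x df.
split; first by move=> x; case: (H x).
rewrite (_ : partial j _ = fun x => \prod_i F i (x ord0 i)); last first.
  by apply/funext => x; rewrite (H x).2.
by apply: IH => i; rewrite /F; case: ifP => // _; exact: C1kW.
Qed.

(** Positive exactly on the open box, and tending pointwise to its indicator as m grows. The limit
    in m serves the fundamental lemma; the case m = 0 is the mollification kernel. *)
Definition box_bump (m : nat) (a b : 'rV[R]_n) (x : 'rV[R]_n) : R :=
  \prod_i (flat 0 (m.+1%:R * (x ord0 i - a ord0 i)) *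
           flat 0 (m.+1%:R * (b ord0 i - x ord0 i))).

Lemma smooth_box_bump m a b : smooth (box_bump m a b).
Proof.
move=> k; rewrite /box_bump.
apply: (@Ck_prod k (fun i t => flat 0 (m.+1%:R * (t - a ord0 i)) *
           flat 0 (m.+1%:R * (b ord0 i - t)))) => i.
apply: C1kM.
  have := @C1k_affine R k (flat 0) (m.+1%:R) (- (m.+1%:R * a ord0 i)) (C1k_flat _ _).
  by congr C1k; apply/funext => t; rewrite mulrBr.
have := @C1k_affine R k (flat 0) (- m.+1%:R) ((m.+1%:R * b ord0 i)) (C1k_flat _ _).
by congr C1k; apply/funext => t; rewrite mulrBr mulNr addrC.
Qed.

Lemma box_bump_ge0 m a b x : 0 <= box_bump m a b x.
Proof. by apply: prodr_ge0 => i _; rewrite mulr_ge0 ?flat_ge0. Qed.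

Lemma box_bump_le1 m a b x : box_bump m a b x <= 1.
Proof.
apply: prodr_ile1 => i _.
by rewrite mulr_ge0 ?flat_ge0//= mulr_ile1 ?flat_ge0 ?flat0_le1.
Qed.

Lemma box_bump_eq0 m (a b x : 'rV[R]_n) :
  ~ (forall i, a ord0 i < x ord0 i < b ord0 i) -> box_bump m a b x = 0.
Proof.
move=> /existsNP[i /negP]; rewrite negb_and -!leNgt => H.
rewrite /box_bump (bigD1 i)//=.
case/orP : H => H; [rewrite (@flat_le0 _ 0 (_ * _))|
  rewrite [X in _ * X * _](@flat_le0 _ 0 (_ * _))]; rewrite ?mul0r ?mulr0 ?mul0r//.
- by rewrite mulr_ge0_le0// subr_le0.
- by rewrite mulr_ge0_le0// subr_le0.
Qed.

Lemma box_bump_gt0 m (a b x : 'rV[R]_n) :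
  (forall i, a ord0 i < x ord0 i < b ord0 i) -> 0 < box_bump m a b x.
Proof.
move=> H; apply: prodr_gt0 => i _; have /andP[ax xb] := H i.
by rewrite mulr_gt0// flat_gt0// mulr_gt0// subr_gt0.
Qed.

Lemma cvg_box_bump a b x : box_bump m a b x @[m --> \oo] -->
  (`[< forall i, a ord0 i < x ord0 i < b ord0 i >]%:R : R).
Proof.
rewrite (_ : _%:R = \prod_(i < n) ((0 < x ord0 i - a ord0 i)%R%:R *
    (0 < b ord0 i - x ord0 i)%R%:R)); last first.
  case: asboolP => [H|/existsNP[i /negP H]].
    by rewrite big1// => i _; have /andP[ax xb] := H i; rewrite !subr_gt0 ax xb mulr1.
  rewrite (bigD1 i)//= !subr_gt0; move: H; rewrite negb_and.
  by move=> /orP[] /negbTE ->; rewrite ?mul0r ?mulr0 ?mul0r.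
by apply: cvg_prod_seq => i; apply: cvgM; exact: cvg_flat0.
Qed.

End Ck_products.

(** * The fundamental lemma of the calculus of variations *)

Section Rintegral_lemmas.
Context d (T : measurableType d) (R : realType) (mu : {measure set T -> \bar R}).
Context (D : set T) (mD : measurable D).
Implicit Types f g : T -> R.

Lemma integrable_measurable_fun f : mu.-integrable D (EFin \o f) -> measurable_fun D f.
Proof. by move=> /integrableP[/measurable_EFinP]. Qed.

Lemma RintegralE f : mu.-integrable D (EFin \o f) ->
  (\int[mu]_(x in D) (f x)%:E = (\int[mu]_(x in D) f x)%R%:E)%E.
Proof. by move=> fi; rewrite /Rintegral fineK//; exact: integrable_fin_num. Qed.

Lemma dominated_cvg_Rintegral (f_ : nat -> T -> R) f g :
  (forall n, measurable_fun D (f_ n)) -> measurable_fun D f ->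
  {ae mu, forall x, D x -> f_ ^~ x @ \oo --> f x} ->
  mu.-integrable D (EFin \o g) ->
  (forall n x, D x -> `|f_ n x| <= g x) ->
  mu.-integrable D (EFin \o f) /\
  (\int[mu]_(x in D) f_ n x @[n --> \oo] --> \int[mu]_(x in D) f x).
Proof.
move=> mf_ mf f_f gi fg.
have H1 m : measurable_fun D (EFin \o f_ m) by exact/measurable_EFinP.
have H2 : measurable_fun D (EFin \o f) by exact/measurable_EFinP.
have H3 : {ae mu, forall x, D x -> (EFin \o f_ m) x @[m --> \oo] --> (EFin \o f) x}.
  by apply: filterS f_f => x /= H' Dx; apply: cvg_EFin; [exact: nearW|exact: H'].
have H4 : {ae mu, forall x m, D x -> (`|(EFin \o f_ m) x| <= (EFin \o g) x)%E}.
  by apply: aeW => x m Dx; rewrite lee_fin; exact: fg.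
have [fi _ H] := dominated_convergence mD H1 H2 H3 gi H4.
by split => //; apply: fine_cvg; rewrite /= -RintegralE.
Qed.

Lemma integrable_bounded_mul f g (C : R) : mu.-integrable D (EFin \o f) ->
  measurable_fun D g -> (forall x, D x -> `|g x| <= C) ->
  mu.-integrable D (EFin \o (fun x => f x * g x)).
Proof.
move=> fi mg gC.
have := integrableMl mD fi mg; apply.
exists C; split; first exact: num_real.
by move=> r Cr x Dx; rewrite /= (le_trans (gC x Dx))// ltW.
Qed.

Lemma integrableD_EFin f g : mu.-integrable D (EFin \o f) ->
  mu.-integrable D (EFin \o g) -> mu.-integrable D (EFin \o (fun x => f x + g x)).
Proof. exact: integrableD. Qed.

Lemma integrableB_EFin f g : mu.-integrable D (EFin \o f) ->
  mu.-integrable D (EFin \o g) -> mu.-integrable D (EFin \o (fun x => f x - g x)).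
Proof. exact: integrableB. Qed.

Lemma integrableZl_EFin (k : R) f : mu.-integrable D (EFin \o f) ->
  mu.-integrable D (EFin \o (fun x => k * f x)).
Proof. exact: (integrableZl mD k). Qed.

Lemma integrable_sum_EFin (I : Type) (s : seq I) (f : I -> T -> R) :
  (forall i, mu.-integrable D (EFin \o f i)) ->
  mu.-integrable D (EFin \o (fun x => \sum_(i <- s) f i x)).
Proof.
move=> fi; elim: s => [|i s IH].
  under eq_fun do rewrite big_nil; exact: integrable0.
under eq_fun do rewrite big_cons; exact: integrableD_EFin.
Qed.

Lemma Rintegral_sum (I : Type) (s : seq I) (f : I -> T -> R) :
  (forall i, mu.-integrable D (EFin \o f i)) ->
  \int[mu]_(x in D) (\sum_(i <- s) f i x) = \sum_(i <- s) \int[mu]_(x in D) f i x.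
Proof.
move=> fi; elim: s => [|i s IH].
  by rewrite big_nil; under eq_Rintegral do rewrite big_nil; rewrite /Rintegral integral0.
rewrite big_cons -IH -RintegralD//; last exact: integrable_sum_EFin.
by apply: eq_Rintegral => x _; rewrite big_cons.
Qed.

End Rintegral_lemmas.

Section fundamental_lemma.
Context {R : realType} {n : nat}.
Local Notation mu := (@lebesgue R n).

(** The coordinate slab a < x_i < b is a countable union of boxes whose other sides are ]-k, k[. *)
Lemma open_box_generate : @measurable _ 'rV[R]_n `<=`
  <<s [set open_box a b | a in setT & b in setT] >>.
Proof.
set G := [set _ | _ in _ & _ in _].
suff mid : measurable_fun setT (id : g_sigma_algebraType G -> 'rV[R]_n).
  by move=> A mA; have := mid measurableT A mA; rewrite setTI preimage_id.
apply/measurable_fun_rV_coordP => i.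
apply: (measurability _ (measurable_realfun.RGenOpens.measurableE R)).
move=> _ [_ [a [b ->] <-]]; rewrite setTI.
pose a' k : 'rV[R]_n := \row_j (if j == i then a else - k%:R).
pose b' k : 'rV[R]_n := \row_j (if j == i then b else k%:R).
rewrite (_ : _ @^-1` _ = \bigcup_k open_box (a' k) (b' k)).
  apply: bigcup_measurable => k _; apply: sub_sigma_algebra.
  by exists (a' k) => //; exists (b' k).
apply/seteqP; split => x /=; rewrite /rV_coord /= in_itv/=.
  move=> xab; exists ((Num.truncn `|x|).+1) => // j; rewrite !mxE.
  case: eqP => [->//|_]; rewrite -ltr_norml (le_lt_trans (ler_coord_norm _ _))//.
  exact: truncnS_gt.
by move=> [k _ /(_ i)]; rewrite !mxE eqxx.
Qed.

Lemma open_boxI (a b a' b' : 'rV[R]_n) : open_box a b `&` open_box a' b' =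
  open_box (\row_i Num.max (a ord0 i) (a' ord0 i)) (\row_i Num.min (b ord0 i) (b' ord0 i)).
Proof.
apply/seteqP; split => x.
  move=> [H H'] i; rewrite !mxE gt_max lt_min.
  by have /andP[-> ->] := H i; have /andP[-> ->] := H' i.
move=> H; split => i; have := H i; rewrite !mxE gt_max lt_min.
  by move=> /andP[/andP[-> _] /andP[-> _]].
by move=> /andP[/andP[_ ->] /andP[_ ->]].
Qed.

Lemma test_box_bump (Omega : set 'rV[R]_n) m a b :
  closed_box a b `<=` Omega -> test Omega (box_bump m a b).
Proof.
move=> abO; split; first exact: smooth_box_bump.
exists (closed_box a b); split => //; first exact: compact_closed_box.
by move=> x nx; apply: box_bump_eq0 => H; apply: nx; exact: open_box_closed_box.
Qed.

Lemma measurable_smooth (D : set 'rV[R]_n) f : measurable D -> smooth f ->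
  measurable_fun D f.
Proof. by move=> mD /(_ 0%N) cf; exact: measurable_fun_continuous_rV. Qed.

(** Bumps give a zero integral of g over boxes, a lambda-system argument extends this to all Borel
    subsets of a box, and a function with zero integral over every Borel set is zero a.e. *)
Lemma fundamental_lemma (Omega : set 'rV[R]_n) (g : 'rV[R]_n -> R) :
  open Omega -> L1loc Omega g ->
  (forall phi, test Omega phi -> \int[mu]_(x in Omega) (g x * phi x) = 0) ->
  ae_on Omega (fun x => g x = 0).
Proof.
move=> oO [mg gloc] g0.
have mO := open_rV_measurable oO.
have [D [a [b [abO Oab]]]] := open_box_cover oO.
(* g is only locally integrable, so the argument runs on one box [Q] whose closure [K] lies in
   Omega. *)
suff H k : D k -> ae_eq mu (open_box (a k) (b k)) (EFin \o g) (cst 0%E).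
  have : {ae mu, forall x, forall k, D k -> open_box (a k) (b k) x -> g x = 0}.
    apply: ae_foralln => k; have [Dk|nDk] := pselect (D k).
      by apply: filterS (H k Dk) => x /= Hx _ xb; have [] := Hx xb.
    by apply: aeW => x.
  apply: filterS => x Hx Ox; have [k Dk xk] := Oab _ Ox.
  exact: Hx Dk xk.
move=> Dk; set Q := open_box (a k) (b k); set K := closed_box (a k) (b k).
have KO : K `<=` Omega by exact: abO.
have QK : Q `<=` K by exact: open_box_closed_box.
have mQ : measurable Q by exact: measurable_open_box.
have mK : measurable K by exact: measurable_closed_box.
have giK : mu.-integrable K (EFin \o g) by apply: gloc => //; exact: compact_closed_box.
have gi : mu.-integrable Q (EFin \o g) by apply: integrableS giK.
have indic_bound (A : set 'rV[R]_n) x : `|\1_A x : R| <= 1.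
  by rewrite indicE; case: (_ \in _); rewrite ?normr1 ?normr0.
(* After intersection with [Q] the box has its closure in [K], so its bumps are test functions; g is
   integrable on [K], which dominates the limit in m. *)
have box0 (a' b' : 'rV[R]_n) : \int[mu]_(x in Q) (g x * \1_(open_box a' b') x) = 0.
  have := open_boxI (a k) (b k) a' b'; set a2 := \row_i _; set b2 := \row_i _ => I.
  have a2b2 : closed_box a2 b2 `<=` K.
    move=> x H i; have := H i; rewrite !mxE ge_max le_min.
    by move=> /andP[/andP[-> _] /andP[-> _]].
  have [|||||_] := @dominated_cvg_Rintegral _ _ _ mu K mK
      (fun m x => g x * box_bump m a2 b2 x) (fun x => g x * \1_(open_box a2 b2) x)
      (fun x => `|g x|).
  - move=> m; apply: measurable_funM; first exact: integrable_measurable_fun giK.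
    by apply: measurable_smooth => //; exact: smooth_box_bump.
  - apply: measurable_funM; first exact: integrable_measurable_fun giK.
    by apply: measurable_indic; exact: measurable_open_box.
  - apply: aeW => x _; apply: cvgMr.
    rewrite indicE; have := @cvg_box_bump R n a2 b2 x.
    by congr (_ --> _); congr (_%:R); apply: asbool_equiv_eq; rewrite inE.
  - exact: integrable_norm giK.
  - move=> m x _; rewrite normrM ler_piMr// ger0_norm ?box_bump_ge0//.
    exact: box_bump_le1.
  rewrite (_ : (fun m => _) = (fun=> 0)); last first.
    apply/funext => m; rewrite -[RHS](g0 (box_bump m a2 b2)).
      rewrite [LHS]Rintegral_mkcond [RHS]Rintegral_mkcond.
      apply: eq_Rintegral => x _; rewrite !patchE.
      case: ifPn => [|/negP]; rewrite inE => xK.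
        by rewrite ifT// inE; exact: KO.
      case: ifPn => // _; rewrite box_bump_eq0 ?mulr0// => H; apply: xK.
      by apply: a2b2; exact: open_box_closed_box.
    by apply: test_box_bump => x /a2b2; exact: KO.
  move=> /(@cvg_lim _ (@Rhausdorff R)); rewrite lim_cst// => H; rewrite [RHS]H.
  rewrite Rintegral_mkcond [RHS]Rintegral_mkcond.
  apply: eq_Rintegral => x _; rewrite !patchE -I !indicE in_setI.
  have [xQ|xQ] := boolP (x \in Q); last by rewrite mulr0 if_same.
  by rewrite ifT// inE; apply: QK; rewrite inE in xQ.
have indicgi (A : set 'rV[R]_n) : measurable A ->
    mu.-integrable Q (EFin \o (fun x => g x * \1_A x)).
  by move=> mA; apply: (@integrable_bounded_mul _ _ _ _ _ _ _ _ 1).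
(* [H] is a lambda-system containing the open boxes, which are stable under intersection and
   generate the Borel sets. *)
pose H := [set A | measurable A /\ \int[mu]_(x in Q) (g x * \1_A x) = 0].
have measH : @measurable _ 'rV[R]_n `<=` H.
  apply: (subset_trans open_box_generate).
  apply: lambda_system_subset => //; last first.
  - by move=> _ [a' _ [b' _ <-]]; split; [exact: measurable_open_box|exact: box0].
  - split => //.
    + split => //; rewrite -[RHS](box0 (a k) (b k)); apply: eq_Rintegral => x xQ.
      by rewrite !indicE in_setT xQ.
    + move=> A B BA [mA A0] [mB B0]; split; first exact: measurableD.
      rewrite -[RHS]subr0 -{1}A0 -B0 -RintegralB//; try exact: indicgi.
      apply: eq_Rintegral => x _; rewrite -mulrBr !indicE in_setD.
      have [xB|xB] := boolP (x \in B); last by rewrite andbT subr0.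
      by rewrite andbF (mem_set (BA _ _)) ?subrr//; rewrite inE in xB.
    + move=> F ndF HF; split; first by apply: bigcup_measurable => i _; case: (HF i).
      have [|||||_] := @dominated_cvg_Rintegral _ _ _ mu Q mQ
        (fun m x => g x * \1_(F m) x) (fun x => g x * \1_(\bigcup_i F i) x)
        (fun x => `|g x|).
      * move=> m; apply: integrable_measurable_fun; apply: indicgi.
        by case: (HF m).
      * apply: integrable_measurable_fun; apply: indicgi.
        by apply: bigcup_measurable => i _; case: (HF i).
      * apply: aeW => x _; apply: cvgMr.
        have [[i _ Fix]|nF] := pselect ((\bigcup_i F i) x); last first.
          rewrite indicE memNset//; rewrite (_ : (fun m => _) = (fun=> 0)); first exact: cvg_cst.
          by apply/funext => m; rewrite indicE memNset// => Fm; apply: nF; exists m.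
        rewrite indicE mem_set; last by exists i.
        apply: cvg_near_cst; exists i => // m /= im.
        by rewrite indicE mem_set//; apply: (subsetPset _ _ (ndF _ _ im)).
      * exact: integrable_norm gi.
      * by move=> m x _; rewrite normrM ler_piMr.
      rewrite (_ : (fun m => _) = (fun=> 0)); last first.
        by apply/funext => m; case: (HF m).
      by move=> /(@cvg_lim _ (@Rhausdorff R)); rewrite lim_cst.
  - move=> _ _ [a1 _ [b1 _ <-]] [a2 _ [b2 _ <-]]; rewrite open_boxI.
    by eexists => //; eexists.
apply: integral_ae_eq => //.
move=> E EQ mE; have [_ HE] := measH E mE.
rewrite /= integral0 -(_ : (\int[mu]_(x in Q) (g x * \1_E x)%:E = 0)%E); last first.
  by rewrite RintegralE ?HE//; exact: indicgi.
rewrite integral_mkcond [RHS]integral_mkcond; apply: eq_integral => x _.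
rewrite !patchE indicE; have [xE|xE] := boolP (x \in E); last by rewrite mulr0 if_same.
by rewrite ifT ?mulr1// inE; apply: EQ; rewrite inE in xE.
Qed.

End fundamental_lemma.

(** * Convolution and mollification *)

Section compact_rV.
Context {R : realType} {n : nat}.
Implicit Types (f : 'rV[R]_n -> R) (A U : set 'rV[R]_n).

Lemma closed_ball_rV_compact (M : R) : compact [set x : 'rV[R]_n | `|x| <= M].
Proof.
apply: bounded_closed_compact.
  by exists M; split; [exact: num_real|move=> r Mr x Ax; rewrite /= (le_trans Ax)// ltW].
apply: (@closed_comp _ _ (fun x : 'rV[R]_n => `|x|) [set r | r <= M]).
  by move=> x _; exact: norm_continuous.
exact: closed_le.
Qed.

(** A Lebesgue number argument for an arbitrary property of radius and centre, so that uniform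
    continuity and the positive distance from a compact set to the complement of an open set are
    both instances. *)
Lemma compact_uniform_radius A (P : R -> 'rV[R]_n -> Prop) : compact A ->
  (forall x r r', r' <= r -> P r x -> P r' x) ->
  (forall x, A x -> exists2 r, 0 < r & forall x', `|x - x'| < r -> P r x') ->
  exists2 r, 0 < r & forall x, A x -> P r x.
Proof.
move=> /compact_near_coveringP cA Pdec AP.
have H := cA R (0 : R)^'+ P _.
near ((0 : R)^'+) => r.
exists r => //; near: r; apply: H => x /AP[r r0 Hr].
exists (ball x r, [set s | s < r]).
  by split; [exact: nbhsx_ballx|exact: nbhs_right_lt].
move=> [y s] /= [xy sr]; apply: (Pdec _ r); first exact: ltW.
by apply: Hr; rewrite -ball_normE in xy.
Unshelve. all: by end_near. Qed.

Lemma compact_unif_continuous f A (e : R) : 0 < e -> compact A ->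
  (forall x, A x -> {for x, continuous f}) ->
  exists2 r : R, 0 < r & forall x y, A x -> `|x - y| < r -> `|f x - f y| <= e.
Proof.
move=> e0 cA cf.
have e20 : 0 < e / 2 by rewrite divr_gt0.
have [x r r' rr' Hr y xy||r r0 H] := @compact_uniform_radius A
  (fun r x => forall y, `|x - y| < r -> `|f x - f y| <= e) cA.
- by apply: Hr; exact: lt_le_trans rr'.
- move=> x Ax; have /(@cvgrPdist_le _ _ _ (nbhs x) _)/(_ _ e20) := cf _ Ax.
  move=> /nbhs_ballP[r /= r0]; rewrite -ball_normE /= => Hr.
  exists (r / 2); first by rewrite divr_gt0.
  move=> x' xx' y xy.
  have -> : f x' - f y = - (f x - f x') + (f x - f y) by ring.
  rewrite (le_trans (ler_normD _ _))// normrN [leRHS]splitr lerD//.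
    by apply: Hr => /=; lra.
  apply: Hr => /=; have -> : x - y = (x - x') + (x' - y) by rewrite addrA subrK.
  by rewrite (le_lt_trans (ler_normD _ _))//; lra.
- by exists r => // x y Ax; exact: H.
Qed.

Lemma compact_open_dist A U : compact A -> open U -> A `<=` U ->
  exists2 r : R, 0 < r & forall x y, A x -> `|x - y| < r -> U y.
Proof.
move=> cA oU AU.
have [x r r' rr' Hr y xy||r r0 H] := @compact_uniform_radius A
  (fun r x => forall y, `|x - y| < r -> U y) cA.
- by apply: Hr; exact: lt_le_trans rr'.
- move=> x /AU Ux; have /nbhs_ballP[r /= r0] := open_nbhs_nbhs (conj oU Ux).
  rewrite -ball_normE /= => Hr.
  exists (r / 2); first by rewrite divr_gt0.
  move=> x' xx' y xy; apply: Hr => /=.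
  have -> : x - y = (x - x') + (x' - y) by rewrite addrA subrK.
  by rewrite (le_lt_trans (ler_normD _ _))//; lra.
- by exists r => // x y Ax; exact: H.
Qed.

Lemma continuous_subr f (x : 'rV[R]_n) : continuous f ->
  continuous (fun s : 'rV[R]_n => f (x - s)).
Proof.
move=> cf y.
apply: (@continuous_comp 'rV[R]_n 'rV[R]_n R (fun s => x - s) f); last exact: cf.
apply/(@cvgrPdist_lt _ _ _ (nbhs y) _) => e e0; apply/nbhs_ballP; exists e => //= s.
have -> : x - y - (x - s) = s - y by rewrite opprB addrC addrA subrK.
by rewrite -ball_normE /= distrC.
Qed.

Definition bounded_support f := exists M : R, forall x, M < `|x| -> f x = 0.

Lemma bounded_support_unif_continuous f (e : R) : 0 < e ->
  bounded_support f -> continuous f ->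
  exists2 r : R, 0 < r & forall x y, `|x - y| < r -> `|f x - f y| <= e.
Proof.
move=> e0 [M fM] cf.
(* With radius M + 1 and steps shorter than 1, a point outside this ball has its neighbour outside
   the ball of radius M, where both values are 0. *)
have [r r0 Hr] := compact_unif_continuous e0 (@closed_ball_rV_compact (M + 1))
  (fun x _ => cf x).
exists (Num.min r 1); first by rewrite lt_min r0 ltr01.
move=> x y; rewrite lt_min => /andP[xyr xy1].
have [xM|xM] := leP `|x| (M + 1); first exact: Hr.
rewrite !fM ?subrr ?normr0 ?ltW//.
  rewrite -(ltrD2r 1); apply: (lt_le_trans xM).
  have {1}-> : x = y + (x - y) by rewrite addrC subrK.
  by rewrite (le_trans (ler_normD _ _))// lerD2l ltW.
by apply: lt_trans xM; rewrite ltrDl.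
Qed.

Lemma bounded_support_bounded f : bounded_support f -> continuous f ->
  exists C : R, forall x, `|f x| <= C.
Proof.
move=> [M fM] cf.
have := @closed_ball_rV_compact M.
have cfM : {within [set x : 'rV[R]_n | `|x| <= M], continuous f}.
  exact: continuous_subspaceT.
move=> /(continuous_compact cfM)/compact_bounded[C [_ HC]].
exists (`|C| + 1) => x; have [xM|xM] := leP `|x| M; last by rewrite fM// normr0 addr_ge0.
apply: (HC (`|C| + 1)); last by exists x.
by rewrite (le_lt_trans (ler_norm _))// ltrDl.
Qed.

Lemma bounded_support_partial f j : bounded_support f ->
  bounded_support (partial j f).
Proof.
move=> [M fM]; exists M => x Mx.
rewrite (near_eq_partial (g := fun=> 0) _ _).2 ?(partial_cst _ _ _).2//.
by apply: filterS (near_norm_gt Mx) => s /fM.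
Qed.

Lemma bounded_support_integrable f : bounded_support f -> continuous f ->
  (lebesgue n).-integrable setT (EFin \o f).
Proof.
move=> bf cf; have [C fC] := bounded_support_bounded bf cf; case: bf => M fM.
by apply: (integrable_bounded_support _ fM fC); exact: measurable_fun_continuous_rV.
Qed.

Lemma integral_partial_eq0 f j : bounded_support f ->
  (forall x, derivable f x (delta_mx ord0 j)) -> continuous (partial j f) ->
  \int[lebesgue n]_x partial j f x = 0.
Proof.
move=> bf df cf.
have [C fC] := bounded_support_bounded (bounded_support_partial j bf) cf.
by case: bf => M fM; rewrite /Rintegral (integral_partial0 df cf fM fC).
Qed.

Lemma compact_bounded_support f A : compact A -> (forall x, ~ A x -> f x = 0) ->
  bounded_support f.
Proof.
move=> /compact_bounded[M [_ AM]] fA; exists (`|M| + 1) => x Mx.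
apply: fA => Ax; have M1 : M < `|M| + 1 by rewrite (le_lt_trans (ler_norm _)) ?ltrDl.
by have := AM _ M1 x Ax; rewrite /= leNgt Mx.
Qed.

Lemma compact_closure_bounded A : bounded_set A -> compact (closure A).
Proof.
move=> [M [_ HM]].
have cB := @closed_ball_rV_compact (`|M| + 1).
apply: (subclosed_compact _ cB); first exact: closed_closure.
have /closure_id -> : closed [set x : 'rV[R]_n | `|x| <= `|M| + 1].
  by apply: compact_closed cB; exact: norm_hausdorff.
apply: closure_subset => x Ax; apply: HM => //.
by rewrite (le_lt_trans (ler_norm _)) ?ltrDl.
Qed.

End compact_rV.

(** * Invariance of Lebesgue measure under reflection *)

Section reflect.
Context {R : realType}.
Local Notation mu1 := (@lebesgue_measure R).

(** By uniqueness of Lebesgue measure it is enough to compare on the generating half-open intervals;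
    reflection only exchanges which endpoint is included. *)
Lemma lebesgue_measure_subr (r : R) (A : set R) : measurable A ->
  pushforward mu1 ((fun t => r - t) : _ -> measurableTypeR R) A = mu1 A.
Proof.
move=> mA; apply/esym.
have mf : measurable_fun setT ((fun t => r - t) : measurableTypeR R -> measurableTypeR R).
  by apply: measurable_funB.
pose nu := measure_function_pushforward__canonical__measure_function_Measure mu1 mf.
apply: (@lebesgue_measure_unique R nu) => // _ [[a b]] _ <-.
rewrite /nu /= /pushforward.
rewrite (_ : _ @^-1` _ = `[r - b, r - a[%classic); last first.
  by apply/seteqP; split => t; rewrite /= !in_itv/=; lra.
rewrite !lebesgue_measure_itv/= !lte_fin.
have -> : (r - b < r - a) = (a < b) by apply/idP/idP; lra.
by case: ifPn => // _; rewrite -!EFinB; congr EFin; ring.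
Qed.

Lemma ge0_integral_subr1 (r : R) (f : R -> \bar R) : measurable_fun setT f ->
  (forall x, 0 <= f x)%E -> (\int[mu1]_t f (r - t)%R = \int[mu1]_t f t)%E.
Proof.
move=> mf f0.
have mr : measurable_fun setT ((fun t => r - t) : measurableTypeR R -> measurableTypeR R).
  by apply: measurable_funB.
rewrite -[LHS](@ge0_integral_pushforward _ _ _ _ _ _ mr mu1 setT f)//.
by apply: eq_measure_integral => A mA _; exact: lebesgue_measure_subr.
Qed.

Lemma ge0_integral_rVS n (f : 'rV[R]_n.+1 -> \bar R) : measurable_fun setT f ->
  (forall x, 0 <= f x)%E ->
  (\int[lebesgue n.+1]_x f x = \int[mu1]_r \int[lebesgue n]_x f (rV_cons (r, x)))%E.
Proof.
move=> mf f0.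
rewrite [LHS](@ge0_integral_pushforward _ _ _ _ _ _ (@measurable_rV_cons R n)
  (mu1 \x lebesgue n)%E setT f)//.
rewrite preimage_setT (@fubini_tonelli1 _ _ _ _ _ mu1 (lebesgue n))//.
  exact: measurableT_comp (@measurable_rV_cons R n).
by move=> p; exact: f0.
Qed.

(** Reflection one coordinate at a time, by Tonelli. It shows that the kernel s -> [B r (x - s)] has
    the same mass for every x. *)
Lemma ge0_integral_subr n (x : 'rV[R]_n) (f : 'rV[R]_n -> R) : continuous f ->
  (forall x, 0 <= f x) ->
  (\int[lebesgue n]_s (f (x - s))%:E = \int[lebesgue n]_s (f s)%:E)%E.
Proof.
elim: n x f => [|n IH] x f cf f0.
  by apply: eq_integral => s _; congr (f _)%:E; apply/rowP; case.
have mf : measurable_fun setT (EFin \o f).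
  by apply/measurable_EFinP; exact: measurable_fun_continuous_rV.
have mfx : measurable_fun setT (fun s : 'rV[R]_n.+1 => (f (x - s))%:E).
  apply/measurable_EFinP; apply: measurable_fun_continuous_rV => //.
  exact: continuous_subr.
have fx0 y : (0 <= (f (x - y))%:E)%E by rewrite lee_fin.
rewrite (ge0_integral_rVS mfx fx0) (ge0_integral_rVS mf f0).
have -> : (fun r => \int[lebesgue n]_s (f (x - rV_cons (r, s)))%:E)%E =
    (fun r => \int[lebesgue n]_s (f (rV_cons (x ord0 ord0 - r, s)))%:E)%E.
  apply/funext => r.
  rewrite -[RHS](IH (\row_j x ord0 (lift ord0 j)) (fun s => f (rV_cons (_, s)))) //.
    apply: eq_integral => s _; congr (f _)%:E; apply/rowP => i.
    rewrite !mxE; case: (unliftP ord0 i) => [j ->|->] //=.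
    by rewrite !mxE.
  move=> y; apply: (@continuous_comp _ _ _ (fun x => rV_cons (_, x)) f).
    exact: rV_cons_continuous.
  exact: cf.
apply: (@ge0_integral_subr1 (x ord0 ord0)
  (fun r => \int[lebesgue n]_s (f (rV_cons (r, s)))%:E)%E).
  apply: (@measurable_fun_fubini_tonelli_F _ _ _ _ _ (lebesgue n)
    (fun p => (f (rV_cons p))%:E)).
  by apply: (measurableT_comp mf); exact: measurable_rV_cons.
  by move=> p; rewrite lee_fin.
by move=> r; apply: integral_ge0 => s _; rewrite lee_fin.
Qed.

End reflect.

Section convolution.
Context {R : realType} {n : nat}.
Implicit Types (v K : 'rV[R]_n -> R).
Local Notation mu := (@lebesgue R n).
Local Notation e := (@delta_mx R 1 n ord0).

Definition convolution v K (x : 'rV[R]_n) : R := \int[mu]_s (v s * K (x - s)).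

Lemma integrable_convolution v K x :
  mu.-integrable setT (EFin \o v) -> bounded_support K -> continuous K ->
  mu.-integrable setT (EFin \o (fun s => v s * K (x - s))).
Proof.
move=> iv bK cK; have [C KC] := bounded_support_bounded bK cK.
apply: (@integrable_bounded_mul _ _ _ _ _ measurableT _ _ C) => //.
by apply: measurable_fun_continuous_rV => //; exact: continuous_subr.
Qed.

(** Differentiation under the integral sign, dominated by |v| times a bound of [partial j K]. *)
Lemma partial_convolution v K j x :
  mu.-integrable setT (EFin \o v) -> bounded_support K -> continuous K ->
  (forall y, derivable K y (e j)) -> continuous (partial j K) ->
  derivable (convolution v K) x (e j) /\
  partial j (convolution v K) x = convolution v (partial j K) x.
Proof.
move=> iv bK cK dK cdK.
have [C KC] := bounded_support_bounded (bounded_support_partial j bK) cdK.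
pose f (t : R) (s : 'rV[R]_n) := v s * K (t *: e j + x - s).
have df (t : R) s : is_derive t 1 (f ^~ s) (v s * partial j K (t *: e j + x - s)).
  rewrite /f; under eq_fun do rewrite -addrA.
  rewrite -addrA.
  exact: (is_deriveZ (v s) (is_derive_line (dK _))).
have d1f t s : partial1of2 f t s = v s * partial j K (t *: e j + x - s).
  by rewrite partial1of2E; exact: derive_val.
have H := @cvg_differentiation_under_integral R _ _ mu f setT measurableT 0 (-1) 1.
apply: line_is_derive.
have {}H : h^-1 *: ((\int[mu]_s f (h *: 1 + 0) s) - \int[mu]_s f 0 s) @[h --> (0:R)^'] -->
    convolution v (partial j K) x.
  rewrite (_ : convolution _ _ _ = \int[mu]_s partial1of2 f 0 s); last first.
    by apply: eq_Rintegral => s _; rewrite d1f scale0r add0r.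
  under eq_fun do rewrite /GRing.scale /= mulr1.
  apply: (H _ _ _ (fun s => `|v s| * C)).
  - by rewrite /= in_itv/=; lra.
  - by move=> t _; exact: integrable_convolution.
  - by move=> t s _ _; case: (df t s).
  - by move=> s; rewrite mulr_ge0// (le_trans _ (KC 0)).
  - apply: (@integrable_bounded_mul _ _ _ _ _ measurableT _ _ `|C|) => //.
    by exact: integrable_norm iv.
  - by move=> t s _ _; rewrite d1f normrM ler_wpM2l.
by apply: DeriveDef; [apply/cvg_ex; eexists; exact: H|exact: cvg_lim H].
Qed.

Lemma continuous_convolution v K :
  mu.-integrable setT (EFin \o v) -> bounded_support K -> continuous K ->
  continuous (convolution v K).
Proof.
move=> iv bK cK x.
pose I := \int[mu]_s `|v s|.
have I0 : 0 <= I by apply: Rintegral_ge0.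
apply/(@cvgrPdist_le _ _ _ (nbhs x) _) => eps eps0.
have d0 : 0 < eps / (I + 1) by rewrite divr_gt0// ltr_wpDl.
have [r r0 Kr] := bounded_support_unif_continuous d0 bK cK.
apply/nbhs_ballP; exists r => //= y; rewrite -ball_normE /= => xy.
have ix := integrable_convolution x iv bK cK.
have iy := integrable_convolution y iv bK cK.
rewrite /convolution -RintegralB//.
have iB : mu.-integrable setT (EFin \o (fun s => v s * K (x - s) - v s * K (y - s))).
  exact: integrableB_EFin.
apply: (le_trans (le_normr_Rintegral _ iB)) => //.
apply: (@le_trans _ _ (\int[mu]_s (eps / (I + 1) * `|v s|))).
  apply: le_Rintegral => //.
  - exact: integrable_norm iB.
  - by apply: integrableZl_EFin => //; exact: integrable_norm iv.
  - move=> s _ /=; rewrite -mulrBr normrM mulrC ler_wpM2r//.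
    by apply: Kr; rewrite opprB addrA subrK.
rewrite RintegralZl//; last exact: integrable_norm iv.
by rewrite -/I mulrAC ler_pdivrMr ?ltr_wpDl// ler_wpM2l ?lerDl// ltW.
Qed.

Lemma smooth_continuous K : smooth K -> continuous K.
Proof. by move=> /(_ 0%N). Qed.

Lemma smooth_derivable K j x : smooth K -> derivable K x (e j).
Proof. by move=> /(_ 1%N)/(_ j)[]. Qed.

Lemma smooth_partial K j : smooth K -> smooth (partial j K).
Proof. by move=> sK k; case: (sK k.+1 j). Qed.

Lemma smooth_convolution v K : mu.-integrable setT (EFin \o v) ->
  bounded_support K -> smooth K -> smooth (convolution v K).
Proof.
move=> iv bK sK k; elim: k K bK sK => [|k IH] K bK sK.
  by apply: continuous_convolution => //; exact: smooth_continuous.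
have H j x := @partial_convolution v K j x iv bK (smooth_continuous sK)
  (fun y => smooth_derivable sK) (smooth_continuous (smooth_partial j sK)).
move=> j; split; first by move=> x; case: (H j x).
rewrite (_ : partial j _ = convolution v (partial j K)).
  by apply: IH; [exact: bounded_support_partial|exact: smooth_partial].
by apply/funext => x; case: (H j x).
Qed.

Lemma partial_subr K j x s : derivable K (x - s) (e j) ->
  derivable (fun s => K (x - s)) s (e j) /\
  partial j (fun s => K (x - s)) s = - partial j K (x - s).
Proof.
move=> dK; apply: line_is_derive.
rewrite (_ : (fun t => _) = (fun t : R => K ((-1 * t + 0) *: e j + (x - s)))); last first.
  by apply/funext => t; rewrite addr0 mulN1r scaleNr opprD addrCA.
have H := @is_derive1_affine R (fun t : R => K (t *: e j + (x - s)))
  (partial j K (x - s)) (-1) 0 0.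
apply: (is_derive_eq (H _)); last by rewrite mulN1r.
by rewrite mulr0 addr0; exact: is_derive_line0.
Qed.

(** The function s -> [v s * K (x - s)] has bounded support, so its partial derivative has integral
    0; the sign from x - s turns this into the equality. *)
Lemma convolution_partial v K j x : bounded_support v -> continuous v ->
  (forall y, derivable v y (e j)) -> continuous (partial j v) ->
  smooth K -> bounded_support K ->
  convolution v (partial j K) x = convolution (partial j v) K x.
Proof.
move=> bv cv dv cdv sK bK.
have iv := bounded_support_integrable bv cv.
have idv := bounded_support_integrable (bounded_support_partial j bv) cdv.
have H s := @partial_subr K j x s (smooth_derivable sK).
have P s := partialM (dv s) (H s).1.
have E : partial j (fun s => v s * K (x - s)) =
    (fun s => partial j v s * K (x - s) - v s * partial j K (x - s)).
  by apply/funext => s; rewrite (P s).2 (H s).2 mulrN addrC.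
have i1 := integrable_convolution x iv (bounded_support_partial j bK)
  (smooth_continuous (smooth_partial j sK)).
have i2 := integrable_convolution x idv bK (smooth_continuous sK).
have := @integral_partial_eq0 R n (fun s => v s * K (x - s)) j.
rewrite E RintegralB// => H0; apply/esym/eqP; rewrite -subr_eq0; apply/eqP/H0.
- by case: bv => M vM; exists M => s Ms; rewrite vM// mul0r.
- by move=> s; case: (P s).
- move=> s; apply: (@continuousB _ _ _ (fun s => partial j v s * K (x - s))
      (fun s => v s * partial j K (x - s))).
    apply: (@continuousM _ _ (partial j v) (fun s => K (x - s))); first exact: cdv.
    by apply: continuous_subr; exact: smooth_continuous.
  apply: (@continuousM _ _ v (fun s => partial j K (x - s))); first exact: cv.
  by apply: continuous_subr; apply: smooth_continuous; exact: smooth_partial.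
Qed.

End convolution.

Section mollification.
Context {R : realType} {n : nat}.
Implicit Types (v : 'rV[R]_n -> R).
Local Notation mu := (@lebesgue R n).
Local Notation e := (@delta_mx R 1 n ord0).

(** The norm of row vectors is the sup norm, so this cube is the ball of radius r. *)
Let B (r : R) : 'rV[R]_n -> R := box_bump 0 (const_mx (- r)) (const_mx r).

Let B_eq0 r x : r <= `|x| -> 0 < r -> B r x = 0.
Proof.
move=> rx r0; apply: box_bump_eq0 => H.
suff : `|x| < r by rewrite ltNge rx.
by apply: ltr_rV_norm => // i; have := H i; rewrite !mxE ltr_norml.
Qed.

Let B_bounded r : 0 < r -> bounded_support (B r).
Proof. by move=> r0; exists r => x rx; apply: B_eq0 => //; exact: ltW. Qed.

Let cB r : continuous (B r).
Proof. exact: smooth_continuous (smooth_box_bump _ _ _). Qed.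

Let mass r := \int[mu]_s B r s.

Let iB r : 0 < r -> mu.-integrable setT (EFin \o B r).
Proof. by move=> r0; apply: bounded_support_integrable; [exact: B_bounded|exact: cB]. Qed.

Let mass_subr r x : \int[mu]_s B r (x - s) = mass r.
Proof.
rewrite /mass /Rintegral (@ge0_integral_subr R n x (B r) (@cB r))//.
by move=> y; exact: box_bump_ge0.
Qed.

(** Otherwise the kernel would vanish a.e., although it is positive on the cube of half-side r/2,
    which has positive measure. *)
Let mass_gt0 r : 0 < r -> 0 < mass r.
Proof.
move=> r0; rewrite lt_neqAle Rintegral_ge0 ?andbT; last first.
  by move=> x _; exact: box_bump_ge0.
apply/eqP => /esym m0.
have B0 : {ae mu, forall x, B r x = 0}.
  have : (\int[mu]_s `|(B r s)%:E| = 0)%E.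
    rewrite (_ : (fun s => _) = (fun s => (B r s)%:E)); last first.
      by apply/funext => s; rewrite gee0_abs// lee_fin box_bump_ge0.
    by rewrite (RintegralE measurableT (iB r0)) -/(mass r) m0.
  move/(ae_eq_integral_abs mu measurableT (f := EFin \o B r)).
  move=> H; apply: filterS (H _) => [x /= /(_ I) []//|].
  by apply/measurable_EFinP; exact: measurable_fun_continuous_rV (@cB r).
have [N [mN N0 BN]] := B0.
pose Q : set 'rV[R]_n := closed_box (const_mx (- (r / 2))) (const_mx (r / 2)).
have QN : Q `<=` N.
  move=> x Qx; apply: BN => /= Bx.
  suff : 0 < B r x by rewrite Bx ltxx.
  by apply: box_bump_gt0 => i; have := Qx i; rewrite !mxE; lra.
have : (mu Q <= 0)%E.
  by rewrite -N0; apply: le_measure; rewrite ?inE//; exact: measurable_closed_box.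
have -> : mu Q = (\prod_(i < n) (r / 2 - - (r / 2)))%:E.
  have := @lebesgue_box R n (const_mx (- (r / 2))) (const_mx (r / 2)).
  rewrite (eq_bigr (fun=> (r / 2 - - (r / 2)))); last by move=> i _; rewrite !mxE.
  move=> <-; last by move=> i; rewrite !mxE; lra.
  congr (mu _); apply/seteqP; split => x H i; have := H i; by rewrite in_itv.
rewrite lee_fin leNgt => /negP; apply; apply: prodr_gt0 => i _; lra.
Qed.

(** The normalising factor is attached to v, which leaves [B r] as the smooth kernel of the
    convolution lemmas. *)
Let mollify r v := convolution (fun s => (mass r)^-1 * v s) (B r).

Let mollify_close r v eps : 0 < r -> mu.-integrable setT (EFin \o v) ->
  (forall x y, `|x - y| < r -> `|v x - v y| <= eps) ->
  forall x, `|mollify r v x - v x| <= eps.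
Proof.
move=> r0 iv vr x.
have m0 := mass_gt0 r0.
have iBx : mu.-integrable setT (EFin \o (fun s => B r (x - s))).
  apply: bounded_support_integrable; last exact: continuous_subr (@cB r).
  exists (r + `|x|) => s rs; apply: B_eq0 => //.
  have : `|s| <= `|x| + `|x - s|.
    have {1}-> : s = x - (x - s) by rewrite opprB addrC subrK.
    exact: ler_normB.
  by move: rs; lra.
have ivx : mu.-integrable setT (EFin \o (fun s => ((mass r)^-1 * v s) * B r (x - s))).
  by apply: integrable_convolution; [exact: integrableZl_EFin|exact: B_bounded|exact: cB].
(* The number v x is itself an average against the normalised kernel, so the difference is the
   average of v s - v x over |x - s| < r. *)
have -> : v x = \int[mu]_s ((mass r)^-1 * v x * B r (x - s)).
  by rewrite RintegralZl// mass_subr mulrAC mulVf ?mul1r// gt_eqF.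
rewrite /mollify /convolution -RintegralB//; last exact: integrableZl_EFin.
apply: (le_trans (le_normr_Rintegral _ _)) => //.
  by apply: integrableB_EFin => //; exact: integrableZl_EFin.
apply: (@le_trans _ _ (\int[mu]_s ((mass r)^-1 * eps * B r (x - s)))).
  apply: le_Rintegral => //.
  - by apply: integrable_norm; apply: integrableB_EFin => //; exact: integrableZl_EFin.
  - exact: integrableZl_EFin.
  - move=> s _ /=; rewrite -mulrBl -mulrBr !normrM gtr0_norm ?invr_gt0//.
    have [xs|xs] := ltP `|x - s| r; last by rewrite (B_eq0 xs r0) normr0 !mulr0.
    rewrite (ger0_norm (box_bump_ge0 _ _ _ _)) ler_wpM2r ?box_bump_ge0//.
    apply: ler_wpM2l; first by rewrite invr_ge0 ltW.
    by apply: vr; rewrite distrC.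
by rewrite RintegralZl// mass_subr mulrAC mulVf ?mul1r// gt_eqF.
Qed.

Lemma test_approximation (Omega : set 'rV[R]_n) v (K : set 'rV[R]_n) (eps : R) :
  open Omega -> compact K -> K `<=` Omega -> (forall x, ~ K x -> v x = 0) ->
  continuous v -> (forall j x, derivable v x (e j)) ->
  (forall j, continuous (partial j v)) -> 0 < eps ->
  exists phi, [/\ test Omega phi, forall x, `|phi x - v x| <= eps
    & forall j x, `|partial j phi x - partial j v x| <= eps].
Proof.
move=> oO cK KO vK cv dv cdv eps0.
have bv := compact_bounded_support cK vK.
have iv := bounded_support_integrable bv cv.
have bdv j := bounded_support_partial j bv.
have idv j := bounded_support_integrable (bdv j) (cdv j).
have [r1 r10 Hr1] := compact_open_dist cK oO KO.
have [r2 r20 Hr2] := bounded_support_unif_continuous eps0 bv cv.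
have [r3 r30 Hr3] : exists2 r, 0 < r & forall j x y, `|x - y| < r ->
    `|partial j v x - partial j v y| <= eps.
  have H j := bounded_support_unif_continuous eps0 (bdv j) (cdv j).
  pose rj j := s2val (cid2 (H j)).
  exists (\big[Num.min/1]_j rj j).
    by apply/bigmin_gtP; split => // j _; rewrite /rj; case: cid2.
  move=> j x y /bigmin_gtP[_ /(_ j isT)]; rewrite /rj; case: cid2 => r /= _; exact.
(* [r1] is the distance that must be kept from the complement of Omega; [r2] and [r3] are the moduli
   of uniform continuity of v and of its partial derivatives. Halving [r1] leaves room for the
   closure of the support. *)
pose r := Num.min (r1 / 2) (Num.min r2 r3).
have r0 : 0 < r by rewrite !lt_min divr_gt0// r20.
have rr1 : r <= r1 / 2 by rewrite ge_min lexx.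
have [rr2 rr3] : r <= r2 /\ r <= r3 by rewrite !ge_min !lexx !orbT.
have sB : smooth (B r) by exact: smooth_box_bump.
have bB := B_bounded r0.
have mE w : mu.-integrable setT (EFin \o w) ->
    mollify r w = fun x => (mass r)^-1 * convolution w (B r) x.
  move=> iw; apply/funext => x; rewrite /mollify /convolution -RintegralZl//.
    by apply: eq_Rintegral => s _; rewrite mulrA.
  exact: integrable_convolution iw bB (@cB r).
have E j : partial j (mollify r v) = mollify r (partial j v).
  rewrite !mE//; apply/funext => x.
  have [d1 d2] := @partial_convolution _ _ v (B r) j x iv bB (@cB r)
    (fun=> smooth_derivable sB) (smooth_continuous (smooth_partial j sB)).
  have [_ H] := partialZ (mass r)^-1 d1.
  rewrite H d2; congr (_ * _).
  exact: (convolution_partial x bv cv (dv j) (cdv j) sB bB).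
have phi0 x : (forall s, K s -> r <= `|x - s|) -> mollify r v x = 0.
  move=> H; rewrite /mollify /convolution.
  rewrite (_ : (fun s => _) = (fun=> 0)) ?/Rintegral ?integral0//.
  apply/funext => s; have [Ks|nKs] := pselect (K s); last by rewrite vK// mulr0 mul0r.
  by rewrite (B_eq0 (H s Ks) r0) mulr0.
exists (mollify r v); split.
- split.
    apply: smooth_convolution => //; exact: integrableZl_EFin.
  have supp x : mollify r v x != 0 -> exists2 s, K s & `|x - s| < r.
    move=> phix; apply: contrapT => nex; move/eqP : phix; apply; apply: phi0 => s Ks.
    by rewrite leNgt; apply/negP => xs; apply: nex; exists s.
  exists (closure [set x | mollify r v x != 0]); split.
  + have [M [_ KM]] := compact_bounded cK.
    apply: (@subclosed_compact _ _ _ (@closed_closure _ _)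
      (@closed_ball_rV_compact R n (`|M| + 1 + r))).
    have cl : closed [set x : 'rV[R]_n | `|x| <= `|M| + 1 + r].
      exact: compact_closed (@norm_hausdorff _ _) (@closed_ball_rV_compact _ _ _).
    rewrite [X in _ `<=` X](closure_id _).1//; apply: closure_subset => x /= /supp[s Ks xs].
    have {1}-> : x = s + (x - s) by rewrite addrC subrK.
    have M1 : M < `|M| + 1 by rewrite (le_lt_trans (ler_norm _))// ltrDl.
    rewrite (le_trans (ler_normD _ _))//.
    by apply: lerD; [exact: (KM _ M1 _ Ks)|exact: ltW].
  (* A point of the closed support is within r1/2 of a point where the mollification is nonzero,
     which is itself within r <= r1/2 of [K]. *)
  + move=> y /(_ (ball y (r1 / 2))) [|x [/supp[s Ks xs]]].
      by apply: nbhsx_ballx; rewrite divr_gt0.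
    rewrite -ball_normE /= => yx; apply: (Hr1 s) => //.
    have -> : s - y = - (x - s) - (y - x) by rewrite !opprB addrA subrK.
    rewrite (le_lt_trans (ler_normB _ _))// normrN.
    by move: xs yx rr1; lra.
  + move=> x nx; apply/eqP; apply: contrapT => /negP phix; apply: nx.
    exact: subset_closure.
- by apply: mollify_close => // x y xy; apply: Hr2; exact: lt_le_trans rr2.
- move=> j; rewrite E; apply: mollify_close => // x y xy; apply: Hr3.
  exact: lt_le_trans rr3.
Qed.

End mollification.

(** * Weak gradients *)

Section integration_by_parts.
Context {R : realType} {n : nat}.
Implicit Types (f phi psi : 'rV[R]_n -> R) (Omega K : set 'rV[R]_n).
Local Notation mu := (@lebesgue R n).
Local Notation e := (@delta_mx R 1 n ord0).

Definition supported_in Omega phi :=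
  exists K, [/\ compact K, K `<=` Omega & forall x, ~ K x -> phi x = 0].

Lemma supported_in_partial Omega phi j : supported_in Omega phi ->
  supported_in Omega (partial j phi).
Proof.
move=> [K [cK KO K0]]; exists K; split => // x nK.
have oK : open (~` K).
  by apply: closed_openC; exact: compact_closed (@norm_hausdorff _ _) cK.
rewrite (near_eq_partial (g := fun=> 0) _ _).2 ?(partial_cst _ _ _).2//.
by apply: filterS (open_nbhs_nbhs (conj oK nK)) => y /K0.
Qed.

Lemma supported_inMl Omega f phi : supported_in Omega phi ->
  supported_in Omega (fun x => f x * phi x).
Proof.
by move=> [K [cK KO K0]]; exists K; split => // x /K0 ->; rewrite mulr0.
Qed.

Lemma supported_inB Omega phi psi : supported_in Omega phi -> supported_in Omega psi ->
  supported_in Omega (fun x => phi x - psi x).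
Proof.
move=> [K [cK KO K0]] [L [cL LO L0]]; exists (K `|` L); split.
- exact: compactU.
- by rewrite subUset.
- by move=> x nKL; rewrite K0 ?L0 ?subr0// => H; apply: nKL; [right|left].
Qed.

Lemma supported_in_bounded Omega phi : supported_in Omega phi -> bounded_support phi.
Proof. by move=> [K [cK _ K0]]; exact: compact_bounded_support K0. Qed.

Lemma test_supported Omega phi : test Omega phi -> supported_in Omega phi.
Proof. by case. Qed.

Lemma supported_in_eq0 Omega phi x : supported_in Omega phi -> ~ Omega x -> phi x = 0.
Proof. by move=> [K [_ KO K0]] nO; apply: K0 => /KO. Qed.

Lemma continuous_mul_supported Omega f phi :
  (forall x, Omega x -> {for x, continuous f}) -> continuous phi ->
  supported_in Omega phi -> continuous (fun x => f x * phi x).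
Proof.
move=> cf cphi [K [cK KO K0]] x.
have [Kx|nKx] := pselect (K x).
  apply: (@continuousM _ _ f phi); [exact: cf (KO _ Kx)|exact: cphi].
have oK : open (~` K).
  by apply: closed_openC; exact: compact_closed (@norm_hausdorff _ _) cK.
rewrite /continuous_at K0// mulr0.
apply: (@cvg_near_cst _ _ _ _ (nbhs x) _).
by apply: filterS (open_nbhs_nbhs (conj oK nKx)) => y /K0 ->; rewrite mulr0.
Qed.

Lemma Rintegral_supported Omega f : (forall x, ~ Omega x -> f x = 0) ->
  \int[mu]_(x in Omega) f x = \int[mu]_x f x.
Proof.
move=> f0; rewrite Rintegral_mkcond; apply: eq_Rintegral => x _.
by rewrite patchE; case: ifPn => // /negP xO; rewrite f0// => Ox; apply: xO; rewrite inE.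
Qed.

Lemma integrable_mul_supported Omega f phi : open Omega ->
  (forall x, Omega x -> {for x, continuous f}) -> continuous phi ->
  supported_in Omega phi -> mu.-integrable Omega (EFin \o (fun x => f x * phi x)).
Proof.
move=> oO cf cphi sphi.
apply: (@integrableS _ _ _ _ setT) => //; first exact: open_rV_measurable.
apply: bounded_support_integrable; last exact: continuous_mul_supported cphi sphi.
exact: supported_in_bounded (supported_inMl f sphi).
Qed.

(** f is controlled only inside Omega, but f phi vanishes off a compact subset of Omega. It is
    therefore differentiable along j with continuous derivative on the whole space, and that
    derivative has integral 0. *)
Lemma integral_by_parts Omega f phi j : open Omega ->
  (forall x, Omega x -> {for x, continuous f}) ->
  (forall x, Omega x -> derivable f x (e j)) ->
  (forall x, Omega x -> {for x, continuous (partial j f)}) ->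
  continuous phi -> (forall x, derivable phi x (e j)) ->
  continuous (partial j phi) -> supported_in Omega phi ->
  \int[mu]_(x in Omega) (f x * partial j phi x) =
  - \int[mu]_(x in Omega) (partial j f x * phi x).
Proof.
move=> oO cf df cdf cphi dphi cdphi sphi.
have sdphi := supported_in_partial j sphi.
have i1 := integrable_mul_supported oO cf cdphi sdphi.
have i2 := integrable_mul_supported oO cdf cphi sphi.
pose g x := f x * phi x.
have P x : derivable g x (e j) /\
    partial j g x = f x * partial j phi x + partial j f x * phi x.
  have [Ox|nOx] := pselect (Omega x); first exact: partialM (df _ Ox) (dphi x).
  have [K [cK KO K0]] := sphi.
  have oK : open (~` K).
    by apply: closed_openC; exact: compact_closed (@norm_hausdorff _ _) cK.
  have nKx : ~ K x by move=> /KO.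
  have gx : \near x, g x = (fun=> 0) x.
    by apply: filterS (open_nbhs_nbhs (conj oK nKx)) => y /K0; rewrite /g => ->; rewrite mulr0.
  have [H1 H2] := @near_eq_partial _ _ _ _ j _ gx.
  have [c1 c2] := partial_cst (0 : R) j x.
  split; first by apply/H1.
  by rewrite H2 c2 (supported_in_eq0 sdphi nOx) (supported_in_eq0 sphi nOx) !mulr0 addr0.
apply/eqP; rewrite -addr_eq0 -RintegralD//; last exact: open_rV_measurable.
have E : partial j g = (fun x => f x * partial j phi x + partial j f x * phi x).
  by apply/funext => x; case: (P x).
rewrite Rintegral_supported; last first.
  move=> x nOx.
  by rewrite (supported_in_eq0 sdphi nOx) (supported_in_eq0 sphi nOx) !mulr0 addr0.
rewrite -E; apply/eqP; apply: integral_partial_eq0.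
- exact: supported_in_bounded (supported_inMl f sphi).
- by move=> x; case: (P x).
- rewrite E => x; apply: (@continuousD _ _ _ (fun x => f x * partial j phi x)).
    exact: continuous_mul_supported cdphi sdphi x.
  exact: continuous_mul_supported cphi sphi x.
Qed.

Lemma test_continuous Omega phi : test Omega phi -> continuous phi.
Proof. by move=> [/smooth_continuous]. Qed.

Lemma test_partial Omega phi j : test Omega phi -> test Omega (partial j phi).
Proof.
move=> [sphi supp]; split; first exact: smooth_partial.
exact: supported_in_partial.
Qed.

Lemma L1loc_continuous Omega f : open Omega ->
  (forall x, Omega x -> {for x, continuous f}) -> L1loc Omega f.
Proof.
move=> oO cf; split; first exact: measurable_fun_continuous_on.
move=> K cK KO; have mK := compact_rV_measurable cK.
apply: measurable_bounded_integrable => //.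
- exact: lebesgue_bounded_ltoo (compact_bounded cK).
- apply: measurable_funS KO _; first exact: open_rV_measurable.
  exact: measurable_fun_continuous_on.
- have cfK : {within K, continuous f}.
    by apply: continuous_in_subspaceT => x; rewrite inE => /KO/cf.
  have := compact_bounded (continuous_compact cfK cK).
  move=> [M [Mr HM]]; exists M; split => // r Mr' x Kx.
  by apply: (HM _ Mr'); exists x.
Qed.

Lemma L1locB Omega f g : L1loc Omega f -> L1loc Omega g ->
  L1loc Omega (fun x => f x - g x).
Proof.
move=> [mf fi] [mg gi]; split; first exact: measurable_funB.
move=> K cK KO; apply: integrableB_EFin; [exact: compact_rV_measurable|exact: fi|exact: gi].
Qed.

Lemma integrable_L1loc_test Omega f phi : open Omega -> L1loc Omega f ->
  continuous phi -> supported_in Omega phi ->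
  mu.-integrable Omega (EFin \o (fun x => f x * phi x)).
Proof.
move=> oO [mf fi] cphi sphi.
have [C phiC] := bounded_support_bounded (supported_in_bounded sphi) cphi.
case: (sphi) => K [cK KO K0].
have mO := open_rV_measurable oO; have mK := compact_rV_measurable cK.
have i := @integrable_bounded_mul _ _ _ mu K mK f phi C (fi K cK KO)
  (measurable_fun_continuous_rV mK cphi) (fun x _ => phiC x).
rewrite (_ : EFin \o _ = (EFin \o (fun x => f x * phi x)) \_ K).
  by apply/integrable_restrict => //; rewrite setIidr.
apply/funext => x; rewrite patchE; case: ifPn => // /negP xK /=.
by rewrite K0 ?mulr0// => Kx; apply: xK; rewrite inE.
Qed.

End integration_by_parts.

Section weak_gradient.
Context {R : realType} {d : nat}.
Context (Omega : set 'rV[R]_d) (oO : open Omega).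
Implicit Types (Z : 'rV[R]_d -> 'rV[R]_d) (G : 'rV[R]_d -> 'M[R]_d).
Local Notation mu := (@lebesgue R d).

Lemma ae_onW (P Q : 'rV[R]_d -> Prop) : (forall x, Omega x -> P x -> Q x) ->
  ae_on Omega P -> ae_on Omega Q.
Proof.
move=> PQ; apply: (@filterS _ (almost_everywhere mu)) => x H Ox.
exact: PQ Ox (H Ox).
Qed.

Lemma ae_onW2 (P Q S : 'rV[R]_d -> Prop) :
  (forall x, Omega x -> P x -> Q x -> S x) ->
  ae_on Omega P -> ae_on Omega Q -> ae_on Omega S.
Proof.
move=> PQS; apply: (@filterS2 _ (almost_everywhere mu)) => x H H' Ox.
exact: PQS Ox (H Ox) (H' Ox).
Qed.

Lemma ae_on_mx m n (F G : 'rV[R]_d -> 'M[R]_(m, n)) :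
  (forall i j, ae_on Omega (fun x => F x i j = G x i j)) ->
  ae_on Omega (fun x => F x = G x).
Proof.
move=> FG.
have : {ae mu, forall x, forall k : 'I_m * 'I_n, Omega x -> F x k.1 k.2 = G x k.1 k.2}.
  apply: filter_forall => k; exact: FG.
by apply: filterS => x H Ox; apply/matrixP => i j; exact: (H (i, j)).
Qed.

Lemma weak_gradient_unique Z G G' :
  weak_gradient Omega Z G -> weak_gradient Omega Z G' ->
  ae_on Omega (fun x => G x = G' x).
Proof.
move=> [_ LG HG] [_ LG' HG']; apply: ae_on_mx => i j.
have H : ae_on Omega (fun x => G x i j - G' x i j = 0).
  apply: fundamental_lemma => //; first exact: L1locB.
  move=> phi tphi; have cphi := test_continuous tphi; have sphi := test_supported tphi.
  have := HG i j phi tphi; rewrite HG'// => /oppr_inj E.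
  under eq_Rintegral do rewrite mulrBl.
  rewrite RintegralB ?E ?subrr//; first exact: open_rV_measurable.
  - exact: integrable_L1loc_test.
  - exact: integrable_L1loc_test.
by apply: ae_onW H => x _ H; apply/eqP; rewrite -subr_eq0 H.
Qed.

(** [wD] comes from a choice operator, so it can be compared with a concrete gradient only almost
    everywhere; this is the bridge used from here on. *)
Lemma weak_gradient_wD Z G : weak_gradient Omega Z G ->
  weak_gradient Omega Z (wD Omega Z) /\ ae_on Omega (fun x => wD Omega Z x = G x).
Proof.
move=> ZG; have W : weak_gradient Omega Z (wD Omega Z).
  by apply: (@getPex _ (weak_gradient Omega Z)); exists G.
by split => //; exact: weak_gradient_unique W ZG.
Qed.

Lemma weak_gradientB Z Z' G G' :
  weak_gradient Omega Z G -> weak_gradient Omega Z' G' ->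
  weak_gradient Omega (fun x => Z x - Z' x) (fun x => G x - G' x).
Proof.
move=> [LZ LG HG] [LZ' LG' HG']; split.
- move=> i; have := L1locB (LZ i) (LZ' i); congr L1loc.
  by apply/funext => x; rewrite /component !mxE.
- move=> i j; have := L1locB (LG i j) (LG' i j); congr L1loc.
  by apply/funext => x; rewrite !mxE.
- move=> i j phi tphi.
  have mO := open_rV_measurable oO.
  have cphi := test_continuous tphi; have sphi := test_supported tphi.
  have tdphi := test_partial j tphi.
  have cdphi := test_continuous tdphi; have sdphi := test_supported tdphi.
  have E1 x : (Z x - Z' x) ord0 i * partial j phi x =
      Z x ord0 i * partial j phi x - Z' x ord0 i * partial j phi x.
    by rewrite !mxE mulrBl.
  have E2 x : (G x - G' x) i j * phi x = G x i j * phi x - G' x i j * phi x.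
    by rewrite !mxE mulrBl.
  under eq_Rintegral do rewrite E1.
  under [X in - X]eq_Rintegral do rewrite E2.
  have i1 := integrable_L1loc_test oO (LZ i) cdphi sdphi.
  have i2 := integrable_L1loc_test oO (LZ' i) cdphi sdphi.
  have i3 := integrable_L1loc_test oO (LG i j) cphi sphi.
  have i4 := integrable_L1loc_test oO (LG' i j) cphi sphi.
  rewrite !RintegralB//.
  by rewrite HG// HG'// opprB opprK addrC.
Qed.

Lemma classical_weak_gradient Z :
  (forall i x, Omega x -> {for x, continuous (component Z i)}) ->
  (forall i j x, Omega x -> derivable (component Z i) x (delta_mx ord0 j)) ->
  (forall i j x, Omega x -> {for x, continuous (partial j (component Z i))}) ->
  weak_gradient Omega Z (Dmx Z).
Proof.
move=> cZ dZ cdZ; split.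
- by move=> i; apply: L1loc_continuous => // x; exact: cZ.
- move=> i j; rewrite (_ : (fun x => _) = partial j (component Z i)).
    by apply: L1loc_continuous => // x; exact: cdZ.
  by apply/funext => x; rewrite mxE.
- move=> i j phi tphi.
  under [X in - X]eq_Rintegral do rewrite mxE.
  apply: integral_by_parts => //.
  + by move=> x; exact: cZ.
  + by move=> x; exact: dZ.
  + by move=> x; exact: cdZ.
  + exact: test_continuous tphi.
  + by move=> x; case: tphi => /smooth_derivable.
  + exact: test_continuous (test_partial j tphi).
  + exact: test_supported.
Qed.

End weak_gradient.

(** * L^p norms *)

Section square_integrable.
Context d (T : measurableType d) (R : realType) (mu : {measure set T -> \bar R}).
Context (D : set T) (mD : measurable D).
Implicit Types f g : T -> R.

Definition L2 f := measurable_fun D f /\ mu.-integrable D (EFin \o (fun x => f x ^+ 2)).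

Lemma le_integrable_EFin f g : measurable_fun D f ->
  mu.-integrable D (EFin \o g) -> (forall x, D x -> `|f x| <= g x) ->
  mu.-integrable D (EFin \o f).
Proof.
move=> mf gi fg; apply: (le_integrable mD _ _ gi); first exact/measurable_EFinP.
by move=> x Dx; rewrite /= lee_fin (le_trans (fg x Dx))// ler_norm.
Qed.

Lemma L2_mul_integrable f g : L2 f -> L2 g ->
  mu.-integrable D (EFin \o (fun x => f x * g x)).
Proof.
move=> [mf fi] [mg gi]; apply: (le_integrable_EFin _ (integrableD_EFin mD fi gi)).
  exact: measurable_funM.
move=> x Dx; rewrite normrM -[f x ^+ 2]real_normK ?num_real//.
rewrite -[g x ^+ 2]real_normK ?num_real//.
have := sqr_ge0 (`|f x| - `|g x|); have := sqr_ge0 (`|f x| + `|g x|).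
by rewrite sqrrB sqrrD; lra.
Qed.

Lemma L2D f g : L2 f -> L2 g -> L2 (fun x => f x + g x).
Proof.
move=> Lf Lg; have := L2_mul_integrable Lf Lg; case: Lf Lg => mf fi [mg gi] fgi.
split; first exact: measurable_funD.
have := integrableD_EFin mD (integrableD_EFin mD fi gi) (integrableZl_EFin mD 2 fgi).
by congr integrable; apply/funext => x /=; congr EFin; ring.
Qed.

Lemma L2Ml f g (C : R) : L2 f -> measurable_fun D g -> (forall x, D x -> `|g x| <= C) ->
  L2 (fun x => g x * f x).
Proof.
move=> [mf fi] mg gC; split; first exact: measurable_funM.
have := @integrable_bounded_mul _ _ _ mu D mD _ (fun x => g x ^+ 2) (C ^+ 2) fi _ _.
move=> H; have := H; rewrite (_ : (fun x => f x ^+ 2 * g x ^+ 2) =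
  (fun x => (g x * f x) ^+ 2)); last by apply/funext => x; rewrite exprMn mulrC.
apply; first exact: measurable_funX.
move=> x Dx; rewrite normrX lerXn2r ?nnegrE//; last exact: gC.
exact: le_trans (gC x Dx).
Qed.

Lemma L2Zl f (c : R) : L2 f -> L2 (fun x => c * f x).
Proof. by move=> Lf; apply: (@L2Ml _ (fun=> c) `|c|). Qed.

Lemma L2B f g : L2 f -> L2 g -> L2 (fun x => f x - g x).
Proof.
move=> Lf Lg; have := L2D Lf (L2Zl (-1) Lg); congr L2.
by apply/funext => x; rewrite mulN1r.
Qed.

Lemma L2_cst (c : R) : (mu D < +oo)%E -> L2 (fun=> c).
Proof.
move=> Doo; split => //; apply: measurable_bounded_integrable => //.
exists `|c ^+ 2|; split; first exact: num_real.
by move=> r rc x _; exact: ltW.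
Qed.

Lemma L2_bounded f (C : R) : (mu D < +oo)%E -> measurable_fun D f ->
  (forall x, D x -> `|f x| <= C) -> L2 f.
Proof.
move=> Doo mf fC; have := L2Ml (L2_cst 1 Doo) mf fC; congr L2.
by apply/funext => x; rewrite mulr1.
Qed.

Lemma L2_cvg_mul f (g : nat -> T -> R) : L2 f -> (forall k, L2 (g k)) ->
  \int[mu]_(x in D) (g k x ^+ 2) @[k --> \oo] --> (0 : R) ->
  \int[mu]_(x in D) (f x * g k x) @[k --> \oo] --> (0 : R).
Proof.
move=> Lf Lg g0; pose I := \int[mu]_(x in D) (f x ^+ 2).
have I0 : 0 <= I by apply: Rintegral_ge0 => x _; exact: sqr_ge0.
apply/cvgrPdist_le => e e0.
(* The weight in |f g| <= h/2 f^2 + 1/(2h) g^2: the first term integrates to at most e/2, and so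
   does the second once the integral of g^2 is below e h. *)
have h0 : 0 < e / (I + 1) by rewrite divr_gt0// ltr_wpDl.
set h := e / (I + 1) in h0.
have eh0 : 0 < e * h by exact: mulr_gt0.
move/cvgrPdist_le : g0 => /(_ _ eh0); apply: filterS => k.
rewrite !sub0r !normrN => Hk.
have fgi := L2_mul_integrable Lf (Lg k).
apply: (le_trans (le_normr_Rintegral mD fgi)).
have fi := integrableZl_EFin mD (h / 2) Lf.2.
have gi := integrableZl_EFin mD (2^-1 / h) (Lg k).2.
apply: (@le_trans _ _ (\int[mu]_(x in D) (h / 2 * f x ^+ 2 + 2^-1 / h * g k x ^+ 2))).
  apply: le_Rintegral => //.
  - exact: integrable_norm fgi.
  - exact: integrableD_EFin.
  - move=> x _; rewrite normrM -[f x ^+ 2]real_normK ?num_real//.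
    rewrite -[g k x ^+ 2]real_normK ?num_real//.
    rewrite -(ler_pM2l (mulr_gt0 (ltr0Sn R 1) h0)).
    have -> : 2 * h * (h / 2 * `|f x| ^+ 2 + 2^-1 / h * `|g k x| ^+ 2) =
      (h * `|f x|) ^+ 2 + `|g k x| ^+ 2 by field; rewrite gt_eqF.
    have := sqr_ge0 (h * `|f x| - `|g k x|); rewrite sqrrB; lra.
rewrite RintegralD// !RintegralZl//; [|exact: (Lg k).2|exact: Lf.2].
have J0 : \int[mu]_(x in D) (g k x ^+ 2) <= e * h by exact: le_trans (ler_norm _) Hk.
have hI : h * I <= e.
  by rewrite /h mulrAC ler_pdivrMr ?ltr_wpDl// ler_wpM2l ?lerDl// ltW.
have : 2^-1 / h * \int[mu]_(x in D) (g k x ^+ 2) <= 2^-1 * e.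
  by rewrite -mulrA ler_wpM2l// ler_pdivrMl// mulrC.
by rewrite -/I; move: hI; lra.
Qed.

End square_integrable.

Section frobenius.
Context {R : realType} {m n : nat}.
Implicit Types A B : 'M[R]_(m, n).

Lemma dotE A B : dot A B = \sum_(k : 'I_m * 'I_n) A k.1 k.2 * B k.1 k.2.
Proof. by rewrite /dot pair_bigA. Qed.

Lemma dot_ge0 A : 0 <= dot A A.
Proof. by do 2!apply: sumr_ge0 => ? _; rewrite -expr2 sqr_ge0. Qed.

Lemma frob_ge0 A : 0 <= frob A.
Proof. exact: sqrtr_ge0. Qed.

Lemma frob_sqr A : frob A ^+ 2 = dot A A.
Proof. by rewrite sqr_sqrtr// dot_ge0. Qed.

Lemma ler_entry_frob A i j : `|A i j| <= frob A.
Proof.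
rewrite -sqrtr_sqr ler_sqrt ?dot_ge0// dotE (bigD1 (i, j))//= -expr2 lerDl.
by apply: sumr_ge0 => k _; rewrite -expr2 sqr_ge0.
Qed.

Lemma frob_le A (C : R) : 0 <= C -> (forall i j, `|A i j| <= C) ->
  frob A <= (m * n)%:R * C.
Proof.
move=> C0 AC; rewrite -[leRHS]ger0_norm ?mulr_ge0//.
rewrite -sqrtr_sqr ler_sqrt ?sqr_ge0// dotE.
apply: (@le_trans _ _ (\sum_(k : 'I_m * 'I_n) C ^+ 2)).
  apply: ler_sum => k _; rewrite -expr2 -real_normK ?num_real//.
  by rewrite lerXn2r ?nnegrE//; exact: AC.
have -> : \sum_(k : 'I_m * 'I_n) C ^+ 2 = (m * n)%:R * C ^+ 2.
  by rewrite sumr_const card_prod !card_ord mulr_natl.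
rewrite exprMn ler_wpM2r ?sqr_ge0//.
by rewrite -natrX ler_nat; case: (m * n)%N => // k; rewrite expnS expn1 leq_pmulr.
Qed.

End frobenius.

(** A termwise bound of the Leibniz formula, with n! terms. It makes the determinant integrable for
    a matrix field in L^n. *)
Lemma normr_det_le {R : realType} n (A : 'M[R]_n) :
  `|\det A| <= #|predT : pred {perm 'I_n}|%:R * frob A ^+ n.
Proof.
rewrite /determinant; apply: (le_trans (ler_norm_sum _ _ _)).
rewrite mulr_natl -sumr_const; apply: ler_sum => s _.
rewrite normrM normr_sign mul1r normr_prod.
have -> : frob A ^+ n = \prod_(i < n) frob A by rewrite prodr_const card_ord.
apply: ler_prod => i _.
by rewrite normr_ge0 ler_entry_frob.
Qed.

Section Lnorm_on.
Context {R : realType} {d : nat}.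
Context (Omega : set 'rV[R]_d) (mO : measurable Omega).
Implicit Types (f : 'rV[R]_d -> R).
Local Notation mu := (@lebesgue R d).

Lemma Lnorm_onE (p : nat) f : (0 < p)%N -> Lnorm_on Omega p%:R%:E f =
  ((\int[mu]_(x in Omega) (`|f x| ^+ p)%:E) `^ (p%:R^-1))%E.
Proof.
move=> p0; rewrite /Lnorm_on unlock; congr poweR.
rewrite [RHS]integral_mkcond; apply: eq_integral => x _.
rewrite patchE /= patchE; case: ifPn => _.
  by rewrite powR_mulrn.
change (((`|0 : R| `^ p%:R)%:E = 0)%E).
by rewrite normr0 powR0// pnatr_eq0 -lt0n.
Qed.

Lemma Lnorm_on_ltoo (p : nat) f : (0 < p)%N -> measurable_fun Omega f ->
  (Lnorm_on Omega p%:R%:E f < +oo)%E <->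
  mu.-integrable Omega (EFin \o (fun x => `|f x| ^+ p)).
Proof.
move=> p0 mf; rewrite Lnorm_onE//.
have mfp : measurable_fun Omega (fun x => `|f x| ^+ p).
  by apply: measurable_funX; exact: measurableT_comp.
have E : (\int[mu]_(x in Omega) `|(`|f x| ^+ p)%:E| =
    \int[mu]_(x in Omega) (`|f x| ^+ p)%:E)%E.
  by apply: eq_integral => x _; rewrite gee0_abs// lee_fin exprn_ge0.
split => [H|/integrableP[_]].
  apply/integrableP; split; first exact/measurable_EFinP.
  by rewrite E; apply: lty_poweRy H; rewrite invr_neq0// pnatr_eq0 -lt0n.
by rewrite E => H; exact: poweR_lty.
Qed.

Lemma Lnorm_on_Rintegral (p : nat) f : (0 < p)%N ->
  mu.-integrable Omega (EFin \o (fun x => `|f x| ^+ p)) ->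
  Lnorm_on Omega p%:R%:E f =
  ((\int[mu]_(x in Omega) (`|f x| ^+ p)) `^ (p%:R^-1))%:E.
Proof. by move=> p0 fi; rewrite Lnorm_onE// RintegralE// poweR_EFin. Qed.

Lemma Lnorm_on_cvg0 (p : nat) (f : nat -> 'rV[R]_d -> R) : (0 < p)%N ->
  (forall k, mu.-integrable Omega (EFin \o (fun x => `|f k x| ^+ p))) ->
  Lnorm_on Omega p%:R%:E (f k) @[k --> \oo] --> 0%E <->
  \int[mu]_(x in Omega) (`|f k x| ^+ p) @[k --> \oo] --> (0 : R).
Proof.
move=> p0 fi; set I := fun k => \int[mu]_(x in Omega) (`|f k x| ^+ p).
have I0 k : 0 <= I k by apply: Rintegral_ge0 => x _; exact: exprn_ge0.
have pR0 : (p%:R : R) != 0 by rewrite pnatr_eq0 -lt0n.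
rewrite (_ : (fun k => Lnorm_on _ _ (f k)) = (fun k => (I k `^ (p%:R^-1))%:E)); last first.
  by apply/funext => k; rewrite Lnorm_on_Rintegral.
have K k (e : R) : 0 < e -> (I k `^ (p%:R^-1) <= e) = (I k <= e ^+ p).
  move=> e0; apply/idP/idP => H.
    have := ge0_ler_powR (ler0n R p); move=> /(_ (I k `^ (p%:R^-1)) e).
    rewrite !nnegrE powR_ge0 (ltW e0) => /(_ isT isT H).
    by rewrite -powRrM mulVf// powRr1// powR_mulrn// ltW.
  have := @ge0_ler_powR R p%:R^-1; rewrite invr_ge0 ler0n => /(_ isT (I k) (e ^+ p)).
  have ep0 : 0 <= e ^+ p by rewrite exprn_ge0// ltW.
  rewrite !nnegrE I0 ep0 => /(_ isT isT H) /le_trans; apply.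
  have e0' := ltW e0.
  by rewrite -powR_mulrn// -powRrM mulfV// powRr1.
split.
- move=> /fine_cvgP[_]; rewrite /comp /= => /cvgrPdist_le H.
  apply/cvgrPdist_le => e e0.
  (* Capping by 1 ensures that the p-th power of the threshold is still at most e. *)
  have e1 : 0 < Num.min e 1 by rewrite lt_min e0 ltr01.
  apply: filterS (H _ e1) => k; rewrite !sub0r !normrN !ger0_norm ?powR_ge0//.
  rewrite K// => /le_trans; apply.
  have m1 : Num.min e 1 <= 1 by rewrite ge_min lexx orbT.
  apply: (@le_trans _ _ (Num.min e 1)); last by rewrite ge_min lexx.
  by rewrite -[leRHS]expr1; apply: ler_wiXn2l => //; exact: ltW.
- move=> /cvgrPdist_le H; apply: cvg_EFin; first exact: nearW.
  apply/cvgrPdist_le => e e0; have ep := exprn_gt0 p e0.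
  apply: filterS (H _ ep) => k; rewrite !sub0r !normrN !ger0_norm ?powR_ge0//.
  by rewrite K.
Qed.

End Lnorm_on.

Section Lp_mx.
Context {R : realType} {d : nat}.
Context (Omega : set 'rV[R]_d) (mO : measurable Omega) (Ooo : (lebesgue d Omega < +oo)%E).
Local Notation mu := (@lebesgue R d).
Context {m n : nat}.
Implicit Types (F G : 'rV[R]_d -> 'M[R]_(m, n)).

Lemma measurable_dot F G :
  (forall i j, measurable_fun Omega (fun x => F x i j)) ->
  (forall i j, measurable_fun Omega (fun x => G x i j)) ->
  measurable_fun Omega (fun x => dot (F x) (G x)).
Proof.
by move=> mF mG; do 2!apply: measurable_sum => ?; exact: measurable_funM.
Qed.

Lemma measurable_frob F : (forall i j, measurable_fun Omega (fun x => F x i j)) ->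
  measurable_fun Omega (fun x => frob (F x)).
Proof.
move=> mF; rewrite (_ : (fun x => _) = Num.sqrt \o (fun x => dot (F x) (F x)))//.
apply: measurableT_comp; last exact: measurable_dot.
by apply: continuous_measurable_fun; exact: sqrt_continuous.
Qed.

Lemma Lp_mx_pow (p : nat) F : (0 < p)%N -> Lp_mx Omega p%:R%:E F ->
  mu.-integrable Omega (EFin \o (fun x => frob (F x) ^+ p)).
Proof.
move=> p0 [mF Foo]; have := (Lnorm_on_ltoo p0 (measurable_frob mF)).1 Foo.
by congr integrable; apply/funext => x /=; rewrite ger0_norm ?frob_ge0.
Qed.

(** Compare t with e. On a set of finite measure, e = 1 gives the inclusion of L^p in L^2, and small
    e shows that L^p convergence to 0 implies L^2 convergence to 0. *)
Lemma sqr_le_pow (p : nat) (e t : R) : (2 <= p)%N -> 0 < e -> 0 <= t ->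
  t ^+ 2 <= e ^+ 2 + t ^+ p / e ^+ (p - 2).
Proof.
move=> p2 e0 t0; have [te|et] := leP t e.
  have : t ^+ 2 <= e ^+ 2 by rewrite lerXn2r// nnegrE ltW.
  move=> /le_trans; apply; rewrite lerDl divr_ge0// exprn_ge0//; exact: ltW.
have : t ^+ 2 <= t ^+ p / e ^+ (p - 2).
  rewrite ler_pdivlMr ?exprn_gt0// -[p in leRHS](subnKC p2) exprD ler_wpM2l ?exprn_ge0//.
  by rewrite lerXn2r// ?nnegrE// ltW.
by move=> /le_trans; apply; rewrite lerDr sqr_ge0.
Qed.

Lemma Lp_mx_L2 (p : nat) F : (2 <= p)%N -> Lp_mx Omega p%:R%:E F ->
  forall i j, L2 mu Omega (fun x => F x i j).
Proof.
move=> p2 LF i j; split; first by case: LF.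
have Fi := Lp_mx_pow (ltnW p2) LF.
apply: (le_integrable_EFin mO _ (integrableD_EFin mO (L2_cst mO 1 Ooo).2 Fi)).
  by apply: measurable_funX; case: LF.
move=> x _; rewrite ger0_norm ?sqr_ge0// -real_normK ?num_real//.
have := sqr_le_pow p2 (ltr01 : 0 < 1 :> R) (frob_ge0 (F x)).
rewrite !expr1n divr1; apply: le_trans.
by rewrite lerXn2r ?nnegrE ?frob_ge0//; exact: ler_entry_frob.
Qed.

Lemma Lnorm_mx_cvg_L2 (p : nat) (F : nat -> 'rV[R]_d -> 'M[R]_(m, n)) : (2 <= p)%N ->
  (forall k i j, L2 mu Omega (fun x => F k x i j)) ->
  Lnorm_mx Omega p%:R%:E (F k) @[k --> \oo] --> 0%E ->
  forall i j, \int[mu]_(x in Omega) (F k x i j ^+ 2) @[k --> \oo] --> (0 : R).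
Proof.
move=> p2 LF F0 i j; apply/cvgrPdist_le => e e0.
have p0 : (0 < p)%N by exact: ltnW.
have mF k : measurable_fun Omega (fun x => frob (F k x)).
  by apply: measurable_frob => i' j'; case: (LF k i' j').
pose V := \int[mu]_(x in Omega) (1 : R).
have V0 : 0 <= V by exact: Rintegral_ge0.
have i1 : mu.-integrable Omega (EFin \o (fun=> 1 : R)).
  by have := (L2_cst mO 1 Ooo).2; under eq_fun do rewrite expr1n.
(* The threshold in [sqr_le_pow]: its square times the volume V is at most e/2, the +1 covering V =
   0. *)
pose t := Num.sqrt (e / (2 * (V + 1))).
have t20 : 0 < e / (2 * (V + 1)) by rewrite divr_gt0// mulr_gt0// ltr_wpDl.
have t0 : 0 < t by rewrite sqrtr_gt0.
have tV : t ^+ 2 * V <= e / 2.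
  have V1 : 0 < V + 1 by rewrite ltr_wpDl.
  rewrite sqr_sqrtr ?(ltW t20)//.
  have -> : e / (2 * (V + 1)) * V = e / 2 * (V / (V + 1)) by field; rewrite gt_eqF.
  rewrite ler_piMr ?divr_ge0 ?ler_pdivrMr ?mul1r ?lerDl//; exact: ltW.
(* The bound on the integral of the p-th power that leaves e/2 after division by t^(p-2). *)
pose h := e / 2 * t ^+ (p - 2).
have h0 : 0 < h by rewrite mulr_gt0 ?divr_gt0 ?exprn_gt0.
have hp : 0 < h `^ p%:R^-1 by exact: powR_gt0.
move: F0 => /fine_cvgP[Ffin /cvgrPdist_le/(_ _ hp)].
apply: filterS2 Ffin => k Ffin; rewrite /= !sub0r !normrN => Fk.
have Fi : mu.-integrable Omega (EFin \o (fun x => frob (F k x) ^+ p)).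
  apply: Lp_mx_pow => //; split; first by move=> i' j'; case: (LF k i' j').
  by rewrite ltey_eq Ffin.
have Fi' : mu.-integrable Omega (EFin \o (fun x => `|frob (F k x)| ^+ p)).
  by under eq_fun do rewrite ger0_norm ?frob_ge0//.
have FE : \int[mu]_(x in Omega) (`|frob (F k x)| ^+ p) =
          \int[mu]_(x in Omega) (frob (F k x) ^+ p).
  by apply: eq_Rintegral => x _; rewrite ger0_norm ?frob_ge0.
have I0 : 0 <= \int[mu]_(x in Omega) (frob (F k x) ^+ p).
  by apply: Rintegral_ge0 => x _; rewrite exprn_ge0 ?frob_ge0.
have Ih : \int[mu]_(x in Omega) (frob (F k x) ^+ p) <= h.
  move: Fk; rewrite /Lnorm_mx Lnorm_on_Rintegral// FE /= ger0_norm ?powR_ge0// => H.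
  have := ge0_ler_powR (ler0n R p); move=> /(_ _ _ _ _ H).
  rewrite !nnegrE !powR_ge0 => /(_ isT isT).
  by rewrite -!powRrM mulVf ?pnatr_eq0 -?lt0n// !powRr1// ltW.
have J0 : 0 <= \int[mu]_(x in Omega) F k x i j ^+ 2.
  by apply: Rintegral_ge0 => x _; exact: sqr_ge0.
rewrite ger0_norm//.
have iF := integrableZl_EFin mO (t ^+ (p - 2))^-1 Fi.
have iT := integrableZl_EFin mO (t ^+ 2) i1.
apply: (@le_trans _ _ (\int[mu]_(x in Omega)
    (t ^+ 2 * 1 + (t ^+ (p - 2))^-1 * frob (F k x) ^+ p))).
  apply: le_Rintegral => //.
  - exact: (LF k i j).2.
  - exact: integrableD_EFin.
  - move=> x _; rewrite mulr1 [X in _ + X]mulrC -real_normK ?num_real//.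
    apply: le_trans (sqr_le_pow p2 t0 (frob_ge0 (F k x))).
    by rewrite lerXn2r ?nnegrE ?frob_ge0//; exact: ler_entry_frob.
rewrite RintegralD// !RintegralZl// -/V.
have : (t ^+ (p - 2))^-1 * \int[mu]_(x in Omega) frob (F k x) ^+ p <= e / 2.
  by rewrite ler_pdivrMl ?exprn_gt0// mulrC.
by move: tV; lra.
Qed.

Lemma Lnorm_mx_sqr F : (forall i j, L2 mu Omega (fun x => F x i j)) ->
  mu.-integrable Omega (EFin \o (fun x => dot (F x) (F x))) /\
  (Lnorm_mx Omega 2%:E F ^+ 2 = (\int[mu]_(x in Omega) dot (F x) (F x))%:E)%E.
Proof.
move=> LF.
have Fi : mu.-integrable Omega (EFin \o (fun x => dot (F x) (F x))).
  under eq_fun do rewrite /dot.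
  do 2!apply: integrable_sum_EFin => // ?; exact: L2_mul_integrable.
split => //; have Fi' : mu.-integrable Omega (EFin \o (fun x => `|frob (F x)| ^+ 2)).
  by under eq_fun do rewrite ger0_norm ?frob_ge0// frob_sqr.
rewrite /Lnorm_mx (Lnorm_on_Rintegral mO (p := 2))//.
rewrite (_ : \int[mu]_(x in Omega) `|frob (F x)| ^+ 2 =
  \int[mu]_(x in Omega) dot (F x) (F x)); last first.
  by apply: eq_Rintegral => x _; rewrite ger0_norm ?frob_ge0// frob_sqr.
set I := \int[mu]_(x in Omega) _.
have I0 : 0 <= I by apply: Rintegral_ge0 => x _; exact: dot_ge0.
by rewrite powR12_sqrt// expe2 -EFinM -expr2 sqr_sqrtr.
Qed.

Lemma bounded_Lp_mx (p : nat) F (C : R) : (0 < p)%N ->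
  (forall i j, measurable_fun Omega (fun x => F x i j)) ->
  (forall i j x, Omega x -> `|F x i j| <= C) ->
  Lp_mx Omega p%:R%:E F.
Proof.
move=> p0 mF FC; split => //.
have mf := measurable_frob mF.
apply/(Lnorm_on_ltoo p0 mf).
apply: measurable_bounded_integrable => //.
  by apply: measurable_funX; exact: measurableT_comp.
pose B := (m * n)%:R * `|C|.
have FB x : Omega x -> frob (F x) <= B.
  by move=> Ox; apply: frob_le => // i j; rewrite (le_trans (FC i j x Ox))// ler_norm.
exists (B ^+ p); split; first exact: num_real.
move=> r Br x Ox; apply: le_trans (ltW Br).
rewrite /= ger0_norm ?exprn_ge0// ger0_norm ?frob_ge0//.
by rewrite lerXn2r ?nnegrE ?frob_ge0 ?mulr_ge0//; exact: FB.
Qed.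

Lemma bounded_cvg_Lnorm_mx (p : nat) (F : nat -> 'rV[R]_d -> 'M[R]_(m, n)) (C : R) :
  (0 < p)%N -> (forall k i j, measurable_fun Omega (fun x => F k x i j)) ->
  (forall k i j x, Omega x -> `|F k x i j| <= C) ->
  (forall i j, ae_on Omega (fun x => F k x i j @[k --> \oo] --> (0 : R))) ->
  Lnorm_mx Omega p%:R%:E (F k) @[k --> \oo] --> 0%E.
Proof.
move=> p0 mF FC F0; have mf k := measurable_frob (mF k).
pose B := (m * n)%:R * `|C|.
have FB k x : Omega x -> frob (F k x) <= B.
  by move=> Ox; apply: frob_le => // i j; rewrite (le_trans (FC k i j x Ox))// ler_norm.
have Fi k : mu.-integrable Omega (EFin \o (fun x => `|frob (F k x)| ^+ p)).
  have [_] := bounded_Lp_mx p0 (mF k) (FC k).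
  by move/(Lnorm_on_ltoo p0 (mf k)).
apply/(Lnorm_on_cvg0 mO p0 Fi).
have [|||||_] := @dominated_cvg_Rintegral _ _ _ mu Omega mO
  (fun k x => `|frob (F k x)| ^+ p) (fun=> 0) (fun=> B ^+ p).
- by move=> k; apply: integrable_measurable_fun (Fi k).
- exact: measurable_cst.
- have : {ae mu, forall x, forall k : 'I_m * 'I_n, Omega x ->
      F l x k.1 k.2 @[l --> \oo] --> (0 : R)}.
    by apply: filter_forall => k; exact: F0.
  apply: filterS => x H Ox.
  have H2 : frob (F k x) @[k --> \oo] --> (0 : R).
    rewrite -(@sqrtr0 R); apply: continuous_cvg; first exact: sqrt_continuous.
    rewrite (_ : (fun k => _) = (fun l =>
        \sum_(k : 'I_m * 'I_n) F l x k.1 k.2 * F l x k.1 k.2)); last first.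
      by apply/funext => l; rewrite dotE.
    have Hs : \sum_(k : 'I_m * 'I_n) F l x k.1 k.2 * F l x k.1 k.2 @[l --> \oo] -->
        \sum_(k : 'I_m * 'I_n) (0 * 0 : R).
      by apply: cvg_sum_seq => k; apply: cvgM; exact: H k Ox.
    by rewrite big1 in Hs => // k _; rewrite mulr0.
  have H3 : `|frob (F k x)| @[k --> \oo] --> (0 : R).
    by rewrite -(@normr0 _ R^o); apply: cvg_norm.
  have -> : (0 : R) = 0 ^+ p by rewrite expr0n gtn_eqF.
  apply: (@cvg_comp _ _ _ _ (fun t : R => t ^+ p) _ _ _ H3).
  exact: exprn_continuous.
- have := (L2_cst mO (Num.sqrt (B ^+ p)) Ooo).2.
  by under eq_fun do rewrite sqr_sqrtr ?exprn_ge0 ?mulr_ge0//.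
- move=> k x Ox; rewrite ger0_norm ?exprn_ge0// ger0_norm ?frob_ge0//.
  by rewrite lerXn2r ?nnegrE ?frob_ge0 ?mulr_ge0//; exact: FB.
by rewrite /Rintegral integral0.
Qed.

End Lp_mx.

(** * The pointwise inequality *)

Section singular_values.
Context {R : realType} {d : nat}.
Implicit Types (u v w : 'rV[R]_d) (A M : 'M[R]_d).

Lemma dot_tr m n (A B : 'M[R]_(m, n)) : dot A B = \tr (A *m B^T).
Proof.
by apply: eq_bigr => i _; rewrite mxE; apply: eq_bigr => j _; rewrite mxE.
Qed.

Lemma dotC m n (A B : 'M[R]_(m, n)) : dot A B = dot B A.
Proof. by do 2!apply: eq_bigr => ? _; rewrite mulrC. Qed.

Lemma dotDl m n (A B C : 'M[R]_(m, n)) : dot (A + B) C = dot A C + dot B C.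
Proof. by rewrite !dot_tr mulmxDl mxtraceD. Qed.

Lemma dotZl m n c (A B : 'M[R]_(m, n)) : dot (c *: A) B = c * dot A B.
Proof. by rewrite !dot_tr -scalemxAl mxtraceZ. Qed.

Lemma dotDr m n (A B C : 'M[R]_(m, n)) : dot A (B + C) = dot A B + dot A C.
Proof. by rewrite dotC dotDl !(dotC A). Qed.

Lemma dotZr m n c (A B : 'M[R]_(m, n)) : dot A (c *: B) = c * dot A B.
Proof. by rewrite dotC dotZl dotC. Qed.

Lemma dotBl m n (A B C : 'M[R]_(m, n)) : dot (A - B) C = dot A C - dot B C.
Proof. by rewrite -scaleN1r dotDl dotZl mulN1r. Qed.

Lemma dotBr m n (A B C : 'M[R]_(m, n)) : dot A (B - C) = dot A B - dot A C.
Proof. by rewrite dotC dotBl !(dotC A). Qed.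

Lemma dot_mulmxr u v A : dot (u *m A) v = dot u (v *m A^T).
Proof. by rewrite !dot_tr trmx_mul trmxK mulmxA. Qed.

Lemma dot_eq0 m n (A : 'M[R]_(m, n)) : dot A A = 0 -> A = 0.
Proof.
move=> A0; apply/matrixP => i j; rewrite mxE; apply/eqP.
by rewrite -normr_le0 (le_trans (ler_entry_frob A i j))// /frob A0 sqrtr0.
Qed.

Lemma continuous_dot_mulmx A : continuous (fun v => dot (v *m A) (v *m A)).
Proof.
move=> v; apply: (@cvg_sum_seq R _ _ (nbhs v) (index_enum _)
  (fun i v => \sum_j (v *m A) i j * (v *m A) i j)
  (fun i => \sum_j (v *m A) i j * (v *m A) i j)) => i.
apply: (@cvg_sum_seq R _ _ (nbhs v) (index_enum _)
  (fun j v => (v *m A) i j * (v *m A) i j)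
  (fun j => (v *m A) i j * (v *m A) i j)) => j.
suff H : (w *m A) i j @[w --> v] --> (v *m A) i j.
  exact: (@cvgM _ _ (nbhs v) _ (fun v => (v *m A) i j) (fun v => (v *m A) i j)).
rewrite mxE (_ : (fun w : 'rV[R]_d => _) = (fun w => \sum_k w i k * A k j)); last first.
  by apply/funext => w; rewrite mxE.
apply: (@cvg_sum_seq R _ _ (nbhs v) (index_enum _)
  (fun k v => v i k * A k j) (fun k => v i k * A k j)) => k.
apply: (@cvgM _ _ (nbhs v) _ (fun v => v i k) (fun=> A k j)); last exact: cvg_cst.
exact: coord_continuous.
Qed.

(** The first-order condition at a minimum in algebraic form. The test value is t = - b / (c + 1),
    where c + 1 replaces c because c may be 0. *)
Lemma quadratic_ge0 (b c : R) : (forall t, 0 <= 2 * t * b + t ^+ 2 * c) -> b = 0.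
Proof.
move=> H; have c0 : 0 <= c by have := H 1; have := H (-1); rewrite sqrrN expr1n; lra.
have := H (- b / (c + 1)).
have -> : 2 * (- b / (c + 1)) * b + (- b / (c + 1)) ^+ 2 * c =
    - (b ^+ 2 * (c + 2) / (c + 1) ^+ 2) by field; rewrite gt_eqF// ltr_wpDl.
rewrite oppr_ge0 ler_pdivrMr ?exprn_gt0// ?ltr_wpDl// mul0r => Hb.
have : b ^+ 2 <= 0 by rewrite -(ler_pM2r (_ : 0 < c + 2)) ?ltr_wpDl// mul0r.
by move=> b2; apply/eqP; rewrite -sqrf_eq0 eq_le b2 sqr_ge0.
Qed.

(* The least eigenvalue of A^T A is the minimum of |A v|^2 over the unit sphere. *)
Lemma singular_value_lb A (sigma : R) : 0 <= sigma ->
  (forall s, singular_value A s -> sigma <= s) ->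
  forall v, sigma ^+ 2 * dot v v <= dot (v *m A^T) (v *m A^T).
Proof.
move=> sigma0 Hs v.
have [->|v0] := eqVneq v 0.
  by rewrite mul0mx /dot !big_ord1 !big1 ?mulr0// => i _; rewrite mxE mul0r.
have vv0 w : w != 0 -> 0 < dot w w.
  move=> w0; rewrite lt_neqAle dot_ge0 andbT eq_sym; apply/eqP => /dot_eq0 w0'.
  by rewrite w0' eqxx in w0.
have cd : continuous (fun v : 'rV[R]_d => dot v v).
  rewrite (_ : (fun v => _) = (fun v => dot (v *m 1%:M) (v *m 1%:M))).
    exact: continuous_dot_mulmx.
  by apply/funext => w; rewrite mulmx1.
pose S := [set w : 'rV[R]_d | dot w w = 1].
have cS : compact S.
  apply: bounded_closed_compact; last first.
    apply: (@closed_comp _ _ (fun v : 'rV[R]_d => dot v v) [set r | r = 1]).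
      by move=> w _; exact: cd.
    exact: closed_eq.
  exists 1; split; first exact: num_real.
  move=> r r1 w Sw; rewrite /= (le_trans _ (ltW r1))//.
  apply: ler_rV_norm => // i; rewrite (le_trans (ler_entry_frob w ord0 i))//.
  by rewrite /frob Sw sqrtr1.
pose nrm w := (Num.sqrt (dot w w))^-1 *: w.
have nrmS w : w != 0 -> S (nrm w).
  move=> w0; rewrite /S /nrm /= dotZl dotZr mulrA -invfM -expr2 sqr_sqrtr ?dot_ge0//.
  by rewrite mulVf// gt_eqF// vv0.
have S0 : S !=set0 by exists (nrm v); exact: nrmS.
have cf : {within S, continuous (fun w => dot (w *m A^T) (w *m A^T))}.
  by apply: continuous_subspaceT; exact: continuous_dot_mulmx.
have [w Sw wmin] := EVT_min_rV S0 cS cf.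
set m := dot (w *m A^T) (w *m A^T) in wmin.
have m0 : 0 <= m by exact: dot_ge0.
rewrite inE in Sw.
have mlb u : m * dot u u <= dot (u *m A^T) (u *m A^T).
  have [->|u0] := eqVneq u 0.
    by rewrite mul0mx /dot !big_ord1 !big1 ?mulr0// => i _; rewrite mxE mul0r.
  have := wmin (nrm u); rewrite inE => /(_ (nrmS _ u0)).
  rewrite /nrm -scalemxAl dotZl dotZr mulrA -invfM -expr2 sqr_sqrtr ?dot_ge0//.
  by rewrite mulrC ler_pdivlMr// vv0.
(* [r] is the residual of the eigenvector equation at the minimiser w. Minimality along w + t r has
   linear coefficient [dot r r], which must therefore vanish. *)
have [r [rdef rE]] : exists r, r = w *m (A^T *m A) - m *: w /\
    forall u, dot r u = dot (w *m A^T) (u *m A^T) - m * dot w u.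
  by eexists; split => // u; rewrite dotBl dotZl mulmxA dot_mulmxr.
have r0 : dot r r = 0.
  apply: (@quadratic_ge0 _ (dot (r *m A^T) (r *m A^T) - m * dot r r)) => t.
  have := mlb (w + t *: r).
  rewrite mulmxDl -scalemxAl !(dotDl, dotDr, dotZl, dotZr) -/m Sw.
  rewrite (dotC (r *m A^T) (w *m A^T)) (dotC r w).
  have : t * dot r r = t * dot (w *m A^T) (r *m A^T) - t * m * dot w r.
    by rewrite {1}rE; ring.
  by move: (dot (w *m _) _) (dot (r *m _) _) (dot w r) (dot r r) => b q c e; lra.
have ev : singular_value A (Num.sqrt m).
  split; first exact: sqrtr_ge0.
  rewrite sqr_sqrtr//; apply/eigenvalueP; exists w.
    by move/dot_eq0/eqP : r0; rewrite rdef subr_eq0 => /eqP.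
  by apply/eqP => w0; move: Sw; rewrite /S w0 /= /dot big_ord1 big1 => [/esym/eqP|i _];
    rewrite ?oner_eq0// mxE mul0r.
have sm := Hs _ ev.
apply: le_trans (mlb v); rewrite ler_wpM2r ?dot_ge0//.
by rewrite -[leRHS]sqr_sqrtr// lerXn2r// nnegrE// sqrtr_ge0.
Qed.

Lemma dot_trmx m n (A B : 'M[R]_(m, n)) : dot A^T B^T = dot A B.
Proof.
rewrite /dot exchange_big /=.
by do 2!apply: eq_bigr => ? _; rewrite !mxE.
Qed.

Lemma singular_value_lb_mx A M (sigma : R) : 0 <= sigma ->
  (forall s, singular_value A s -> sigma <= s) ->
  sigma ^+ 2 * dot M M <= dot (A *m M) (A *m M).
Proof.
move=> sigma0 Hs; rewrite -(dot_trmx M M) -(dot_trmx (A *m M)) trmx_mul.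
have E (B : 'M[R]_d) : dot B B = \sum_i dot (row i B) (row i B).
  apply: eq_bigr => i _; rewrite /dot big_ord1.
  by apply: eq_bigr => j _; rewrite !mxE.
rewrite !E mulr_sumr; apply: ler_sum => i _; rewrite row_mul.
exact: singular_value_lb.
Qed.

End singular_values.

Section determinant_expansion.
Context {R : realType}.

(** Entries indexed by natural numbers make the ordinals of the Laplace expansion compute away,
    leaving plain real variables for [ring] and [lra]; [matrix_natE] puts any matrix in this
    form. *)
Lemma det_mx_nat2 (f : nat -> nat -> R) : \det (\matrix_(i < 2, j < 2) f i j) =
  f 0 0 * f 1 1 - f 0 1 * f 1 0.
Proof.
rewrite (expand_det_row _ ord0) !big_ord_recl big_ord0 /cofactor !det_mx11 !mxE /=.
by rewrite expr0 expr1; ring.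
Qed.

Lemma det_mx_nat3 (f : nat -> nat -> R) : \det (\matrix_(i < 3, j < 3) f i j) =
  f 0 0 * (f 1 1 * f 2 2 - f 1 2 * f 2 1) - f 0 1 * (f 1 0 * f 2 2 - f 1 2 * f 2 0)
  + f 0 2 * (f 1 0 * f 2 1 - f 1 1 * f 2 0).
Proof.
rewrite (expand_det_row _ ord0) !big_ord_recl big_ord0 /cofactor.
have E (j : 'I_3) : \det (row' ord0 (col' j (\matrix_(i < 3, j < 3) f i j))) =
    f 1 (bump j 0) * f 2 (bump j 1) - f 1 (bump j 1) * f 2 (bump j 0).
  rewrite -(det_mx_nat2 (fun a b => f a.+1 (bump j b))); congr (\det _).
  by apply/matrixP => a b; rewrite !mxE.
by rewrite !E !mxE /= /bump /= !expr0 !expr1 sqrrN expr1n; ring.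
Qed.

Lemma matrix_natE n (A : 'M[R]_n.+1) :
  exists f : nat -> nat -> R, A = \matrix_(i, j) f i j.
Proof.
exists (fun a b => A (inord a) (inord b)).
by apply/matrixP => i j; rewrite mxE !inord_val.
Qed.

(** 5/3 is the value of the root at which C / 2 equals 5/2, the loss met in [det_perturbation_lb]
    for |M| <= 2. *)
Lemma sqrt3P : 5 / 3 <= Num.sqrt 3 :> R /\ Num.sqrt 3 ^+ 2 = 3 :> R.
Proof.
split; last by rewrite sqr_sqrtr.
have -> : 5 / 3 = Num.sqrt ((5 / 3) ^+ 2) :> R by rewrite sqrtr_sqr ger0_norm.
by rewrite ler_sqrt//; lra.
Qed.

Local Notation C := (1 + 3 / 2 * (1 + Num.sqrt 3) : R).

(** For d = 2, det (1 + M) - 1 - tr M = det M >= - |M|^2 / 2. For d = 3 the remainder is e2 + det M,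
    with e2 the second invariant; the cubic term is harmless for |M| <= 2, and for larger M the
    trace is compared directly with |M|^2. *)
Lemma det_perturbation_lb d (M : 'M[R]_d) : d = 2%N \/ d = 3%N ->
  - (C / 2) * dot M M <= `|\det (1%:M + M)| - 1 - \tr M.
Proof.
have := sqrt3P; move: (Num.sqrt 3) => r [s3 s32].
case=> ?; subst d.
- have [f ->] := matrix_natE M.
  have -> : 1%:M + \matrix_(i < 2, j < 2) f i j =
      \matrix_(i < 2, j < 2) (fun a b => (a == b)%:R + f a b) i j.
    by apply/matrixP => i j; rewrite !mxE.
  rewrite (det_mx_nat2 (fun a b => (a == b)%:R + f a b)) /dot /mxtrace.
  rewrite !big_ord_recl !big_ord0 !mxE /= !addr0 !add0r.
  move: (f 0 0) (f 0 1) (f 1 0) (f 1 1) => a b c e.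
  apply: (@le_trans _ _ ((1 + a) * (1 + e) - b * c - 1 - (a + e))); last first.
    by rewrite !lerD2r; exact: ler_norm.
  have H : 0 <= (a * a + b * b + (c * c + e * e)) by rewrite -!expr2 !addr_ge0 ?sqr_ge0.
  have C1 : 1 <= 1 + 3 / 2 * (1 + r) by lra.
  have H2 := mulr_ge0 (_ : 0 <= 1 + 3 / 2 * (1 + r) - 1) H.
  rewrite subr_ge0 in H2; have {}H2 := H2 C1.
  have := sqr_ge0 (a + e); have := sqr_ge0 (b - c); rewrite sqrrB sqrrD !expr2; lra.
- have [f ->] := matrix_natE M.
  have -> : 1%:M + \matrix_(i < 3, j < 3) f i j =
      \matrix_(i < 3, j < 3) (fun a b => (a == b)%:R + f a b) i j.
    by apply/matrixP => i j; rewrite !mxE.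
  rewrite (det_mx_nat3 (fun a b => (a == b)%:R + f a b)) /dot /mxtrace.
  rewrite !big_ord_recl !big_ord0 !mxE /= !addr0 !add0r.
  rewrite /bump /=.
  move: (f 0 0) (f 0 1) (f 0 2) (f 1 0) (f 1 1) (f 1 2) (f 2 0) (f 2 1) (f 2 2).
  move=> a11 a12 a13 a21 a22 a23 a31 a32 a33.
  pose s := a11 ^+ 2 + a12 ^+ 2 + a13 ^+ 2 + a21 ^+ 2 + a22 ^+ 2 + a23 ^+ 2 +
    a31 ^+ 2 + a32 ^+ 2 + a33 ^+ 2.
  pose D := a11 * (a22 * a33 - a23 * a32) - a12 * (a21 * a33 - a23 * a31)
    + a13 * (a21 * a32 - a22 * a31).
  pose e2 := a11 * a22 - a12 * a21 + (a11 * a33 - a13 * a31) + (a22 * a33 - a23 * a32).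
  pose tr := a11 + (a22 + a33).
  rewrite (_ : a11 * a11 + _ + _ = s); last by rewrite /s; ring.
  rewrite (_ : (1 + a11) * _ - _ + _ = 1 + tr + e2 + D); last first.
    by rewrite /tr /e2 /D; ring.
  rewrite -/tr.
  have s0 : 0 <= s by rewrite /s !addr_ge0 ?sqr_ge0.
  pose t := Num.sqrt s.
  have t0 : 0 <= t by exact: sqrtr_ge0.
  have ts : t ^+ 2 = s by rewrite sqr_sqrtr.
  (* s + 2 e2 is the square of the trace plus the squares of the differences a_ij - a_ji, i < j. *)
  have e2s : - (s / 2) <= e2.
    have := sqr_ge0 tr; have := sqr_ge0 (a12 - a21); have := sqr_ge0 (a13 - a31).
    by have := sqr_ge0 (a23 - a32); rewrite /s /e2 /tr; lra.
  have trt : tr <= r * t.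
    rewrite -[leRHS]ger0_norm ?mulr_ge0//; last by lra.
    apply: le_trans (ler_norm _) _; rewrite -(ler_pXn2r (_ : 0 < 2)%N) ?nnegrE//.
    rewrite -!normrX !ger0_norm ?sqr_ge0// exprMn s32 ts.
    have := sqr_ge0 (a11 - a22); have := sqr_ge0 (a11 - a33); have := sqr_ge0 (a22 - a33).
    have := sqr_ge0 a12; have := sqr_ge0 a13; have := sqr_ge0 a21.
    have := sqr_ge0 a23; have := sqr_ge0 a31; have := sqr_ge0 a32.
    by rewrite /s /tr; lra.
  have Dt : - D <= t ^+ 3.
    pose x := a11 ^+ 2 + a12 ^+ 2 + a13 ^+ 2.
    pose y := a21 ^+ 2 + a22 ^+ 2 + a23 ^+ 2.
    pose z := a31 ^+ 2 + a32 ^+ 2 + a33 ^+ 2.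
    have [x0 [y0 z0]] : 0 <= x /\ 0 <= y /\ 0 <= z.
      by rewrite /x /y /z !addr_ge0 ?sqr_ge0.
    have sxyz : s = x + y + z by rewrite /s /x /y /z; ring.
    (* Hadamard's inequality, with the defect written as a sum of squares. *)
    have DD : D ^+ 2 <= x * y * z.
      pose w1 := a22 * a33 - a23 * a32; pose w2 := a23 * a31 - a21 * a33.
      pose w3 := a21 * a32 - a22 * a31.
      have -> : x * y * z = D ^+ 2 + x * (a21 * a31 + a22 * a32 + a23 * a33) ^+ 2 +
          ((a12 * w3 - a13 * w2) ^+ 2 + (a13 * w1 - a11 * w3) ^+ 2 +
           (a11 * w2 - a12 * w1) ^+ 2).
        by rewrite /x /y /z /D /w1 /w2 /w3; ring.
      by rewrite -addrA lerDl !addr_ge0 ?sqr_ge0// mulr_ge0// sqr_ge0.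
    (* Each factor is at most s; this crude bound suffices for the constant. *)
    have xyz : x * y * z <= s ^+ 3.
      rewrite sxyz !exprS expr0 mulr1 -mulrA; apply: ler_pM => //; try lra.
        exact: mulr_ge0.
      by apply: ler_pM => //; lra.
    rewrite -[leRHS]ger0_norm ?exprn_ge0//.
    apply: le_trans (ler_norm _) _; rewrite normrN -(ler_pXn2r (_ : 0 < 2)%N) ?nnegrE//.
    rewrite -!normrX !ger0_norm ?sqr_ge0// -exprM mulnC exprM ts.
    exact: le_trans xyz.
  (* If t <= 2 then - D <= 2 s, so the loss is at most s/2 + 2 s. If t > 2 then s >= 2 t > 4, and 1
     + r t <= s/4 + r s/2. *)
  have [t2|t2] := leP t 2.
  + apply: (@le_trans _ _ (1 + tr + e2 + D - 1 - tr)); last first.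
      by rewrite !lerD2r; exact: ler_norm.
    have : t ^+ 3 <= 2 * s by rewrite exprS ts ler_wpM2r.
    have : 5 / 3 * s <= r * s by rewrite ler_wpM2r.
    by lra.
  + apply: (@le_trans _ _ (0 - 1 - tr)); last by rewrite !lerD2r.
    have tt : 2 * t <= s by rewrite -ts expr2 ler_wpM2r// ltW.
    have r0 : 0 <= r by lra.
    have := mulr_ge0 r0 s0; have : r * (2 * t) <= r * s by rewrite ler_wpM2l.
    by lra.
Qed.

Lemma det_lower_bound d (A H : 'M[R]_d) (a q sigma : R) : d = 2%N \/ d = 3%N ->
  0 < a -> 0 < sigma -> \det A = 1 -> (forall s, singular_value A s -> sigma <= s) ->
  0 <= q -> q <= a * sigma ^+ 2 * (1 + 3 / 2 * (1 + Num.sqrt 3))^-1 ->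
  0 <= a / 2 * dot H H + q * (`|\det (A + H)| - 1 - dot (cof A) H).
Proof.
move=> hd a0 sigma0 dA hs q0 qC.
have C0 : 0 < C by have [s3 _] := sqrt3P; lra.
(* Since det A = 1, the adjugate is the inverse of A. *)
pose M := \adj A *m H.
have AM : A *m M = H by rewrite /M mulmxA mul_mx_adj dA mul1mx.
have cH : dot (cof A) H = \tr M.
  rewrite dotC dot_tr mxtrace_mulC /M; congr (\tr (_ *m _)).
  by apply/matrixP => i j; rewrite !mxE.
have dH : \det (A + H) = \det (1%:M + M).
  by rewrite -[in LHS]AM -[X in X + _]mulmx1 -mulmxDr det_mulmx dA mul1r.
have MH : sigma ^+ 2 * dot M M <= dot H H.
  by rewrite -[in leRHS]AM; apply: singular_value_lb_mx => //; exact: ltW.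
have := det_perturbation_lb M hd; rewrite -dH -cH => P.
have qC' : q * C <= a * sigma ^+ 2 by rewrite -ler_pdivlMr.
have H1 := ler_wpM2l q0 P.
have H2 := ler_wpM2r (dot_ge0 M) qC'.
have H3 := ler_wpM2l (ltW a0) MH.
by move: H1 H2 H3; move: (_ - dot (cof A) H) C (dot M M) (dot H H) => u k x y; lra.
Qed.

End determinant_expansion.

(** * Approximation of functions vanishing on the boundary *)

Section truncation.
Context {R : realType}.
Implicit Types (x t h : R).

(** The positive part. It enters [trunc] only through its square, which is C^1. *)
Definition posp x : R := (x + `|x|) / 2.

Lemma posp_ge0 x : 0 <= posp x.
Proof. by rewrite divr_ge0//; have := ler_norm (- x); rewrite normrN; lra. Qed.

Lemma posp_id x : 0 <= x -> posp x = x.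
Proof. by move=> x0; rewrite /posp ger0_norm//; field. Qed.

Lemma posp_eq0 x : x <= 0 -> posp x = 0.
Proof. by move=> x0; rewrite /posp ler0_norm// subrr mul0r. Qed.

Lemma continuous_posp : continuous posp.
Proof.
move=> x; apply: cvgMl; apply: cvgD; first exact: cvg_id.
exact: (@norm_continuous _ R^o).
Qed.

Lemma is_derive_posp2 x : is_derive x 1 (fun y => posp y ^+ 2) (2 * posp x).
Proof.
have [x0|x0|->] := ltgtP x 0.
- rewrite posp_eq0 ?mulr0; last exact: ltW.
  apply: (@near_eq_is_derive _ _ _ (cst 0)).
  near=> t; rewrite posp_eq0 ?expr0n//=; apply: ltW.
  by near: t; exact: lt_nbhsl.
- rewrite posp_id; last exact: ltW.
  apply: (@near_eq_is_derive _ _ _ (fun y : R => y ^+ 2)).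
    near=> t; rewrite posp_id//; apply: ltW.
    by near: t; exact: lt_nbhsr.
  have := is_deriveX 2 (is_derive_id x 1).
  by rewrite exprfctE /GRing.scale /= mulr1 expr1.
- rewrite posp_id// mulr0; apply: (is_derive1_quadratic (C := 1)).
    by rewrite posp_id// expr0n.
  move=> t; rewrite mul1r subr0 ger0_norm ?sqr_ge0//.
  have [t0|t0] := leP 0 t; first by rewrite posp_id.
  by rewrite posp_eq0 ?expr0n ?sqr_ge0//; exact: ltW.
Unshelve. all: by end_near. Qed.

(* An odd C^1 function vanishing on [-h, h] and tending to the identity as
   h -> 0, with slope bounded uniformly in h. *)
Definition trunc h t : R :=
  t * (posp (t ^+ 2 - h ^+ 2) ^+ 2 / (posp (t ^+ 2 - h ^+ 2) ^+ 2 + h ^+ 4)).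

Definition dtrunc h t : R :=
  posp (t ^+ 2 - h ^+ 2) ^+ 2 / (posp (t ^+ 2 - h ^+ 2) ^+ 2 + h ^+ 4) +
  4 * t ^+ 2 * posp (t ^+ 2 - h ^+ 2) * h ^+ 4 /
    (posp (t ^+ 2 - h ^+ 2) ^+ 2 + h ^+ 4) ^+ 2.

Lemma trunc_eq0 h t : `|t| <= h -> trunc h t = 0.
Proof.
move=> th; rewrite /trunc posp_eq0 ?expr0n/= ?mul0r ?mulr0//.
rewrite subr_le0 -real_normK ?num_real// lerXn2r ?nnegrE//.
exact: le_trans th.
Qed.

Let den_gt0 h y : 0 < h -> 0 < posp y ^+ 2 + h ^+ 4.
Proof. by move=> h0; rewrite ltr_wpDl ?sqr_ge0 ?exprn_gt0. Qed.

Lemma is_derive_ratio (y c : R) : y + c != 0 ->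
  is_derive y 1 (fun z : R => z / (z + c)) (c / (y + c) ^+ 2).
Proof.
move=> yc.
have dD : is_derive y 1 (fun z : R => z + c) 1.
  have := is_deriveD (is_derive_id y 1) (is_derive_cst c y 1).
  by rewrite addr0.
have dV := @is_deriveV R (fun z => z + c) y 1 1 yc dD.
have dM := is_deriveM (is_derive_id y 1) dV.
apply: (is_derive_eq dM); rewrite /GRing.scale /=; field.
by rewrite yc.
Qed.

Lemma is_derive_trunc h t : 0 < h -> is_derive t 1 (trunc h) (dtrunc h t).
Proof.
move=> h0.
have dq : is_derive t 1 (fun s : R => s ^+ 2 - h ^+ 2) (2 * t).
  have := is_deriveB (is_deriveX 2 (is_derive_id t 1)) (is_derive_cst (h ^+ 2) t 1).
  by rewrite exprfctE /GRing.scale /= mulr1 expr1 subr0.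
have dP : is_derive t 1 (fun s : R => posp (s ^+ 2 - h ^+ 2) ^+ 2)
    (2 * posp (t ^+ 2 - h ^+ 2) * (2 * t)).
  exact: (@is_derive1_comp R (fun y => posp y ^+ 2) (fun s => s ^+ 2 - h ^+ 2)
    t _ _ (is_derive_posp2 _) dq).
have D0 := lt0r_neq0 (den_gt0 (t ^+ 2 - h ^+ 2) h0).
have dQ := @is_derive1_comp R (fun z => z / (z + h ^+ 4))
  (fun s => posp (s ^+ 2 - h ^+ 2) ^+ 2) t _ _ (is_derive_ratio D0) dP.
have dM := is_deriveM (is_derive_id t 1) dQ.
apply: (is_derive_eq dM); rewrite /dtrunc /GRing.scale /=; field.
by rewrite D0.
Qed.

Lemma trunc_le h t : 0 < h -> `|trunc h t| <= `|t|.
Proof.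
move=> h0; rewrite /trunc normrM ler_piMr// ger0_norm.
  by rewrite ler_pdivrMr ?den_gt0// mul1r lerDl exprn_ge0// ltW.
by rewrite divr_ge0 ?sqr_ge0// ltW// den_gt0.
Qed.

(** 9 = 1 + 8. The first quotient is at most 1. The second is 0 for t^2 <= h^2; otherwise t^2 = m +
    k with k = h^2, and it equals 4 (m k k^2 + m^2 k^2) / (m^2 + k^2)^2, where each product is at
    most the denominator. *)
Lemma dtrunc_le h t : 0 < h -> `|dtrunc h t| <= 9.
Proof.
move=> h0; rewrite /dtrunc; set m := posp _.
have D0 := den_gt0 (t ^+ 2 - h ^+ 2) h0; rewrite -/m in D0.
have m0 : 0 <= m by exact: posp_ge0.
have h2 : 0 < h ^+ 2 by exact: exprn_gt0.
have h4 : h ^+ 4 = (h ^+ 2) ^+ 2 by rewrite -exprM.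
have H1 : m ^+ 2 / (m ^+ 2 + h ^+ 4) <= 1.
  by rewrite ler_pdivrMr// mul1r lerDl exprn_ge0// ltW.
have H2 : 4 * t ^+ 2 * m * h ^+ 4 / (m ^+ 2 + h ^+ 4) ^+ 2 <= 8.
  rewrite ler_pdivrMr ?exprn_gt0//.
  have [th|th] := leP (t ^+ 2) (h ^+ 2).
    have -> : m = 0 by rewrite /m posp_eq0// subr_le0.
    by rewrite mulr0 mul0r mulr_ge0// exprn_ge0// addr_ge0 ?exprn_ge0 ?(ltW h0).
  have mE : t ^+ 2 = m + h ^+ 2 by rewrite /m posp_id ?subrK// subr_ge0 ltW.
  rewrite mE h4; move: (h ^+ 2) h2 => k k0.
  have A1 : m * k <= m ^+ 2 + k ^+ 2 by have := sqr_ge0 (m - k); rewrite sqrrB; nra.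
  have A2 : k ^+ 2 <= m ^+ 2 + k ^+ 2 by rewrite lerDr sqr_ge0.
  have A3 : m ^+ 2 <= m ^+ 2 + k ^+ 2 by rewrite lerDl sqr_ge0.
  have B1 := ler_pM (mulr_ge0 m0 (ltW k0)) (sqr_ge0 k) A1 A2.
  have B2 := ler_pM (sqr_ge0 m) (sqr_ge0 k) A3 A2.
  have -> : 4 * (m + k) * m * k ^+ 2 = 4 * (m * k * k ^+ 2 + m ^+ 2 * k ^+ 2) by ring.
  by rewrite [X in _ <= 8 * X]expr2; lra.
rewrite ger0_norm; first by lra.
have h40 : 0 <= h ^+ 4 by rewrite exprn_ge0// ltW.
apply: addr_ge0; apply: divr_ge0; rewrite ?sqr_ge0 ?(ltW D0)//.
by apply: mulr_ge0 => //; apply: mulr_ge0 => //; apply: mulr_ge0; rewrite ?sqr_ge0.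
Qed.

Lemma continuous_dtrunc h : 0 < h -> continuous (dtrunc h).
Proof.
move=> h0 t.
have cX (k : nat) : {for t, continuous (fun s : R => s ^+ k)} by exact: exprn_continuous.
have cq : {for t, continuous (fun s : R => s ^+ 2 - h ^+ 2)}.
  by apply: cvgB; [exact: cX|exact: cvg_cst].
have cp : {for t, continuous (fun s : R => posp (s ^+ 2 - h ^+ 2))}.
  apply: (@continuous_comp _ _ _ (fun s : R => s ^+ 2 - h ^+ 2) posp) => //.
  exact: continuous_posp.
have cp2 : {for t, continuous (fun s : R => posp (s ^+ 2 - h ^+ 2) ^+ 2)}.
  rewrite (_ : (fun s => _) =
      (fun s => posp (s ^+ 2 - h ^+ 2) * posp (s ^+ 2 - h ^+ 2))); first exact: cvgM.
  by apply/funext => s; rewrite expr2.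
have cD : {for t, continuous (fun s : R => posp (s ^+ 2 - h ^+ 2) ^+ 2 + h ^+ 4)}.
  by apply: cvgD => //; exact: cvg_cst.
have D0 := lt0r_neq0 (den_gt0 (t ^+ 2 - h ^+ 2) h0).
apply: cvgD; first by apply: cvgM => //; exact: cvgV.
apply: cvgM.
  by apply: cvgM; [apply: cvgM => //; apply: cvgM; [exact: cvg_cst|exact: cX]|exact: cvg_cst].
apply: cvgV; first by rewrite expf_neq0.
rewrite (_ : (fun s => _) = (fun s => (posp (s ^+ 2 - h ^+ 2) ^+ 2 + h ^+ 4) *
    (posp (s ^+ 2 - h ^+ 2) ^+ 2 + h ^+ 4))); first exact: cvgM.
by apply/funext => s; rewrite [LHS]expr2.
Qed.

(** At t = 0 the slopes are all 0 although the limit function has slope 1. This is why the zero set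
    of u needs [partial_eq0_on_zeros]. *)
Lemma cvg_trunc t : trunc k.+1%:R^-1 t @[k --> \oo] --> t /\
  dtrunc k.+1%:R^-1 t @[k --> \oo] --> ((t != 0)%:R : R).
Proof.
have [->|t0] := eqVneq t 0.
  have E k : posp ((0 : R) ^+ 2 - k.+1%:R^-1 ^+ 2) = 0.
    by rewrite posp_eq0// expr0n /= sub0r oppr_le0 exprn_ge0.
  split; rewrite (_ : (fun k => _) = (fun=> 0)); try exact: cvg_cst.
    by apply/funext => k; rewrite /trunc mul0r.
  by apply/funext => k; rewrite /dtrunc E !expr0n /= mul0r mulr0 !mul0r addr0.
have h0 : (k.+1%:R^-1 : R) @[k --> \oo] --> (0 : R) by exact: cvg_harmonic.
have hX (j : nat) : ((k.+1%:R^-1 : R) ^+ j.+1) @[k --> \oo] --> (0 : R).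
  have -> : (0 : R) = 0 ^+ j.+1 by rewrite expr0n.
  apply: (@cvg_comp _ _ _ _ (fun t : R => t ^+ j.+1) _ _ _ h0).
  exact: exprn_continuous.
have t2 : 0 < t ^+ 2 by rewrite exprn_even_gt0.
have cm : posp (t ^+ 2 - (k.+1%:R^-1 : R) ^+ 2) @[k --> \oo] --> t ^+ 2.
  rewrite -[X in _ --> X]posp_id ?(ltW t2)// -[X in posp X]subr0.
  have cq : t ^+ 2 - (k.+1%:R^-1 : R) ^+ 2 @[k --> \oo] --> t ^+ 2 - 0.
    by apply: cvgB; [exact: cvg_cst|exact: hX].
  exact: (@cvg_comp _ _ _ _ posp _ _ _ cq (@continuous_posp _)).
have cm2 : posp (t ^+ 2 - (k.+1%:R^-1 : R) ^+ 2) ^+ 2 @[k --> \oo] --> (t ^+ 2) ^+ 2.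
  apply: (@cvg_comp _ _ _ _ (fun t : R => t ^+ 2) _ _ _ cm).
  exact: exprn_continuous.
have cD : posp (t ^+ 2 - (k.+1%:R^-1 : R) ^+ 2) ^+ 2 + (k.+1%:R^-1 : R) ^+ 4
    @[k --> \oo] --> (t ^+ 2) ^+ 2.
  by rewrite -[X in _ --> X]addr0; apply: cvgD => //; exact: hX.
have t4 : (t ^+ 2) ^+ 2 != 0 by rewrite !expf_neq0.
have cr : posp (t ^+ 2 - (k.+1%:R^-1 : R) ^+ 2) ^+ 2 /
  (posp (t ^+ 2 - (k.+1%:R^-1 : R) ^+ 2) ^+ 2 + (k.+1%:R^-1 : R) ^+ 4)
    @[k --> \oo] --> (1 : R).
  by rewrite -[X in _ --> X](mulfV t4); apply: cvgM => //; exact: cvgV.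
split.
  by rewrite -[X in _ --> X]mulr1; apply: cvgM => //; exact: cvg_cst.
rewrite -[X in _ --> X]addr0; apply: cvgD => //.
rewrite -[X in _ --> X](mul0r (((t ^+ 2) ^+ 2) ^+ 2)^-1); apply: cvgM.
  rewrite -[X in _ --> X](mulr0 (4 * t ^+ 2 * t ^+ 2)); apply: cvgM; last exact: hX.
  by apply: cvgM => //; exact: cvg_cst.
apply: cvgV; first by rewrite expf_neq0.
apply: (@cvg_comp _ _ _ _ (fun t : R => t ^+ 2) _ _ _ cD).
exact: exprn_continuous.
Qed.

End truncation.
Lemma continuous_trunc {R : realType} (h : R) : 0 < h -> continuous (trunc h).
Proof.
move=> h0 t; apply: differentiable_continuous; apply/derivable1_diffP.
by have [] := is_derive_trunc t h0.
Qed.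

Lemma near_eq_continuous_at {R : realType} {n : nat} (f g : 'rV[R]_n -> R) x :
  (\near x, f x = g x) -> {for x, continuous g} -> {for x, continuous f}.
Proof.
move=> fg cg; rewrite /prop_for /continuous_at (nbhs_singleton fg) => P nP.
have H : nbhs x [set y | P (g y)] by exact: cg.
have : nbhs x [set y | P (f y)] by apply: filterS2 fg H => y /= ->.
by [].
Qed.

Section vanishing_boundary.
Context {R : realType} {n : nat} (Omega : set 'rV[R]_n) (u : 'rV[R]_n -> R).
Local Notation e j := (delta_mx ord0 j).
Local Notation mu := (@lebesgue R n).
Hypotheses (oO : open Omega) (bO : bounded_set Omega)
  (uc : {within closure Omega, continuous u})
  (u0 : forall x, boundary Omega x -> u x = 0)
  (ud : forall j x, Omega x -> derivable u x (e j))
  (udc : forall j x, Omega x -> {for x, continuous (partial j u)}).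

Lemma within_closure_continuous x : Omega x -> {for x, continuous u}.
Proof.
move=> Ox; have := continuous_subspaceW (@subset_closure _ Omega) uc.
by rewrite continuous_open_subspace// => H; apply: H; rewrite inE.
Qed.

Definition cut h x : R := if x \in Omega then trunc h (u x) else 0.

(** At a boundary point u is 0 and continuous along the closure, so |u| < h nearby and the
    truncation vanishes there. Hence extension by 0 creates no singularity and the support stays
    inside Omega. *)
Lemma cut_near0 h x : 0 < h -> ~ Omega x -> \near x, cut h x = 0.
Proof.
move=> h0 nO; have [cx|ncx] := pselect (closure Omega x); last first.
  have : nbhs x (~` closure Omega).
    by apply: open_nbhs_nbhs; split => //; exact/closed_openC/closed_closure.
  apply: filterS => y ny; rewrite /cut; case: ifPn => //; rewrite inE => Oy.
  by case: ny; exact: subset_closure.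
have ux : u x = 0.
  by apply: u0; split => //; rewrite (interior_id _).1.
have := uc; rewrite subspace_continuousP => /(_ x cx).
move=> /cvgrPdist_lt /(_ h h0); rewrite /prop_near1 withinE => -[V nV HV].
apply: filterS nV => y Vy; rewrite /cut; case: ifPn => //; rewrite inE => Oy.
rewrite trunc_eq0//.
have : ([set t | `|u x - u t| < h] `&` closure Omega) y.
  by rewrite HV; split => //; exact: subset_closure.
by move=> -[/=]; rewrite ux sub0r normrN => /ltW.
Qed.

Lemma cut_nearE h x : Omega x -> \near x, cut h x = (trunc h \o u) x.
Proof.
move=> Ox; apply: filterS (open_nbhs_nbhs (conj oO Ox)) => y Oy.
by rewrite /cut mem_set.
Qed.

Lemma partial_cut h j x : 0 < h -> derivable (cut h) x (e j) /\
  partial j (cut h) x = if x \in Omega then dtrunc h (u x) * partial j u x else 0.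
Proof.
move=> h0; case: ifPn => [|/negP]; rewrite inE => Ox.
  have [H1 H2] := near_eq_partial j (cut_nearE h Ox).
  have [H3 H4] := partial_comp1 (is_derive_trunc (u x) h0) (@ud j x Ox).
  by split; [exact/H1|rewrite H2].
have [H1 H2] := near_eq_partial j (cut_near0 h0 Ox).
have [H3 H4] := partial_cst (0 : R) j x.
by split; [exact/H1|rewrite H2].
Qed.

Lemma continuous_cut h : 0 < h -> continuous (cut h).
Proof.
move=> h0 x; have [Ox|Ox] := pselect (Omega x).
  have H : {for x, continuous (trunc h \o u)}.
    apply: (@continuous_comp _ _ _ u (trunc h)); last exact: continuous_trunc.
    exact: within_closure_continuous.
  exact: near_eq_continuous_at (cut_nearE h Ox) H.
rewrite /prop_for /continuous_at {2}/cut ifF; last by apply/negP; rewrite inE.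
by apply: (@cvg_near_cst _ _ _ _ (nbhs x)); exact: cut_near0.
Qed.

Lemma continuous_partial_cut h j : 0 < h -> continuous (partial j (cut h)).
Proof.
move=> h0; rewrite (_ : partial j (cut h) =
    fun x => if x \in Omega then dtrunc h (u x) * partial j u x else 0); last first.
  by apply/funext => x; rewrite (partial_cut j x h0).2.
move=> x; have [Ox|Ox] := pselect (Omega x).
  have H : {for x, continuous (fun x => dtrunc h (u x) * partial j u x)}.
    apply: (@continuousM _ _ (dtrunc h \o u) (partial j u)); last exact: udc.
    apply: (@continuous_comp _ _ _ u (dtrunc h)); last exact: continuous_dtrunc.
    exact: within_closure_continuous.
  apply: near_eq_continuous_at H.
  by apply: filterS (open_nbhs_nbhs (conj oO Ox)) => y Oy; rewrite mem_set.
rewrite /prop_for /continuous_at [X in _ --> X]ifF; last by apply/negP; rewrite inE.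
apply: (@cvg_near_cst _ _ _ _ (nbhs x)).
(* A partial derivative at y depends on a neighbourhood of y, so the vanishing is needed around
   every nearby y. *)
apply: filterS (near_join (cut_near0 h0 Ox)) => y H.
rewrite -(partial_cut j y h0).2 (near_eq_partial j H).2.
exact: (partial_cst _ _ _).2.
Qed.

Lemma cut_support h : 0 < h -> supported_in Omega (cut h).
Proof.
move=> h0; exists (closure [set x | cut h x != 0]); split.
- apply: (subclosed_compact _ (compact_closure_bounded bO)).
    exact: closed_closure.
  apply: closure_subset => x /=; rewrite /cut; case: ifPn; last by rewrite eqxx.
  by rewrite inE.
- move=> x cx; apply: contrapT => nO; have := cx _ (cut_near0 h0 nO).
  by move=> [y [/= /eqP]].
- move=> x nx; apply: contrapT => /eqP cx; apply: nx; exact: subset_closure.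
Qed.

Lemma cut_le h x : 0 < h -> `|cut h x| <= `|u x|.
Proof. by move=> h0; rewrite /cut; case: ifPn => _; rewrite ?trunc_le// normr0. Qed.

Context (C : R).
Hypotheses (uB : forall x, Omega x -> `|u x| <= C)
  (duB : forall j x, Omega x -> `|partial j u x| <= C).

Let mO := open_rV_measurable oO.
Let mub : (mu Omega < +oo)%E. Proof. exact: lebesgue_bounded_ltoo. Qed.

Let mfu : measurable_fun Omega u.
Proof. by apply: measurable_fun_continuous_on => // x; exact: within_closure_continuous. Qed.

Let mdu j : measurable_fun Omega (partial j u).
Proof. by apply: measurable_fun_continuous_on => // x; exact: udc. Qed.

Let h_gt0 k : 0 < k.+1%:R^-1 :> R. Proof. by rewrite invr_gt0. Qed.

Let w k := cut k.+1%:R^-1.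

Let cw x : Omega x -> w k x @[k --> \oo] --> u x.
Proof.
move=> Ox; rewrite /w /cut mem_set//; exact: (cvg_trunc (u x)).1.
Qed.

Let cdw j x : Omega x ->
  partial j (w k) x @[k --> \oo] --> (u x != 0)%:R * partial j u x.
Proof.
move=> Ox; under eq_fun do rewrite /w (partial_cut j x (h_gt0 _)).2 mem_set//.
by apply: cvgM; [exact: (cvg_trunc (u x)).2|exact: cvg_cst].
Qed.

Let wC k x : Omega x -> `|w k x| <= C.
Proof. by move=> Ox; apply: le_trans (uB Ox); exact: cut_le. Qed.

Let dwC k j x : Omega x -> `|partial j (w k) x| <= 9 * C.
Proof.
move=> Ox; rewrite (partial_cut j x (h_gt0 _)).2 mem_set// normrM ler_pM//.
  exact: dtrunc_le.
exact: duB.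
Qed.

Let mw k : measurable_fun Omega (w k).
Proof. by apply: measurable_fun_continuous_rV => //; exact: continuous_cut. Qed.

Let mdw k j : measurable_fun Omega (partial j (w k)).
Proof. by apply: measurable_fun_continuous_rV => //; exact: continuous_partial_cut. Qed.

Let mg j : measurable_fun Omega (fun x => (u x != 0)%:R * partial j u x).
Proof.
apply: (@measurable_fun_cvg _ _ _ _ (fun k => partial j (w k))) => //.
by move=> x Ox; exact: cdw.
Qed.

(* The gradient of trunc h u converges both to that of u in the sense of
   distributions and pointwise to its restriction to {u != 0}. *)
Lemma partial_eq0_on_zeros j : ae_on Omega (fun x => u x = 0 -> partial j u x = 0).
Proof.
suff H : ae_on Omega (fun x => (u x != 0)%:R * partial j u x - partial j u x = 0).
  apply: ae_onW H => x Ox + ux; rewrite ux eqxx mul0r sub0r => /eqP.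
  by rewrite oppr_eq0 => /eqP.
have L1g : L1loc Omega (fun x => (u x != 0)%:R * partial j u x).
  split => // K cK KO; have mK := compact_rV_measurable cK.
  apply: (@integrableS _ _ _ _ Omega) => //.
  apply: measurable_bounded_integrable => //.
  exists C; split; first exact: num_real.
  move=> M CM x Ox; rewrite /= normrM (le_trans _ (ltW CM))//.
  rewrite -[X in _ <= X]mul1r ler_pM//; last exact: duB.
  by case: (_ != _); rewrite ?normr1 ?normr0.
have L1u : L1loc Omega (partial j u) by apply: L1loc_continuous => // x; exact: udc.
apply: (fundamental_lemma oO (L1locB L1g L1u)) => phi tphi.
have [cphi sphi] := (test_continuous tphi, test_supported tphi).
have i1 := integrable_L1loc_test oO L1g cphi sphi.
have i2 := integrable_L1loc_test oO L1u cphi sphi.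
under eq_Rintegral do rewrite mulrBl.
rewrite RintegralB//; apply/eqP; rewrite subr_eq0; apply/eqP.
have [ip is_] := (test_continuous (test_partial j tphi), test_supported (test_partial j tphi)).
have [mphi mdphi] : measurable_fun Omega phi /\ measurable_fun Omega (partial j phi).
  by split; apply: measurable_fun_continuous_rV.
have [i3 i4] : mu.-integrable Omega (EFin \o (fun x => 9 * C * `|phi x|)) /\
    mu.-integrable Omega (EFin \o (fun x => C * `|partial j phi x|)).
  have ab (f : 'rV[R]_n -> R) (c : R) : continuous f -> supported_in Omega f ->
      mu.-integrable Omega (EFin \o (fun x => c * `|f x|)).
    move=> cf sf; apply: integrableZl_EFin => //; apply: integrable_norm.
    apply: (@integrableS _ _ _ _ setT) => //.
    exact: bounded_support_integrable (supported_in_bounded sf) cf.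
  by split; apply: ab.
have [|||||_ c1] := @dominated_cvg_Rintegral _ _ _ mu Omega mO
  (fun k x => partial j (w k) x * phi x)
  (fun x => (u x != 0)%:R * partial j u x * phi x) (fun x => 9 * C * `|phi x|).
- by move=> k; exact: measurable_funM.
- exact: measurable_funM.
- by apply: aeW => x Ox; apply: cvgM; [exact: cdw|exact: cvg_cst].
- exact: i3.
- by move=> k x Ox; rewrite normrM ler_wpM2r// dwC.
have [|||||_ c2] := @dominated_cvg_Rintegral _ _ _ mu Omega mO
  (fun k x => w k x * partial j phi x)
  (fun x => u x * partial j phi x) (fun x => C * `|partial j phi x|).
- by move=> k; exact: measurable_funM.
- exact: measurable_funM.
- by apply: aeW => x Ox; apply: cvgM; [exact: cw|exact: cvg_cst].
- exact: i4.
- by move=> k x Ox; rewrite normrM ler_wpM2r// wC.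
have dphi x : derivable phi x (e j) := smooth_derivable tphi.1.
have E k : \int[mu]_(x in Omega) (partial j (w k) x * phi x) =
   - \int[mu]_(x in Omega) (w k x * partial j phi x).
  rewrite (@integral_by_parts _ _ Omega (w k) phi)// ?opprK//.
  + by move=> x _; exact: continuous_cut.
  + by move=> x _; exact: (partial_cut j x (h_gt0 k)).1.
  + by move=> x _; exact: continuous_partial_cut.
have E2 : \int[mu]_(x in Omega) (partial j u x * phi x) =
   - \int[mu]_(x in Omega) (u x * partial j phi x).
  rewrite (@integral_by_parts _ _ Omega u phi)// ?opprK//.
  + by move=> x Ox; exact: within_closure_continuous.
  + by move=> x Ox; exact: ud.
  + by move=> x Ox; exact: udc.
have c3 : \int[mu]_(x in Omega) (partial j (w k) x * phi x) @[k --> \oo] -->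
    - \int[mu]_(x in Omega) (u x * partial j phi x).
  by under eq_fun do rewrite E; exact: cvgN.
by rewrite E2; apply: (cvg_unique _ c1 c3); exact: norm_hausdorff.
Qed.

(** The truncation at height 1/(k+1) is mollified to within 1/(k+1), together with its partial
    derivatives. The bounds uniform in k, where 9 is the slope bound of [dtrunc_le], allow dominated
    convergence later. *)
Lemma vanishing_boundary_approximation : exists phi : nat -> 'rV[R]_n -> R,
  [/\ forall k, test Omega (phi k),
      forall k x, Omega x -> `|phi k x| <= C + 1,
      forall k j x, Omega x -> `|partial j (phi k) x| <= 9 * C + 1,
      forall x, Omega x -> phi k x @[k --> \oo] --> u x
    & forall j, ae_on Omega
        (fun x => partial j (phi k) x @[k --> \oo] --> partial j u x)].
Proof.
have H k : exists phi, [/\ test Omega phi, forall x, `|phi x - w k x| <= k.+1%:R^-1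
    & forall j x, `|partial j phi x - partial j (w k) x| <= k.+1%:R^-1].
  have [K [cK KO K0]] := cut_support (h_gt0 k).
  apply: (test_approximation oO cK KO K0) => //.
  - exact: continuous_cut.
  - by move=> j x; exact: (partial_cut j x (h_gt0 k)).1.
  - by move=> j; exact: continuous_partial_cut.
pose phi k := sval (cid (H k)).
have phiP k := svalP (cid (H k)).
have k1 k : (k.+1%:R^-1 : R) <= 1 by rewrite invf_le1// ler1n.
have near_le (f g : nat -> R) (b : R) : (forall k, `|f k - g k| <= k.+1%:R^-1) ->
    (forall k, `|g k| <= b) -> forall k, `|f k| <= b + 1.
  move=> fg gb k; have := ler_normD (f k - g k) (g k); rewrite subrK => /le_trans; apply.
  by move: (fg k) (gb k) (k1 k); move: (_^-1) => r; lra.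
have near_cvg (f g : nat -> R) (c : R) : (forall k, `|f k - g k| <= k.+1%:R^-1) ->
    g @ \oo --> c -> f @ \oo --> c.
  move=> fg gc.
  have fg0 : f k - g k @[k --> \oo] --> (0 : R).
    apply/norm_cvg0P; apply: (@squeeze_cvgr _ _ _ _ (cst 0) (fun k : nat => k.+1%:R^-1 : R)).
    - by apply: nearW => k /=; rewrite fg normr_ge0.
    - exact: cvg_cst.
    - exact: cvg_harmonic.
  have -> : f = (fun k => (f k - g k) + g k) by apply/funext => k; rewrite subrK.
  by rewrite -[c]add0r; exact: cvgD.
exists phi; split.
- by move=> k; have [] := phiP k.
- move=> k x Ox; apply: (near_le (phi ^~ x) (w ^~ x)).
    by move=> l; have [_ P _] := phiP l; exact: P.
  by move=> l; exact: wC.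
- move=> k j x Ox; apply: (near_le (fun l => partial j (phi l) x) (fun l => partial j (w l) x)).
    by move=> l; have [_ _ P] := phiP l; exact: P.
  by move=> l; exact: dwC.
- move=> x Ox; apply: (near_cvg _ (w ^~ x)); last exact: cw.
  by move=> l; have [_ P _] := phiP l; exact: P.
- move=> j; apply: ae_onW (partial_eq0_on_zeros j) => x Ox uz.
  apply: (near_cvg _ (fun l => partial j (w l) x)).
    by move=> l; have [_ _ P] := phiP l; exact: P.
  have := @cdw j x Ox; have [ux|ux] := eqVneq (u x) 0; last by rewrite mul1r.
  by rewrite uz// mulr0.
Qed.

End vanishing_boundary.

(** * Null Lagrangians *)

(* Unification would otherwise unfold limits to compare two partial derivatives. *)
Local Opaque partial.

Lemma Rintegral_eq0 d (T : measurableType d) (R : realType)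
    (mu : {measure set T -> \bar R}) (D : set T) (f : T -> R) :
  (forall x, D x -> f x = 0) -> \int[mu]_(x in D) f x = 0.
Proof.
move=> f0; rewrite /Rintegral integral0_eq//.
by move=> x Dx; rewrite /= f0.
Qed.

(** * Symmetry of second partial derivatives *)

Section schwarz.
Context {R : realType} {n : nat}.
Implicit Types (f : 'rV[R]_n -> R) (x : 'rV[R]_n) (i j : 'I_n).
Local Notation e j := (delta_mx ord0 j).

Lemma continuous_dist f x (eps : R) : {for x, continuous f} -> 0 < eps ->
  exists2 r, 0 < r & forall y, `|x - y| < r -> `|f x - f y| <= eps.
Proof.
move=> cf e0; have : nbhs x [set y | `|f x - f y| <= eps].
  exact: (@cvgrPdist_le _ _ _ (nbhs x) _ _ _).1 cf _ e0.
by move=> /nbhs_ballP[r /= r0 H]; exists r => // y; have := H y; rewrite -ball_normE.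
Qed.

Lemma line_MVT f j x (dl : R) : 0 < dl -> (forall y, derivable f y (e j)) ->
  exists2 t, 0 <= t <= dl & f (dl *: e j + x) - f x = partial j f (t *: e j + x) * dl.
Proof.
move=> d0 df.
have [||t] := @MVT R (fun s => f (s *: e j + x)) (fun s => partial j f (s *: e j + x)) 0 dl d0.
- by move=> s _; exact: is_derive_line.
- apply: continuous_subspaceT => s; apply: differentiable_continuous.
  by apply/derivable1_diffP; rewrite derivable_line.
rewrite in_itv/= => /andP[t0 td] E; exists t; first by rewrite !ltW.
by move: E; rewrite scale0r add0r subr0.
Qed.

Lemma second_difference f i j x (dl : R) : 0 < dl ->
  (forall y, derivable f y (e i)) -> (forall y, derivable (partial i f) y (e j)) ->
  exists y, `|x - y| <= 2 * dl /\
   f (dl *: e i + (dl *: e j + x)) - f (dl *: e j + x) - (f (dl *: e i + x) - f x) =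
   partial j (partial i f) y * dl * dl.
Proof.
move=> d0 df ddf.
pose g y := f (dl *: e j + y) - f y.
have dg y : derivable g y (e i) /\
    partial i g y = partial i f (dl *: e j + y) - partial i f y.
  have E : (fun s : R => f (dl *: e j + (s *: e i + y))) =
      (fun s : R => f (s *: e i + (dl *: e j + y))).
    by apply/funext => s; rewrite addrCA.
  have [H1 H2] : derivable (fun z => f (dl *: e j + z)) y (e i) /\
      partial i (fun z => f (dl *: e j + z)) y = partial i f (dl *: e j + y).
    by apply: line_is_derive; rewrite E; exact: is_derive_line0.
  by have [H3 H4] := partialB H1 (df y); rewrite /g -H2.
have [s s0 Es] := line_MVT x d0 (fun y => (dg y).1).
have [t t0 Et] := line_MVT (s *: e i + x) d0 ddf.
exists (t *: e j + (s *: e i + x)); split.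
  have -> : x - (t *: e j + (s *: e i + x)) = - (t *: e j) - s *: e i.
    by rewrite !opprD addrC -!addrA addNr addr0.
  rewrite (le_trans (ler_normB _ _))// normrN !normrZ.
  have [/andP[? ?] /andP[? ?]] := (s0, t0).
  rewrite !ger0_norm// mulr2n mulrDl mul1r; apply: lerD.
    by rewrite -[leRHS]mulr1; apply: ler_pM => //; exact: norm_delta_mx_le1.
  by rewrite -[leRHS]mulr1; apply: ler_pM => //; exact: norm_delta_mx_le1.
rewrite -Et -(dg _).2 -Es /g [in LHS]addrCA; ring.
Qed.

(** The double increment of f along i and j does not depend on the order. By [second_difference] the
    two mixed derivatives agree at points y and z close to x, and continuity brings both to x. *)
Lemma partialC f i j x :
  (forall k y, derivable f y (e k)) ->
  (forall k l y, derivable (partial k f) y (e l)) ->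
  (forall k l, continuous (partial k (partial l f))) ->
  partial i (partial j f) x = partial j (partial i f) x.
Proof.
move=> df ddf cf; apply/eqP; rewrite -subr_eq0 -normr_le0; apply/ler_addgt0Pr => eps e0.
rewrite add0r.
have e2 : 0 < eps / 2 by rewrite divr_gt0.
have [r1 r10 H1] := continuous_dist (cf i j x) e2.
have [r2 r20 H2] := continuous_dist (cf j i x) e2.
(* The intermediate points lie within 2 dl of x, which must be below both radii. *)
pose dl := Num.min r1 r2 / 3.
have d0 : 0 < dl by rewrite divr_gt0// lt_min r10.
have dr : 2 * dl < r1 /\ 2 * dl < r2.
  have := ge_min r1 r1 r2; have := ge_min r2 r1 r2.
  rewrite !lexx orbT /dl; move: (Num.min _ _) r10 r20 d0 => m; rewrite /dl; lra.
have [y [y1 Ey]] := second_difference x d0 (df i) (ddf i j).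
have [z [z1 Ez]] := second_difference x d0 (df j) (ddf j i).
have alg (a b b' c p q r : R) : r != 0 -> a - b - (b' - c) = p * r * r ->
    a - b' - (b - c) = q * r * r -> p = q.
  by move=> r0 E1 E2; apply: (mulIf r0); apply: (mulIf r0); rewrite -E1 -E2; ring.
have Eq : dl *: e j + (dl *: e i + x) = dl *: e i + (dl *: e j + x) := addrCA _ _ _.
rewrite Eq in Ez.
have E : partial j (partial i f) y = partial i (partial j f) z.
  exact: (alg _ _ _ _ _ _ _ (lt0r_neq0 d0) Ey Ez).
have Hy : `|partial j (partial i f) x - partial j (partial i f) y| <= eps / 2.
  by apply: H2; apply: le_lt_trans y1 _; case: dr.
have Hz : `|partial i (partial j f) x - partial i (partial j f) z| <= eps / 2.
  by apply: H1; apply: le_lt_trans z1 _; case: dr.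
have alg2 (a b p q r : R) : `|a - p| <= r / 2 -> `|b - q| <= r / 2 -> p = q -> `|a - b| <= r.
  move=> + + pq; rewrite -pq => H3 H4; apply: (le_trans (ler_distD p _ _)).
  by rewrite (splitr r); apply: lerD; [exact: H3|rewrite distrC; exact: H4].
exact: (alg2 _ _ _ _ _ Hz Hy (esym E)).
Qed.

Lemma smooth_partialC f i j x : smooth f ->
  partial i (partial j f) x = partial j (partial i f) x.
Proof.
move=> sf; apply: partialC.
- by move=> k y; exact: smooth_derivable.
- by move=> k l y; apply: smooth_derivable; exact: smooth_partial.
- by move=> k l; apply: smooth_continuous; do 2 apply: smooth_partial.
Qed.

End schwarz.

Section null_lagrangian.
Context {R : realType} {n : nat} (Omega : set 'rV[R]_n).
Implicit Types (f g phi : 'rV[R]_n -> R) (x : 'rV[R]_n) (i j k : 'I_n).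
Local Notation e j := (delta_mx ord0 j).
Local Notation mu := (@lebesgue R n).
Hypothesis oO : open Omega.

Definition C1_on f := [/\ forall x, Omega x -> {for x, continuous f},
  forall j x, Omega x -> derivable f x (e j)
  & forall j x, Omega x -> {for x, continuous (partial j f)}].

(** The minor on columns i and j of the matrix with rows grad g and grad phi. *)
Definition minor g phi i j x :=
  partial i g x * partial j phi x - partial j g x * partial i phi x.

Lemma integrable_minor g phi i j : C1_on g -> test Omega phi ->
  mu.-integrable Omega (EFin \o minor g phi i j).
Proof.
move=> [cg dg cdg] tphi.
have H k l : mu.-integrable Omega (EFin \o (fun x => partial k g x * partial l phi x)).
  apply: integrable_mul_supported => //; first by move=> x; exact: cdg.
    exact: test_continuous (test_partial l tphi).
  exact: test_supported (test_partial l tphi).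
by apply: integrableB_EFin => //; exact: open_rV_measurable.
Qed.

(** g is only C^1, so all derivatives are moved from g onto m and phi. The mixed second derivatives
    of phi cancel by symmetry, and only products of first derivatives remain. *)
Lemma integral_minorM g m phi i j : C1_on g -> test Omega phi ->
  continuous m -> (forall k x, derivable m x (e k)) ->
  (forall k, continuous (partial k m)) ->
  \int[mu]_(x in Omega) (m x * minor g phi i j x) =
  \int[mu]_(x in Omega) (g x * (partial j m x * partial i phi x -
                                partial i m x * partial j phi x)).
Proof.
move=> [cg dg cdg] tphi cm dm cdm.
have mO := open_rV_measurable oO.
have cphi k := test_continuous (test_partial k tphi).
have sphi k := test_supported (test_partial k tphi).
have cdphi k l := test_continuous (test_partial k (test_partial l tphi)).
have dphi k l x : derivable (partial k phi) x (e l).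
  by apply: smooth_derivable; exact: (test_partial k tphi).1.
pose w k x := m x * partial k phi x.
have cw k : continuous (w k).
  by move=> x; apply: (@continuousM _ _ m (partial k phi)); [exact: cm|exact: cphi].
have sw k : supported_in Omega (w k) by exact: supported_inMl.
have dw k l x : derivable (w k) x (e l) /\ partial l (w k) x =
    m x * partial l (partial k phi) x + partial l m x * partial k phi x.
  exact: partialM.
have cdw k l : continuous (partial l (w k)).
  rewrite (_ : partial l (w k) =
      fun x => m x * partial l (partial k phi) x + partial l m x * partial k phi x).
    move=> x; apply: (@continuousD _ _ _ (fun x => m x * partial l (partial k phi) x)).
      by apply: (@continuousM _ _ m (partial l (partial k phi))); [exact: cm|exact: cdphi].
    by apply: (@continuousM _ _ (partial l m) (partial k phi)); [exact: cdm|exact: cphi].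
  by apply/funext => x; rewrite (dw k l x).2.
have IBP k l : \int[mu]_(x in Omega) (partial l g x * w k x) =
    - \int[mu]_(x in Omega) (g x * partial l (w k) x).
  rewrite (@integral_by_parts _ _ Omega g (w k))// ?opprK//.
  + by move=> x Ox; exact: dg.
  + by move=> x Ox; exact: cdg.
  + by move=> x; exact: (dw k l x).1.
have i1 k l : mu.-integrable Omega (EFin \o (fun x => partial l g x * w k x)).
  by apply: integrable_mul_supported => // x; exact: cdg.
have i2 k l : mu.-integrable Omega (EFin \o (fun x => g x * partial l (w k) x)).
  by apply: integrable_mul_supported => //; exact: supported_in_partial.
transitivity (\int[mu]_(x in Omega) (partial i g x * w j x - partial j g x * w i x)).
  apply: eq_Rintegral => x _; rewrite /minor /w mulrBr.
  by congr (_ - _); rewrite mulrCA.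
rewrite RintegralB// !IBP opprK addrC -RintegralB//; apply: eq_Rintegral => x _.
rewrite (dw i j x).2 (dw j i x).2 (smooth_partialC i j x tphi.1) -mulrBr.
by rewrite opprD addrACA subrr add0r.
Qed.

Lemma integral_minor g phi i j : C1_on g -> test Omega phi ->
  \int[mu]_(x in Omega) minor g phi i j x = 0.
Proof.
move=> Cg tphi.
transitivity (\int[mu]_(x in Omega) ((fun=> 1) x * minor g phi i j x)).
  by apply: eq_Rintegral => x _; rewrite mul1r.
have p0 k x : partial k (fun _ : 'rV[R]_n => 1) x = 0 := (partial_cst 1 k x).2.
rewrite integral_minorM//.
- by apply: Rintegral_eq0 => x _; rewrite !p0 !mul0r subr0 mulr0.
- exact: cst_continuous.
- move=> k; rewrite (_ : partial k _ = fun=> 0); first exact: cst_continuous.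
  by apply/funext => x; rewrite p0.
Qed.

(** The sum is the determinant of the gradients of c . x + psi, g and phi, expanded along its first
    row. After [integral_minorM] the six terms carry mixed second derivatives of psi and cancel in
    pairs. *)
Let triple_smooth psi g phi (c : 'I_n -> R) i j k : C1_on g -> test Omega phi ->
  test Omega psi ->
  \int[mu]_(x in Omega) ((c k + partial k psi x) * minor g phi i j x) +
  \int[mu]_(x in Omega) ((c i + partial i psi x) * minor g phi j k x) +
  \int[mu]_(x in Omega) ((c j + partial j psi x) * minor g phi k i x) = 0.
Proof.
move=> Cg tphi tpsi.
have mO := open_rV_measurable oO.
have sdpsi l := (test_partial l tpsi).1.
have dm l l' x : derivable (fun y => c l + partial l psi y) x (e l') /\
    partial l' (fun y => c l + partial l psi y) x = partial l' (partial l psi) x.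
  have [c1 c2] := partial_cst (c l) l' x.
  have [H1 H2] := partialD c1 (smooth_derivable (j := l') (x := x) (sdpsi l)).
  by rewrite H2 c2 add0r.
have cc l : continuous (fun y => c l + partial l psi y).
  move=> x; apply: (@continuousD _ _ _ (fun=> c l)); first exact: cst_continuous.
  exact: (smooth_continuous (sdpsi l)).
have cdc l l' : continuous (partial l' (fun y => c l + partial l psi y)).
  rewrite (_ : partial l' _ = partial l' (partial l psi)).
    by apply: smooth_continuous; exact: smooth_partial.
  by apply/funext => x; rewrite (dm l l' x).2.
have cdm l := integral_minorM _ _ Cg tphi (cc l) (fun l' x => (dm l l' x).1) (cdc l).
have cg : forall x, Omega x -> {for x, continuous g} by case: Cg.
pose G l l1 l2 x := g x *
  (partial l2 (partial l psi) x * partial l1 phi x -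
   partial l1 (partial l psi) x * partial l2 phi x).
have iG l l1 l2 : mu.-integrable Omega (EFin \o G l l1 l2).
  have cd k1 k2 : continuous (fun x => partial k1 (partial l psi) x * partial k2 phi x).
    move=> x; apply: (@continuousM _ _ (partial k1 (partial l psi)) (partial k2 phi)).
      exact: (smooth_continuous (smooth_partial k1 (sdpsi l))).
    exact: (smooth_continuous (smooth_partial k2 tphi.1)).
  have sd k1 k2 : supported_in Omega (fun x => partial k1 (partial l psi) x * partial k2 phi x).
    apply: supported_inMl; exact: test_supported (test_partial k2 tphi).
  apply: (integrable_mul_supported oO cg); last exact: supported_inB.
  move=> x; apply: (@continuousB _ _ _
    (fun x => partial l2 (partial l psi) x * partial l1 phi x)
    (fun x => partial l1 (partial l psi) x * partial l2 phi x)).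
    exact: cd.
  exact: cd.
have E l l1 l2 : \int[mu]_(x in Omega) ((c l + partial l psi x) * minor g phi l1 l2 x) =
    \int[mu]_(x in Omega) G l l1 l2 x.
  apply: (etrans (cdm l1 l2 l)); apply: eq_Rintegral => x _.
  by rewrite (dm l l1 x).2 (dm l l2 x).2.
have iG2 := integrableD_EFin mO (iG k i j) (iG i j k).
apply: (etrans (congr2 +%R (congr2 +%R (E k i j) (E i j k)) (E j k i))).
apply: (etrans (congr1 (+%R^~ _) (esym (RintegralD mO (iG k i j) (iG i j k))))).
apply: (etrans (esym (RintegralD mO iG2 (iG j k i)))).
apply: Rintegral_eq0 => x _; rewrite /G.
have alg (a p q w s t v : R) : a * (p * s - q * t) + a * (q * t - w * v) + a * (w * v - p * s) = 0.
  by ring.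
rewrite (smooth_partialC i j x tpsi.1) (smooth_partialC k i x tpsi.1).
rewrite (smooth_partialC j k x tpsi.1).
exact: alg.
Qed.

Context (bO : bounded_set Omega) (u : 'rV[R]_n -> R) (C : R).
Hypotheses (uc : {within closure Omega, continuous u})
  (u0 : forall x, boundary Omega x -> u x = 0)
  (ud : forall j x, Omega x -> derivable u x (e j))
  (udc : forall j x, Omega x -> {for x, continuous (partial j u)})
  (uB : forall x, Omega x -> `|u x| <= C)
  (duB : forall j x, Omega x -> `|partial j u x| <= C).

(* The determinant of the gradients of (c . x + u, g, phi). *)
Lemma integral_triple g phi (c : 'I_n -> R) i j k : C1_on g -> test Omega phi ->
  \int[mu]_(x in Omega) ((c k + partial k u x) * minor g phi i j x) +
  \int[mu]_(x in Omega) ((c i + partial i u x) * minor g phi j k x) +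
  \int[mu]_(x in Omega) ((c j + partial j u x) * minor g phi k i x) = 0.
Proof.
move=> Cg tphi; have mO := open_rV_measurable oO.
(* The triple is linear in grad u with integrable coefficients, so a.e. convergence with uniform
   bounds of the gradients of psi is enough. *)
have [psi [tpsi _ dpsiB _ cdpsi]] := vanishing_boundary_approximation oO bO uc u0 ud udc uB duB.
have cI l l1 l2 :
   \int[mu]_(x in Omega) ((c l + partial l (psi m) x) * minor g phi l1 l2 x) @[m --> \oo] -->
   \int[mu]_(x in Omega) ((c l + partial l u x) * minor g phi l1 l2 x).
  have iM := integrable_minor l1 l2 Cg tphi.
  have [|||||_ //] := @dominated_cvg_Rintegral _ _ _ mu Omega mO
    (fun m x => (c l + partial l (psi m) x) * minor g phi l1 l2 x)
    (fun x => (c l + partial l u x) * minor g phi l1 l2 x)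
    (fun x => (`|c l| + (9 * C + 1)) * `|minor g phi l1 l2 x|).
  - move=> m; apply: measurable_funM; last exact: integrable_measurable_fun iM.
    apply: measurable_funD; first exact: measurable_cst.
    apply: measurable_fun_continuous_rV => //; exact: test_continuous (test_partial l (tpsi m)).
  - apply: measurable_funM; last exact: integrable_measurable_fun iM.
    apply: measurable_funD; first exact: measurable_cst.
    by apply: measurable_fun_continuous_on => // x; exact: udc.
  - apply: ae_onW (cdpsi l) => x Ox H; apply: cvgM; last exact: cvg_cst.
    by apply: cvgD => //; exact: cvg_cst.
  - by apply: integrableZl_EFin => //; exact: integrable_norm.
  - move=> m x Ox; rewrite normrM ler_wpM2r// (le_trans (ler_normD _ _))// lerD2l.
    exact: dpsiB.
pose J v l l1 l2 := \int[mu]_(x in Omega) ((c l + partial l v x) * minor g phi l1 l2 x).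
have H : J (psi m) k i j + J (psi m) i j k + J (psi m) j k i @[m --> \oo] -->
    J u k i j + J u i j k + J u j k i.
  by apply: cvgD; [apply: cvgD|]; exact: cI.
apply: (cvg_unique _ H); first exact: norm_hausdorff.
have E m : J (psi m) k i j + J (psi m) i j k + J (psi m) j k i = 0.
  exact: triple_smooth.
rewrite (_ : (fun m => _) = fun=> 0); first exact: cvg_cst.
by apply/funext => m; exact: E.
Qed.

End null_lagrangian.

Section cofactor_expansion.
Context {R : realType}.

Lemma dot_cof2 (A H : 'M[R]_2) :
  let p a b := A (inord a) (inord b) in let h a b := H (inord a) (inord b) in
  dot (cof A) H = p 1 1 * h 0 0 - p 1 0 * h 0 1 + (p 0 0 * h 1 1 - p 0 1 * h 1 0).
Proof.
have [f ->] := matrix_natE A; have [g ->] := matrix_natE H.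
rewrite /dot /cof !big_ord_recl !big_ord0 /= !mxE /cofactor !det_mx11 !mxE !inordK//=.
by rewrite /bump /= ?expr0 ?expr1 ?expr2; ring.
Qed.

Lemma dot_cof3 (A H : 'M[R]_3) :
  let p a b := A (inord a) (inord b) in let h a b := H (inord a) (inord b) in
  dot (cof A) H =
    (p 1 1 * p 2 2 - p 1 2 * p 2 1) * h 0 0 + (p 1 2 * p 2 0 - p 1 0 * p 2 2) * h 0 1
    + (p 1 0 * p 2 1 - p 1 1 * p 2 0) * h 0 2
  + ((p 0 2 * p 2 1 - p 0 1 * p 2 2) * h 1 0 + (p 0 0 * p 2 2 - p 0 2 * p 2 0) * h 1 1
    + (p 0 1 * p 2 0 - p 0 0 * p 2 1) * h 1 2)
  + ((p 0 1 * p 1 2 - p 0 2 * p 1 1) * h 2 0 + (p 0 2 * p 1 0 - p 0 0 * p 1 2) * h 2 1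
    + (p 0 0 * p 1 1 - p 0 1 * p 1 0) * h 2 2).
Proof.
have [f ->] := matrix_natE A; have [g ->] := matrix_natE H.
have E (i j : 'I_3) : \det (row' i (col' j (\matrix_(i < 3, j < 3) f i j))) =
    f (bump i 0) (bump j 0) * f (bump i 1) (bump j 1) -
    f (bump i 0) (bump j 1) * f (bump i 1) (bump j 0).
  rewrite -(det_mx_nat2 (fun a b => f (bump i a) (bump j b))); congr (\det _).
  by apply/matrixP => a b; rewrite !mxE.
rewrite /dot /cof !big_ord_recl !big_ord0 /= !mxE /cofactor !E ?mxE !inordK//=.
rewrite /bump /= !addr0 ?addn0 ?addn1 ?addn2 /= !exprS !expr0 /=; ring.
Qed.

End cofactor_expansion.

(** * Piola's identity for C^1 maps equal to the identity on the boundary *)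

Section piola.
Context {R : realType} {n : nat} (Omega : set 'rV[R]_n) (Z : 'rV[R]_n -> 'rV[R]_n).
Local Notation e j := (delta_mx ord0 j).
Local Notation mu := (@lebesgue R n).
Local Notation U i := (fun x => component Z i x - x ord0 i).
Context (C : R).
Hypotheses (n23 : n = 2%N \/ n = 3%N) (oO : open Omega) (bO : bounded_set Omega)
  (CZ : forall i, C1_on Omega (component Z i))
  (Uc : forall i, {within closure Omega, continuous (U i)})
  (Z_id : forall x, boundary Omega x -> Z x = x)
  (UB : forall i x, Omega x -> `|U i x| <= C)
  (dUB : forall i j x, Omega x -> `|partial j (U i) x| <= C).

Lemma partial_displacement i j x : Omega x -> derivable (U i) x (e j) /\
  partial j (component Z i) x = (i == j)%:R + partial j (U i) x.
Proof.
move=> Ox; have [_ dZ _] := CZ i; have [c1 c2] := partial_coord i j x.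
have [H1 H2] := partialB (dZ j x Ox) c1.
by split => //; rewrite H2 c2 addrCA subrr addr0.
Qed.

Lemma continuous_partial_displacement i j x : Omega x ->
  {for x, continuous (partial j (U i))}.
Proof.
move=> Ox; have [_ _ cdZ] := CZ i.
apply: (near_eq_continuous_at (g := fun y => partial j (component Z i) y - (i == j)%:R)).
  apply: filterS (open_nbhs_nbhs (conj oO Ox)) => y Oy.
  by rewrite (partial_displacement i j Oy).2 addrAC subrr add0r.
apply: (@continuousB _ _ _ (partial j (component Z i)) (fun=> (i == j)%:R)).
  exact: cdZ.
exact: cst_continuous.
Qed.

Let row_triple i1 i2 phi i j k : test Omega phi ->
  mu.-integrable Omega (EFin \o (fun x =>
    partial k (component Z i1) x * minor (component Z i2) phi i j x
    + partial i (component Z i1) x * minor (component Z i2) phi j k x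
    + partial j (component Z i1) x * minor (component Z i2) phi k i x)) /\
  \int[mu]_(x in Omega) (partial k (component Z i1) x * minor (component Z i2) phi i j x
    + partial i (component Z i1) x * minor (component Z i2) phi j k x
    + partial j (component Z i1) x * minor (component Z i2) phi k i x) = 0.
Proof.
move=> tphi; have mO := open_rV_measurable oO.
have u0 x : boundary Omega x -> component Z i1 x - x ord0 i1 = 0.
  by move=> /Z_id Zx; rewrite /component Zx subrr.
have ud l x (Ox : Omega x) := (partial_displacement i1 l Ox).1.
(* The component [i1] of Z is the coordinate x_i1 plus a function vanishing on the boundary, so c is
   the unit vector of index [i1]. *)
have H := @integral_triple _ _ Omega oO bO _ C (@Uc i1) u0 ud
  (@continuous_partial_displacement i1) (UB i1) (dUB i1) _ _ (fun l => (i1 == l)%:R)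
  i j k (CZ i2) tphi.
have iT l l1 l2 : mu.-integrable Omega (EFin \o
    (fun x => partial l (component Z i1) x * minor (component Z i2) phi l1 l2 x)).
  rewrite (_ : (fun x => _) =
      (fun x => minor (component Z i2) phi l1 l2 x * partial l (component Z i1) x)).
    apply: (@integrable_bounded_mul _ _ _ _ _ mO _ _ (1 + C)).
    - exact: integrable_minor.
    - by apply: measurable_fun_continuous_on => // x Ox; have [_ _ +] := CZ i1; apply.
    - move=> x Ox; rewrite (partial_displacement i1 l Ox).2.
      rewrite (le_trans (ler_normD _ _))// lerD ?dUB//.
      by case: (i1 == l); rewrite ?normr1 ?normr0.
  by apply/funext => x; rewrite mulrC.
have E l l1 l2 : \int[mu]_(x in Omega)
     (((i1 == l)%:R + partial l (U i1) x) * minor (component Z i2) phi l1 l2 x)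
   = \int[mu]_(x in Omega) (partial l (component Z i1) x * minor (component Z i2) phi l1 l2 x).
  by apply: eq_Rintegral => x; rewrite inE => Ox; rewrite (partial_displacement i1 l Ox).2.
have i12 := integrableD_EFin mO (iT k i j) (iT i j k).
split; first exact: (integrableD_EFin mO i12 (iT j k i)).
apply: (etrans (RintegralD mO i12 (iT j k i))).
apply: (etrans (congr1 (+%R^~ _) (RintegralD mO (iT k i j) (iT i j k)))).
exact: (etrans (esym (congr2 +%R (congr2 +%R (E k i j) (E i j k)) (E j k i))) H).
Qed.

(** cof DZ : Dphi is the sum over i of the determinant of DZ with row i replaced by grad phi_i. Each
    summand has integral 0: it is a [minor] for n = 2, and a triple with the rows in cyclic order
    for n = 3. *)
Lemma piola phi : test_field Omega phi ->
  mu.-integrable Omega (EFin \o (fun x => dot (cof (Dmx Z x)) (Dmx phi x))) /\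
  \int[mu]_(x in Omega) dot (cof (Dmx Z x)) (Dmx phi x) = 0.
Proof.
move=> tphi; have mO := open_rV_measurable oO.
have row3 (i : 'I_n) i1 i2 a b c := @row_triple i1 i2 _ a b c (tphi i).
have min2 (i : 'I_n) i1 a b := integrable_minor oO a b (CZ i1) (tphi i).
have imin2 (i : 'I_n) i1 a b := integral_minor oO a b (CZ i1) (tphi i).
case: n23 => ?; subst n.
- pose o a : 'I_2 := inord a.
  have -> : (fun x => dot (cof (Dmx Z x)) (Dmx phi x)) =
     (fun x => minor (component Z (o 1)) (component phi (o 0)) (o 1) (o 0) x +
       minor (component Z (o 0)) (component phi (o 1)) (o 0) (o 1) x).
    by apply/funext => x; rewrite dot_cof2 !mxE.
  have i1 := min2 (o 0) (o 1) (o 1) (o 0); have i2 := min2 (o 1) (o 0) (o 0) (o 1).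
  split; first exact: (integrableD_EFin mO i1 i2).
  by apply: (etrans (RintegralD mO i1 i2)); rewrite !imin2 addr0.
- pose o a : 'I_3 := inord a.
  pose T (i : 'I_3) i1 i2 x :=
    partial (o 2) (component Z i1) x * minor (component Z i2) (component phi i) (o 0) (o 1) x
    + partial (o 0) (component Z i1) x * minor (component Z i2) (component phi i) (o 1) (o 2) x
    + partial (o 1) (component Z i1) x * minor (component Z i2) (component phi i) (o 2) (o 0) x.
  have -> : (fun x => dot (cof (Dmx Z x)) (Dmx phi x)) =
     (fun x => T (o 0) (o 1) (o 2) x + T (o 1) (o 2) (o 0) x + T (o 2) (o 0) (o 1) x).
    apply/funext => x; rewrite dot_cof3 /T /minor !mxE -/(o 0) -/(o 1) -/(o 2).
    pose p a b := partial (o b) (component Z (o a)) x.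
    pose h a b := partial (o b) (component phi (o a)) x.
    rewrite -!/(p _ _) -!/(h _ _).
    move: (p 0 0) (p 0 1) (p 0 2) (p 1 0) (p 1 1) (p 1 2) (p 2 0) (p 2 1) (p 2 2).
    move: (h 0 0) (h 0 1) (h 0 2) (h 1 0) (h 1 1) (h 1 2) (h 2 0) (h 2 1) (h 2 2).
    by move=> *; ring.
  have [iT IT] : (forall i i1 i2, (lebesgue 3).-integrable Omega (EFin \o T i i1 i2)) /\
      forall i i1 i2, \int[lebesgue 3]_(x in Omega) T i i1 i2 x = 0.
    by split => i i1 i2; have [] := row3 i i1 i2 (o 0) (o 1) (o 2).
  have i12 := integrableD_EFin mO (iT (o 0) (o 1) (o 2)) (iT (o 1) (o 2) (o 0)).
  split; first exact: (integrableD_EFin mO i12 (iT (o 2) (o 0) (o 1))).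
  apply: (etrans (RintegralD mO i12 (iT (o 2) (o 0) (o 1)))).
  rewrite IT addr0.
  apply: (etrans (RintegralD mO (iT (o 0) (o 1) (o 2)) (iT (o 1) (o 2) (o 0)))).
  by rewrite !IT addr0.
Qed.

End piola.

(** * Density of test fields *)

Section almost_everywhere_equal.
Context {R : realType} {d : nat} (Omega : set 'rV[R]_d) (oO : open Omega).
Local Notation mu := (@lebesgue R d).

Lemma ae_eq_Rintegral (f g : 'rV[R]_d -> R) : measurable_fun Omega f ->
  measurable_fun Omega g -> ae_on Omega (fun x => f x = g x) ->
  \int[mu]_(x in Omega) f x = \int[mu]_(x in Omega) g x.
Proof.
move=> mf mg fg; congr fine; apply: ae_eq_integral.
- exact: open_rV_measurable.
- exact/measurable_EFinP.
- exact/measurable_EFinP.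
- by apply: (ae_onW _ fg) => x Ox /= ->.
Qed.

Lemma Lnorm_mx_ae_eq m n (p : nat) (F G : 'rV[R]_d -> 'M[R]_(m, n)) : (0 < p)%N ->
  (forall i j, measurable_fun Omega (fun x => F x i j)) ->
  (forall i j, measurable_fun Omega (fun x => G x i j)) ->
  ae_on Omega (fun x => F x = G x) ->
  Lnorm_mx Omega p%:R%:E F = Lnorm_mx Omega p%:R%:E G.
Proof.
move=> p0 mF mG FG; have mO := open_rV_measurable oO.
rewrite /Lnorm_mx !Lnorm_onE//; congr poweR; apply: ae_eq_integral => //.
- apply/measurable_EFinP; apply: measurable_funX; apply: measurableT_comp => //.
  exact: measurable_frob.
- apply/measurable_EFinP; apply: measurable_funX; apply: measurableT_comp => //.
  exact: measurable_frob.
- by apply: (ae_onW _ FG) => x Ox /= ->.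
Qed.

Lemma weak_gradient_measurable Z G : weak_gradient Omega Z G ->
  forall i j, measurable_fun Omega (fun x => G x i j).
Proof. by move=> [_ LG _] i j; have [] := LG i j. Qed.

Lemma W1p_wD (p : nat) Z : (0 < p)%N -> W1p Omega p%:R%:E Z ->
  weak_gradient Omega Z (wD Omega Z) /\ Lp_mx Omega p%:R%:E (wD Omega Z).
Proof.
move=> p0 [_ [G ZG [mG LG]]]; have [ZD DG] := weak_gradient_wD oO ZG.
split => //; split; first exact: weak_gradient_measurable ZD.
by rewrite (Lnorm_mx_ae_eq p0 _ _ DG)//; exact: weak_gradient_measurable ZD.
Qed.

End almost_everywhere_equal.

Lemma measurable_Dmx_test {R : realType} {d : nat} (Omega : set 'rV[R]_d) phi i j :
  open Omega -> test_field Omega phi ->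
  measurable_fun Omega (fun x => phi x ord0 i) /\
  measurable_fun Omega (fun x => Dmx phi x i j).
Proof.
move=> oO tphi; split.
  apply: measurable_fun_continuous_rV; first exact: open_rV_measurable.
  exact: test_continuous (tphi i).
under eq_fun do rewrite mxE.
apply: measurable_fun_continuous_rV; first exact: open_rV_measurable.
exact: test_continuous (test_partial j (tphi i)).
Qed.

Section density.
Context {R : realType} {d : nat} (Omega : set 'rV[R]_d).
Local Notation mu := (@lebesgue R d).
Hypotheses (oO : open Omega) (bO : bounded_set Omega).
Let mO := open_rV_measurable oO.
Let Ooo : (mu Omega < +oo)%E. Proof. exact: lebesgue_bounded_ltoo. Qed.

Definition L2_mx m n (F : 'rV[R]_d -> 'M[R]_(m, n)) :=
  forall i j, L2 mu Omega (fun x => F x i j).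

Lemma L2_mxB m n (F G : 'rV[R]_d -> 'M[R]_(m, n)) : L2_mx F -> L2_mx G ->
  L2_mx (fun x => F x - G x).
Proof.
move=> LF LG i j; have := L2B mO (LF i j) (LG i j); congr L2.
by apply/funext => x; rewrite !mxE.
Qed.

Lemma L2_mx_dot_integrable m n (F G : 'rV[R]_d -> 'M[R]_(m, n)) : L2_mx F -> L2_mx G ->
  mu.-integrable Omega (EFin \o (fun x => dot (F x) (G x))).
Proof.
move=> LF LG; rewrite /dot.
do 2!apply: integrable_sum_EFin => // ?; exact: L2_mul_integrable.
Qed.

Lemma L2_mx_cvg_dot m n (F : 'rV[R]_d -> 'M[R]_(m, n)) G : L2_mx F ->
  (forall k, L2_mx (G k)) ->
  (forall i j, \int[mu]_(x in Omega) (G k x i j ^+ 2) @[k --> \oo] --> (0 : R)) ->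
  \int[mu]_(x in Omega) dot (F x) (G k x) @[k --> \oo] --> (0 : R).
Proof.
move=> LF LG G0.
have E k : \int[mu]_(x in Omega) dot (F x) (G k x) =
    \sum_(i < m) \sum_(j < n) \int[mu]_(x in Omega) (F x i j * G k x i j).
  rewrite /dot Rintegral_sum//; last first.
    move=> i; apply: integrable_sum_EFin => // j.
    exact: (L2_mul_integrable mO (LF i j) (LG k i j)).
  apply: eq_bigr => i _; rewrite Rintegral_sum// => j.
  exact: (L2_mul_integrable mO (LF i j) (LG k i j)).
under eq_fun do rewrite E.
have H0 : \sum_(i < m) \sum_(j < n) (0 : R) = 0 by rewrite big1// => i _; rewrite big1.
have H : \sum_(i < m) \sum_(j < n) \int[mu]_(x in Omega) (F x i j * G k x i j) @[k --> \oo] -->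
    \sum_(i < m) \sum_(j < n) (0 : R).
  apply: cvg_sum_seq => i; apply: cvg_sum_seq => j.
  exact: (L2_cvg_mul mO (LF i j) (fun k => LG k i j)).
by rewrite H0 in H.
Qed.

Lemma test_field_L2 phi : test_field Omega phi -> L2_mx phi /\ L2_mx (Dmx phi).
Proof.
have L2t f : test Omega f -> L2 mu Omega f.
  move=> tf; have [C fC] := bounded_support_bounded
    (supported_in_bounded (test_supported tf)) (test_continuous tf).
  apply: (L2_bounded mO Ooo (C := C)) => //.
  by apply: measurable_fun_continuous_rV => //; exact: test_continuous tf.
move=> tphi; split=> i j.
  by rewrite (ord1 i); exact: L2t (tphi j).
by under eq_fun do rewrite mxE; exact: L2t (test_partial j (tphi i)).
Qed.

(* Test fields are dense in W1p0 and the L2 norm is controlled by the Lp norm. *)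
Lemma W1p0_annihilator (p : nat) (f : 'rV[R]_d -> 'rV[R]_d) (g : 'rV[R]_d -> 'M[R]_d) V :
  (2 <= p)%N -> L2_mx f -> L2_mx g ->
  (forall phi, test_field Omega phi ->
    \int[mu]_(x in Omega) (dot (f x) (phi x) + dot (g x) (Dmx phi x)) = 0) ->
  W1p0 Omega p%:R%:E V ->
  \int[mu]_(x in Omega) (dot (f x) (V x) + dot (g x) (wD Omega V x)) = 0.
Proof.
move=> p2 Lf Lg fg0 [WV [phi tphi [c1 c2]]].
have p0 : (0 < p)%N by apply: leq_trans p2.
have [_ LDV] := W1p_wD oO p0 WV.
have L2V : L2_mx V by exact: Lp_mx_L2 p2 WV.1.
have L2D : L2_mx (wD Omega V) by exact: Lp_mx_L2 p2 LDV.
have L2p k := (test_field_L2 (tphi k)).1.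
have L2Dp k := (test_field_L2 (tphi k)).2.
have L21 k := L2_mxB (L2p k) L2V.
have L22 k := L2_mxB (L2Dp k) L2D.
have e1 := L2_mx_cvg_dot Lf L21 (Lnorm_mx_cvg_L2 mO Ooo p2 L21 c1).
have e2 := L2_mx_cvg_dot Lg L22 (Lnorm_mx_cvg_L2 mO Ooo p2 L22 c2).
pose I := \int[mu]_(x in Omega) (dot (f x) (V x) + dot (g x) (wD Omega V x)).
have i1 := integrableD_EFin mO (L2_mx_dot_integrable Lf L2V) (L2_mx_dot_integrable Lg L2D).
(* The pairing with phi_k is 0, so the pairing with phi_k - V is the constant - I; since it also
   tends to 0, I = 0. *)
have E k : \int[mu]_(x in Omega) dot (f x) (phi k x - V x) +
    \int[mu]_(x in Omega) dot (g x) (Dmx (phi k) x - wD Omega V x) = - I.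
  have i2 := integrableD_EFin mO (L2_mx_dot_integrable Lf (L2p k))
    (L2_mx_dot_integrable Lg (L2Dp k)).
  apply: (etrans (esym (RintegralD mO (L2_mx_dot_integrable Lf (L21 k))
    (L2_mx_dot_integrable Lg (L22 k))))).
  transitivity (\int[mu]_(x in Omega) ((dot (f x) (phi k x) + dot (g x) (Dmx (phi k) x))
     - (dot (f x) (V x) + dot (g x) (wD Omega V x)))).
    by apply: eq_Rintegral => x _; rewrite !dotBr opprD addrACA.
  by apply: (etrans (RintegralB mO i2 i1)); rewrite fg0// sub0r.
have H : \int[mu]_(x in Omega) dot (f x) (phi k x - V x) +
    \int[mu]_(x in Omega) dot (g x) (Dmx (phi k) x - wD Omega V x) @[k --> \oo] --> (0 : R).
  by rewrite -[X in _ --> X]addr0; exact: cvgD.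
apply/eqP; rewrite -oppr_eq0 -/I; apply/eqP.
apply: (cvg_unique (@norm_hausdorff _ _) _ H).
rewrite (_ : (fun k => _) = fun=> - I); first exact: cvg_cst.
by apply/funext => k; exact: E.
Qed.

End density.

Lemma mxBE (V : zmodType) m n (A B : 'M[V]_(m, n)) i j : (A - B) i j = A i j - B i j.
Proof. by rewrite !mxE. Qed.

Lemma finite_bounded (T : Type) (R : realType) (D : set T) (I : finType) (f : I -> T -> R) :
  (forall i, exists C, forall x, D x -> `|f i x| <= C) ->
  exists2 C, 0 <= C & forall i x, D x -> `|f i x| <= C.
Proof.
move=> H; exists (\sum_i `|sval (cid (H i))|); first by apply: sumr_ge0.
move=> i x Dx; rewrite (le_trans (svalP (cid (H i)) x Dx))//.
by rewrite (le_trans (ler_norm _))// (bigD1 i)//= lerDl sumr_ge0.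
Qed.

(** * Sobolev regularity and zero trace of the displacement [Zs - id] *)

Section displacement.
Context {R : realType} {d : nat} (Omega : set 'rV[R]_d).
Local Notation mu := (@lebesgue R d).
Local Notation e j := (delta_mx ord0 j).
Hypotheses (oO : open Omega) (bO : bounded_set Omega).
Let mO := open_rV_measurable oO.
Let Ooo : (mu Omega < +oo)%E. Proof. exact: lebesgue_bounded_ltoo. Qed.

Lemma within_closure_bounded (f : 'rV[R]_d -> R) : {within closure Omega, continuous f} ->
  exists C, forall x, Omega x -> `|f x| <= C.
Proof.
move=> cf; have := compact_bounded (continuous_compact cf (compact_closure_bounded bO)).
move=> [M [_ HM]]; exists (`|M| + 1) => x Ox; apply: (HM (`|M| + 1)).
  by rewrite (le_lt_trans (ler_norm _)) ?ltrDl.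
by exists x => //; exact: subset_closure.
Qed.

Lemma within_closure_mx m n (F : 'rV[R]_d -> 'M[R]_(m, n)) i j :
  {within closure Omega, continuous F} -> {within closure Omega, continuous (fun x => F x i j)}.
Proof.
rewrite !subspace_continuousP => cF x Ax.
apply: (@cvg_comp _ _ _ _ (fun A : 'M[R]_(m, n) => A i j) _ _ _ (cF x Ax)).
exact: coord_continuous.
Qed.

Context (Zs : 'rV[R]_d -> 'rV[R]_d) (Zs_C1 : C1_closure Omega Zs)
  (Zs_id : forall x, boundary Omega x -> Zs x = x).
Local Notation U i := (fun x => component Zs i x - x ord0 i).

Lemma displacement_continuous i : {within closure Omega, continuous (U i)}.
Proof.
have [cZ _ _] := Zs_C1; have := @within_closure_mx _ _ _ ord0 i cZ.
rewrite !subspace_continuousP => c x Ax.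
apply: (@cvgB _ _ _ _ _ (component Zs i) (fun x : 'rV[R]_d => x ord0 i)); first exact: c.
apply: cvg_within_filter; exact: coord_continuous.
Qed.

Lemma C1_closure_C1_on i : C1_on Omega (component Zs i).
Proof.
have [cZ dZ [G cG ZG]] := Zs_C1; split.
- move=> x Ox; apply: (within_closure_continuous oO) => //; exact: within_closure_mx cZ.
- move=> j x Ox; have /derivable_mxP := diff_derivable (v := e j) (dZ x Ox).
  by apply.
- move=> j x Ox; apply: (near_eq_continuous_at (g := fun x => G x i j)).
    apply: filterS (open_nbhs_nbhs (conj oO Ox)) => y Oy.
    by rewrite -(ZG y Oy) mxE.
  apply: (within_closure_continuous oO) => //; exact: within_closure_mx cG.
Qed.

Lemma displacement_bounded : exists C, [/\ 0 <= C,
  forall i x, Omega x -> `|U i x| <= C,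
  forall i j x, Omega x -> `|partial j (U i) x| <= C,
  forall i x, Omega x -> `|Zs x ord0 i| <= C &
  forall i j x, Omega x -> `|Dmx Zs x i j| <= C].
Proof.
have [cZ dZ [G cG ZG]] := Zs_C1.
have [C1 C10 H1] := finite_bounded (fun i => within_closure_bounded (@displacement_continuous i)).
have [C2 C20 H2] := finite_bounded
  (fun i => within_closure_bounded (@within_closure_mx _ _ _ ord0 i cZ)).
have [C3 C30 H3] := finite_bounded
  (fun k : 'I_d * 'I_d => within_closure_bounded (@within_closure_mx _ _ _ k.1 k.2 cG)).
have ZC i j x : Omega x -> `|Dmx Zs x i j| <= C3.
  by move=> Ox; rewrite ZG//; exact: (H3 (i, j)).
(* The three bounds are for the displacement, for [Zs] and for its gradient; the 1 absorbs the
   Kronecker symbol in the gradient of the displacement. *)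
exists (C1 + C2 + C3 + 1); split.
- by rewrite !addr_ge0.
- by move=> i x Ox; apply: le_trans (H1 i x Ox) _; lra.
- move=> i j x Ox; have := (partial_displacement C1_closure_C1_on i j Ox).2.
  have := ZC i j x Ox; rewrite mxE => + E; rewrite E => ZE.
  rewrite -[partial j _ x](addKr (i == j)%:R) (le_trans (ler_normD _ _))// normrN.
  have : `|(i == j)%:R : R| <= 1 by case: eqP; rewrite ?normr1 ?normr0.
  by move: ZE; move: (`|_|) (`|_|) => p q; lra.
- by move=> i x Ox; apply: le_trans (H2 i x Ox) _; lra.
- by move=> i j x Ox; apply: le_trans (ZC i j x Ox) _; lra.
Qed.

Lemma displacement_approximation : exists (C : R) (phi : nat -> 'rV[R]_d -> 'rV[R]_d),
  [/\ forall k, test_field Omega (phi k),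
   forall k i x, Omega x -> `|phi k x ord0 i - U i x| <= C,
   forall k i j x, Omega x -> `|Dmx (phi k) x i j - partial j (U i) x| <= C,
   forall i x, Omega x -> phi k x ord0 i - U i x @[k --> \oo] --> (0 : R)
  & forall i j, ae_on Omega
      (fun x => Dmx (phi k) x i j - partial j (U i) x @[k --> \oo] --> (0 : R))].
Proof.
have [C [C0 UC dUC _ _]] := displacement_bounded.
have u0 i x : boundary Omega x -> U i x = 0.
  by move=> /Zs_id Zx; rewrite /component Zx subrr.
have ud i l x (Ox : Omega x) := (partial_displacement C1_closure_C1_on i l Ox).1.
have udc i := @continuous_partial_displacement _ _ _ _ oO C1_closure_C1_on i.
have H i := vanishing_boundary_approximation oO bO (@displacement_continuous i) (u0 i)
  (ud i) (udc i) (UC i) (dUC i).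
pose phi k x := \row_i sval (cid (H i)) k x.
have phiE k i : component (phi k) i = sval (cid (H i)) k.
  by apply/funext => x; rewrite /component mxE.
have phiP i := svalP (cid (H i)).
have DphiE k i j x : Dmx (phi k) x i j = partial j (sval (cid (H i)) k) x.
  by rewrite mxE phiE.
(* The bound 9 C + 1 of the approximating gradients plus C for the limit; it covers the values as
   well. *)
exists (10 * C + 1), phi; split.
- by move=> k i; rewrite phiE; have [] := phiP i.
- move=> k i x Ox; have [_ P _ _ _] := phiP i; rewrite mxE.
  rewrite (le_trans (ler_normB _ _))//.
  have := P k x Ox; have := UC i x Ox; move: (`|_|) (`|_|) => p q; lra.
- move=> k i j x Ox; have [_ _ P _ _] := phiP i; rewrite DphiE.
  rewrite (le_trans (ler_normB _ _))//.
  have := P k j x Ox; have := dUC i j x Ox; move: (`|_|) (`|_|) => p q; lra.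
- move=> i x Ox; have [_ _ _ P _] := phiP i; rewrite -(subrr (U i x)).
  apply: cvgB; last exact: cvg_cst.
  by under eq_fun do rewrite mxE; exact: P.
- move=> i j; have [_ _ _ _ P] := phiP i; apply: ae_onW (P j) => x Ox Px.
  rewrite -(subrr (partial j (U i) x)).
  apply: cvgB; last exact: cvg_cst.
  by under eq_fun do rewrite DphiE.
Qed.

Lemma weak_gradient_id : weak_gradient Omega (fun x => x) (fun=> 1%:M).
Proof.
have H : weak_gradient Omega (fun x => x) (Dmx (fun x => x)).
  apply: classical_weak_gradient => //.
  - by move=> i x _; exact: coord_continuous.
  - by move=> i j x _; exact: (partial_coord i j x).1.
  - move=> i j x _; rewrite (_ : partial j _ = fun=> (i == j)%:R); first exact: cst_continuous.
    by apply/funext => y; exact: (partial_coord i j y).2.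
congr weak_gradient: H; apply/funext => x; apply/matrixP => i j; rewrite !mxE.
exact: (partial_coord i j x).2.
Qed.

(** Zero trace means lying in the closure of the test fields. The approximations converge boundedly
    a.e. with their gradients, so dominated convergence on the bounded set Omega gives W^{1,d}
    convergence. *)
Lemma W1d_id_of_C1 : (0 < d)%N -> weak_gradient Omega Zs (Dmx Zs) /\ W1d_id Omega Zs.
Proof.
move=> d0.
have [C [C0 UC dUC ZC DZC]] := displacement_bounded.
have [C' [phi [tphi phiC dphiC cphi cdphi]]] := displacement_approximation.
have ZD : weak_gradient Omega Zs (Dmx Zs).
  apply: classical_weak_gradient => //.
  - by move=> i; have [] := C1_closure_C1_on i.
  - by move=> i; have [_] := C1_closure_C1_on i.
  - by move=> i; have [_ _] := C1_closure_C1_on i.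
have mZ i j : measurable_fun Omega (fun x => Zs x i j).
  rewrite (ord1 i).
  by apply: measurable_fun_continuous_on => // x; have [+ _ _] := C1_closure_C1_on j; apply.
have mD := weak_gradient_measurable ZD.
have ZW : W1p Omega d%:R%:E Zs.
  split; last exists (Dmx Zs) => //.
  - apply: (bounded_Lp_mx mO Ooo (C := C)) => // i j x; rewrite (ord1 i); exact: ZC.
  - exact: (bounded_Lp_mx mO Ooo (C := C)).
split => //; split => //.
have ZDi := weak_gradientB oO ZD weak_gradient_id.
have UE x i : (Zs x - x) ord0 i = U i x by rewrite !mxE.
have DE x i j : Omega x -> (Dmx Zs x - 1%:M) i j = partial j (U i) x.
  move=> Ox; rewrite !mxE (partial_displacement C1_closure_C1_on i j Ox).2.
  by rewrite addrAC subrr add0r.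
have mZi i j : measurable_fun Omega (fun x => (Zs x - x) i j).
  under eq_fun do rewrite mxBE; apply: measurable_funB => //.
  rewrite (ord1 i); exact: measurable_funTS (measurable_rV_coord _).
have mDi i j : measurable_fun Omega (fun x => (Dmx Zs x - 1%:M) i j).
  by under eq_fun do rewrite mxBE; apply: measurable_funB.
have ZWi : W1p Omega d%:R%:E (fun x => Zs x - x).
  split; last exists (fun x => Dmx Zs x - 1%:M) => //.
  - apply: (bounded_Lp_mx mO Ooo (C := C)) => // i j x Ox.
    by rewrite (ord1 i) UE; exact: UC.
  - apply: (bounded_Lp_mx mO Ooo (C := C)) => // i j x Ox.
    by rewrite DE//; exact: dUC.
split => //; exists phi => //; split.
- apply: (bounded_cvg_Lnorm_mx mO Ooo (C := C')) => //.
  + move=> k i j; under eq_fun do rewrite mxBE.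
    apply: measurable_funB; last exact: mZi.
    by rewrite (ord1 i); exact: (measurable_Dmx_test j j oO (tphi k)).1.
  + by move=> k i j x Ox; rewrite (ord1 i) mxBE UE; exact: phiC.
  + move=> i j; apply: aeW => x Ox; rewrite (ord1 i).
    rewrite (_ : (fun k => _) = (fun k => phi k x ord0 j - U j x)); first exact: cphi.
    by apply/funext => k; rewrite mxBE UE.
- have [WD WDE] := weak_gradient_wD oO ZDi.
  (* The definition of zero trace speaks of the chosen gradient [wD]; the norm does not see the null
     set where it differs from the classical one. *)
  have E k : Lnorm_mx Omega d%:R%:E (fun x => Dmx (phi k) x - wD Omega (fun x => Zs x - x) x) =
      Lnorm_mx Omega d%:R%:E (fun x => Dmx (phi k) x - (Dmx Zs x - 1%:M)).
    apply: Lnorm_mx_ae_eq => //.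
    + move=> i j; under eq_fun do rewrite mxBE.
      apply: measurable_funB; first exact: (measurable_Dmx_test i j oO (tphi k)).2.
      exact: (weak_gradient_measurable WD i j).
    + move=> i j; under eq_fun do rewrite mxBE.
      apply: measurable_funB; last exact: mDi.
      exact: (measurable_Dmx_test i j oO (tphi k)).2.
    + by apply: ae_onW WDE => x Ox ->.
  under eq_fun do rewrite E.
  apply: (bounded_cvg_Lnorm_mx mO Ooo (C := C')) => //.
  + move=> k i j; under eq_fun do rewrite mxBE.
    apply: measurable_funB; last exact: mDi.
    exact: (measurable_Dmx_test i j oO (tphi k)).2.
  + by move=> k i j x Ox; rewrite mxBE DE//; exact: dphiC.
  + move=> i j; apply: ae_onW (cdphi i j) => x Ox H.
    rewrite (_ : (fun k => _) = (fun k => Dmx (phi k) x i j - partial j (U i) x))//.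
    by apply/funext => k; rewrite mxBE DE.
Qed.

End displacement.

Lemma measurable_det {R : realType} {d : nat} (Omega : set 'rV[R]_d) n (F : 'rV[R]_d -> 'M[R]_n) :
  (forall i j, measurable_fun Omega (fun x => F x i j)) ->
  measurable_fun Omega (fun x => \det (F x)).
Proof.
move=> mF; rewrite /determinant; apply: measurable_sum => s.
by apply: measurable_funM => //; apply: measurable_prod => i _; exact: mF.
Qed.

(** * The Lagrangian as the integral of a real density *)

Section minimality.
Context {R : realType} {d : nat} (hd : d = 2%N \/ d = 3%N) (Omega : set 'rV[R]_d).
Local Notation mu := (@lebesgue R d).
Hypotheses (oO : open Omega) (bO : bounded_set Omega).
Let mO := open_rV_measurable oO.
Let Ooo : (mu Omega < +oo)%E. Proof. exact: lebesgue_bounded_ltoo. Qed.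
Let d2 : (2 <= d)%N. Proof. by case: hd => ->. Qed.
Let d0 : (0 < d)%N. Proof. exact: leq_trans d2. Qed.

Context (a : R) (S : 'rV[R]_d -> 'rV[R]_d) (S_H1 : W1p Omega 2%:E S).

(** The gradient is an argument, so that the classical gradient can be used for [Zs] and the weak
    one for competitors. *)
Definition density (q : 'rV[R]_d -> R) (Z : 'rV[R]_d -> 'rV[R]_d) (D : 'rV[R]_d -> 'M[R]_d) x : R :=
  1 / 2 * dot (Z x - S x) (Z x - S x)
  + a / 2 * dot (D x - wD Omega S x) (D x - wD Omega S x)
  + q x * (`|\det (D x)| - 1).

Lemma S_L2 : L2_mx Omega S /\ L2_mx Omega (wD Omega S).
Proof.
have [_ LD] := @W1p_wD _ _ _ oO 2 S isT S_H1.
by split; apply: (Lp_mx_L2 mO Ooo (p := 2)) => //; exact: S_H1.1.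
Qed.

(** The determinant is dominated by the d-th power of the Frobenius norm of D, which is where the
    exponent d of the Sobolev space enters. *)
Lemma det_integrable (q : 'rV[R]_d -> R) (M : R) (D : 'rV[R]_d -> 'M[R]_d) :
  measurable_fun Omega q ->
  (forall x, Omega x -> `|q x| <= M) -> Lp_mx Omega d%:R%:E D ->
  mu.-integrable Omega (EFin \o (fun x => q x * (`|\det (D x)| - 1))).
Proof.
move=> mq qM LD.
have i1 : mu.-integrable Omega (EFin \o (fun x => `|\det (D x)| - 1)).
  apply: integrableB_EFin => //; last first.
    have := (L2_cst mO 1 Ooo).2; congr integrable.
    by apply/funext => x /=; rewrite expr1n.
  have H := integrableZl_EFin mO (#|predT : pred {perm 'I_d}|%:R : R) (Lp_mx_pow d0 LD).
  apply: (@le_integrable_EFin _ _ _ _ _ mO _ _ _ H).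
    by apply: measurableT_comp => //; apply: measurable_det; case: LD.
  by move=> x Ox; rewrite normr_id; exact: normr_det_le.
have := integrable_bounded_mul mO i1 mq qM.
by congr integrable; apply/funext => x /=; rewrite mulrC.
Qed.

Lemma density_integrable (q : 'rV[R]_d -> R) (M : R) Z (D : 'rV[R]_d -> 'M[R]_d) :
  measurable_fun Omega q ->
  (forall x, Omega x -> `|q x| <= M) -> L2_mx Omega Z -> Lp_mx Omega d%:R%:E D ->
  mu.-integrable Omega (EFin \o density q Z D).
Proof.
move=> mq qM LZ LD; have [LS LDS] := S_L2.
have L2D : L2_mx Omega D by exact: Lp_mx_L2 d2 LD.
have L1 := L2_mxB oO LZ LS; have L2 := L2_mxB oO L2D LDS.
have i1 := integrableZl_EFin mO (1 / 2) (L2_mx_dot_integrable oO L1 L1).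
have i2 := integrableZl_EFin mO (a / 2) (L2_mx_dot_integrable oO L2 L2).
exact: (integrableD_EFin mO (integrableD_EFin mO i1 i2) (det_integrable mq qM LD)).
Qed.

(** [q'] is the given multiplier and q a version bounded at every point; likewise D is a convenient
    version of the weak gradient. *)
Lemma LagrangianE (q q' : 'rV[R]_d -> R) (M : R) Z (D : 'rV[R]_d -> 'M[R]_d) :
  measurable_fun Omega q' -> measurable_fun Omega q ->
  (forall x, Omega x -> `|q x| <= M) -> ae_on Omega (fun x => q' x = q x) ->
  L2_mx Omega Z -> Lp_mx Omega d%:R%:E D ->
  (forall i j, measurable_fun Omega (fun x => wD Omega Z x i j)) ->
  ae_on Omega (fun x => wD Omega Z x = D x) ->
  Lagrangian Omega a S Z q' = (\int[mu]_(x in Omega) density q Z D x)%:E.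
Proof.
move=> mq' mq qM qq LZ LD mW WD; have [LS LDS] := S_L2.
have mD := LD.1.
have L2D : L2_mx Omega D by exact: Lp_mx_L2 d2 LD.
have L1 := L2_mxB oO LZ LS; have L2 := L2_mxB oO L2D LDS.
have i1 := integrableZl_EFin mO (1 / 2) (L2_mx_dot_integrable oO L1 L1).
have i2 := integrableZl_EFin mO (a / 2) (L2_mx_dot_integrable oO L2 L2).
have i3 := det_integrable mq qM LD.
have E1 := (Lnorm_mx_sqr mO L1).2.
have E2 := (Lnorm_mx_sqr mO L2).2.
have E2' : Lnorm_mx Omega 2%:E (fun x => wD Omega Z x - wD Omega S x) =
    Lnorm_mx Omega 2%:E (fun x => D x - wD Omega S x).
  apply: (@Lnorm_mx_ae_eq _ _ _ oO _ _ 2) => //.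
  - move=> i j; under eq_fun do rewrite mxBE; apply: measurable_funB => //; exact: (LDS i j).1.
  - by move=> i j; exact: (L2 i j).1.
  - by apply: ae_onW WD => x Ox ->.
have E3 : (\int[mu]_(x in Omega) (q' x * (`|\det (wD Omega Z x)| - 1))%:E)%E =
    (\int[mu]_(x in Omega) (q x * (`|\det (D x)| - 1)))%:E.
  rewrite -RintegralE//; apply: ae_eq_integral => //.
  - apply/measurable_EFinP; apply: measurable_funM => //; apply: measurable_funB => //.
    by apply: measurableT_comp => //; exact: measurable_det.
  - by apply/measurable_EFinP; exact: integrable_measurable_fun i3.
  - apply: (ae_onW2 _ qq WD) => x Ox /= -> -> //.
rewrite /Lagrangian E1 E2' E2 E3 -!EFinM -!EFinD; congr EFin.
apply/esym; apply: (etrans (RintegralD mO (integrableD_EFin mO i1 i2) i3)).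
apply: (etrans (congr1 (+%R^~ _) (RintegralD mO i1 i2))).
by rewrite !RintegralZl//; apply: L2_mx_dot_integrable.
Qed.

End minimality.

(** * The energy inequality *)

Section energy.
Context {R : realType} {d : nat} (hd : d = 2%N \/ d = 3%N) (Omega : set 'rV[R]_d).
Local Notation mu := (@lebesgue R d).
Hypotheses (oO : open Omega) (bO : bounded_set Omega).
Let mO := open_rV_measurable oO.
Let Ooo : (mu Omega < +oo)%E. Proof. exact: lebesgue_bounded_ltoo. Qed.
Let d2 : (2 <= d)%N. Proof. by case: hd => ->. Qed.
Let d0 : (0 < d)%N. Proof. exact: leq_trans d2. Qed.

(** The set [W1d_id] is an affine space through the identity, so density is applied to Z - id, whose
    gradient is D - 1 almost everywhere. *)
Lemma W1p0_annihilator_affine f g (Z : 'rV[R]_d -> 'rV[R]_d) D :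
  L2_mx Omega f -> L2_mx Omega g ->
  (forall phi, test_field Omega phi ->
    \int[mu]_(x in Omega) (dot (f x) (phi x) + dot (g x) (Dmx phi x)) = 0) ->
  W1d_id Omega Z -> weak_gradient Omega Z D ->
  \int[mu]_(x in Omega) (dot (f x) (Z x - x) + dot (g x) (D x - 1%:M)) = 0.
Proof.
move=> Lf Lg fg0 [WZ W0] ZD.
have H := W1p0_annihilator oO bO d2 Lf Lg fg0 W0.
have ZDi := weak_gradientB oO ZD (weak_gradient_id oO).
have [WD WDE] := weak_gradient_wD oO ZDi.
have m1 : measurable_fun Omega (fun x => dot (f x) (Z x - x)).
  apply: measurable_dot => i j; first exact: (Lf i j).1.
  under eq_fun do rewrite mxBE; apply: measurable_funB; first exact: WZ.1.1.
  by rewrite (ord1 i); exact: measurable_funTS (measurable_rV_coord _).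
apply: (etrans _ H); apply: ae_eq_Rintegral => //.
- apply: measurable_funD => //; apply: measurable_dot => i j; first exact: (Lg i j).1.
  exact: (weak_gradient_measurable ZDi i j).
- apply: measurable_funD => //; apply: measurable_dot => i j; first exact: (Lg i j).1.
  exact: (weak_gradient_measurable WD i j).
- by apply: ae_onW WDE => x Ox ->.
Qed.

Context (a : R) (a0 : 0 < a) (S : 'rV[R]_d -> 'rV[R]_d) (S_H1 : W1p Omega 2%:E S).
Context (Zs : 'rV[R]_d -> 'rV[R]_d) (sigma : R) (sigma0 : 0 < sigma).
Hypotheses (Zs_C1 : C1_closure Omega Zs)
  (Zs_id : forall x, boundary Omega x -> Zs x = x)
  (Zs_det : forall x, Omega x -> \det (Dmx Zs x) = 1)
  (sigma_lb : forall x s, Omega x -> singular_value (Dmx Zs x) s -> sigma <= s).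
Local Notation M := (a * sigma ^+ 2 * (1 + 3 / 2 * (1 + Num.sqrt 3))^-1).
Context (q : 'rV[R]_d -> R).
Hypotheses (mq : measurable_fun Omega q) (q_bnd : forall x, Omega x -> 0 <= q x <= M).

Let Zs_facts := W1d_id_of_C1 oO bO Zs_C1 Zs_id d0.

Let DZs_Lp : Lp_mx Omega d%:R%:E (Dmx Zs).
Proof.
have [C [_ _ _ _ ZC]] := displacement_bounded oO bO Zs_C1.
apply: (bounded_Lp_mx mO Ooo (C := C)) => //.
exact: weak_gradient_measurable Zs_facts.1.
Qed.

Let q_norm x : Omega x -> `|q x| <= M.
Proof. by move=> Ox; have /andP[q0 qM] := q_bnd Ox; rewrite ger0_norm. Qed.

Let Zs_L2 : L2_mx Omega Zs.
Proof. exact: (Lp_mx_L2 mO Ooo d2 Zs_facts.2.1.1). Qed.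

Let f x := Zs x - S x.
Let g x := a *: (Dmx Zs x - wD Omega S x) + q x *: cof (Dmx Zs x).

Let f_L2 : L2_mx Omega f.
Proof. exact: (L2_mxB oO Zs_L2 (S_L2 oO bO S_H1).1). Qed.

Let cof_L2 : L2_mx Omega (fun x => q x *: cof (Dmx Zs x)).
Proof.
have [C [C0 _ _ _ ZC]] := displacement_bounded oO bO Zs_C1.
have mD := DZs_Lp.1.
move=> i j; under eq_fun do rewrite mxE mxE.
set minors := fun x => row' i (col' j (Dmx Zs x)).
have minorsE x k l : minors x k l = Dmx Zs x (lift i k) (lift j l) by rewrite !mxE.
(* A cofactor is up to sign a determinant of size d - 1 with entries bounded by C; its Frobenius
   norm is at most (d-1)^2 C. *)
set B := #|predT : pred {perm 'I_d.-1}|%:R * ((d.-1 * d.-1)%:R * C) ^+ d.-1.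
have cofC x : Omega x -> `|cofactor (Dmx Zs x) i j| <= B.
  move=> Ox; rewrite /cofactor normrM normrX normrN1 expr1n mul1r.
  apply: (le_trans (normr_det_le _)).
  rewrite ler_wpM2l// lerXn2r ?nnegrE ?frob_ge0 ?mulr_ge0//.
  by apply: frob_le => // k l; rewrite -/(minors x) minorsE; exact: ZC.
apply: (L2_bounded mO Ooo (C := M * B)).
  apply: measurable_funM => //; rewrite /cofactor; apply: measurable_funM => //.
  apply: (measurable_det (F := minors)) => k l; under eq_fun do rewrite minorsE.
  exact: mD.
by move=> x Ox; rewrite normrM ler_pM// ?q_norm ?cofC.
Qed.

Let g_L2 : L2_mx Omega g.
Proof.
have L1 := L2_mxB oO (Lp_mx_L2 mO Ooo d2 DZs_Lp) (S_L2 oO bO S_H1).2.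
move=> i j; have := L2D mO (L2Zl mO a (L1 i j)) (cof_L2 i j); congr L2.
by apply/funext => x; rewrite /g [RHS]mxE [in RHS]mxE.
Qed.

Lemma euler_lagrange_L2 : L2_mx Omega f /\ L2_mx Omega g.
Proof. by []. Qed.

Hypothesis EL : forall phi, test_field Omega phi ->
  \int[mu]_(x in Omega) (dot (Zs x - S x) (phi x) +
    dot (a *: (Dmx Zs x - wD Omega S x) + q x *: cof (Dmx Zs x)) (Dmx phi x)) = 0.

(** The quadratic term in Z - Zs is kept on the smaller side because it yields uniqueness. *)
Lemma density_lb Z : W1d_id Omega Z ->
  \int[mu]_(x in Omega) density Omega a S q Zs (Dmx Zs) x +
  1 / 2 * \int[mu]_(x in Omega) dot (Z x - Zs x) (Z x - Zs x) <=
  \int[mu]_(x in Omega) density Omega a S q Z (wD Omega Z) x.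
Proof.
move=> WZ; have [ZD LD] := W1p_wD oO d0 WZ.1.
have LZ : L2_mx Omega Z by exact: (Lp_mx_L2 mO Ooo d2 WZ.1.1).
have L2D : L2_mx Omega (wD Omega Z) by exact: (Lp_mx_L2 mO Ooo d2 LD).
have DZ2 : L2_mx Omega (Dmx Zs) by exact: (Lp_mx_L2 mO Ooo d2 DZs_Lp).
have LW := L2_mxB oO LZ Zs_L2; have LH := L2_mxB oO L2D DZ2.
have i1 := density_integrable hd oO bO a S_H1 mq q_norm Zs_L2 DZs_Lp.
have i2 := density_integrable hd oO bO a S_H1 mq q_norm LZ LD.
have i3 := integrableZl_EFin mO (1 / 2) (L2_mx_dot_integrable oO LW LW).
have i4 := integrableD_EFin mO (L2_mx_dot_integrable oO f_L2 LW) (L2_mx_dot_integrable oO g_L2 LH).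
(* Z - Zs is the difference of Z - id and Zs - id, and the first variation vanishes on both. *)
have l0 : \int[mu]_(x in Omega) (dot (f x) (Z x - Zs x) + dot (g x) (wD Omega Z x - Dmx Zs x)) = 0.
  have H1 := W1p0_annihilator_affine f_L2 g_L2 EL WZ ZD.
  have H2 := W1p0_annihilator_affine f_L2 g_L2 EL Zs_facts.2 Zs_facts.1.
  have L1 : L2_mx Omega (fun=> 1%:M : 'M[R]_d) by move=> i j; exact: L2_cst.
  have iD Z' D : L2_mx Omega D -> W1d_id Omega Z' -> mu.-integrable Omega (EFin \o (fun x =>
      dot (f x) (Z' x - x) + dot (g x) (D x - 1%:M))).
    move=> LD' [_ [[LZ' _] _]]; apply: integrableD_EFin => //; apply: L2_mx_dot_integrable => //.
      exact: (Lp_mx_L2 mO Ooo d2 LZ').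
    exact: L2_mxB.
  have := RintegralB mO (iD _ _ L2D WZ) (iD _ _ DZ2 Zs_facts.2).
  rewrite H1 H2 subrr => <-; apply: eq_Rintegral => x _.
  have sub (V : zmodType) (u v w : V) : u - w - (v - w) = u - v by rewrite opprB addrA subrK.
  by rewrite opprD addrACA -!dotBr !sub.
have i13 := integrableD_EFin mO i1 i3.
have i134 := integrableD_EFin mO i13 i4.
have E : 1 / 2 * \int[mu]_(x in Omega) dot (Z x - Zs x) (Z x - Zs x) =
    \int[mu]_(x in Omega) (1 / 2 * dot (Z x - Zs x) (Z x - Zs x)).
  by rewrite RintegralZl//; exact: L2_mx_dot_integrable.
rewrite E -[leLHS]addr0 -l0.
have E2 := etrans (RintegralD mO i13 i4) (congr1 (+%R^~ _) (RintegralD mO i1 i3)).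
rewrite -E2; apply: le_Rintegral => // x Ox.
have /andP[q0 qM] := q_bnd Ox.
(* The rest is algebra: expanding the squares around [Zs], what exceeds the linear part and |Z -
   Zs|^2 / 2 is exactly the quantity bounded below here. *)
have := det_lower_bound (wD Omega Z x - Dmx Zs x) hd a0 sigma0 (Zs_det Ox)
  (fun s => @sigma_lb x s Ox) q0 qM.
rewrite [Dmx Zs x + _]addrC subrK /density (Zs_det Ox) normr1 subrr mulr0 addr0.
have sub (V : zmodType) (u v w : V) : u - v = (w - v) + (u - w).
  by rewrite [RHS]addrC addrA subrK.
rewrite (sub _ (Z x) (S x) (Zs x)) -/(f x) (sub _ (wD Omega Z x) (wD Omega S x) (Dmx Zs x)).
rewrite /g -/(f x); move: (f x) (Z x - Zs x) (Dmx Zs x - wD Omega S x) (wD Omega Z x - Dmx Zs x).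
move=> v w B H; rewrite !(dotDl, dotDr, dotZl) (dotC w v) (dotC H B).
move: (dot v v) (dot v w) (dot w w) (dot B B) (dot B H) (dot H H) (dot (cof _) _) (\det _).
by move=> vv vw ww BB BH HH cH dt; lra.
Qed.

(** Existence and uniqueness both follow from [density_lb]: a second minimiser forces the integral
    of |Z - Zs|^2 to be 0. *)
Lemma unique_minimizer_truncated q' : measurable_fun Omega q' ->
  ae_on Omega (fun x => q' x = q x) ->
  unique_minimizer Omega (W1d_id Omega) (fun Z => Lagrangian Omega a S Z q') Zs.
Proof.
move=> mq' qq.
have LE Z : W1d_id Omega Z -> Lagrangian Omega a S Z q' =
    (\int[mu]_(x in Omega) density Omega a S q Z (wD Omega Z) x)%:E.
  move=> WZ; have [ZD LD] := W1p_wD oO d0 WZ.1.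
  apply: (LagrangianE hd oO bO a S_H1 mq' mq q_norm qq) => //.
  - exact: (Lp_mx_L2 mO Ooo d2 WZ.1.1).
  - exact: weak_gradient_measurable ZD.
  - by apply: aeW.
have LEs : Lagrangian Omega a S Zs q' =
    (\int[mu]_(x in Omega) density Omega a S q Zs (Dmx Zs) x)%:E.
  have [WD WDE] := weak_gradient_wD oO Zs_facts.1.
  apply: (LagrangianE hd oO bO a S_H1 mq' mq q_norm qq) => //.
  exact: weak_gradient_measurable WD.
have iW Z : W1d_id Omega Z ->
    mu.-integrable Omega (EFin \o (fun x => dot (Z x - Zs x) (Z x - Zs x))).
  move=> WZ; have LW := L2_mxB oO (Lp_mx_L2 mO Ooo d2 WZ.1.1) Zs_L2.
  exact: L2_mx_dot_integrable.
have W0 Z : 0 <= \int[mu]_(x in Omega) dot (Z x - Zs x) (Z x - Zs x).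
  by apply: Rintegral_ge0 => x _; exact: dot_ge0.
split; first split; first exact: Zs_facts.2.
  move=> Z WZ; rewrite LEs LE// lee_fin; apply: le_trans (density_lb WZ).
  by rewrite lerDl mulr_ge0.
move=> Z [WZ Zmin]; have := Zmin Zs Zs_facts.2; rewrite LEs LE// lee_fin => le1.
have I0 : \int[mu]_(x in Omega) dot (Z x - Zs x) (Z x - Zs x) = 0.
  apply/eqP; rewrite eq_le W0 andbT; have := le_trans (density_lb WZ) le1.
  by rewrite gerDl pmulr_rle0.
have : ae_eq mu Omega (EFin \o (fun x => dot (Z x - Zs x) (Z x - Zs x))) (cst 0%E).
  apply/(ae_eq_integral_abs mu mO); first exact: measurable_int (iW Z WZ).
  transitivity (\int[mu]_(x in Omega) (dot (Z x - Zs x) (Z x - Zs x))%:E)%E.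
    by apply: eq_integral => x _; rewrite gee0_abs// lee_fin dot_ge0.
  exact: (etrans (RintegralE mO (iW Z WZ)) (congr1 EFin I0)).
apply: (@ae_onW _ _ Omega) => x Ox /= [/dot_eq0/eqP].
by rewrite subr_eq0 => /eqP.
Qed.

End energy.

Lemma Lnorm_on_le_ae {R : realType} {d : nat} (Omega : set 'rV[R]_d) (f : 'rV[R]_d -> R) (M : R) :
  (Lnorm_on Omega +oo%E f <= M%:E)%E -> ae_on Omega (fun x => `|f x| <= M).
Proof.
rewrite /Lnorm_on unlock; case: ifPn => [_ /ess_supP|].
  apply: (@filterS _ (almost_everywhere (lebesgue d))) => x /=; rewrite lee_fin => + Ox.
  by rewrite patchE mem_set.
(* Degenerate branch in the definition of the sup norm: the whole space has measure 0, so every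
   property holds a.e. *)
rewrite -leNgt measure_le0 => /eqP mu0 _; exists setT; split => //.
Qed.

Unset Implicit Arguments.

Theorem proposition3p4 (R : realType) (d : nat) (hd : d = 2%N \/ d = 3%N)
  (Omega : set 'rV[R]_d)
  (Omega_bounded : bounded_set Omega)
  (Omega_open : open Omega)
  (Omega_smooth : smooth_boundary Omega)
  (a : R) (a_gt0 : 0 < a)
  (S : 'rV[R]_d -> 'rV[R]_d)
  (S_Omega : set_fun Omega Omega S)
  (S_H1 : W1p Omega 2%:E S)
  (Zs : 'rV[R]_d -> 'rV[R]_d) (qs : 'rV[R]_d -> R)
  (Zs_diff : Diff_id Omega Zs)
  (qs_Linfty : Lp_on Omega +oo%E qs)
  (Zs_qs_solve : solves Omega a S Zs qs)
  (sigma : R) (sigma_gt0 : 0 < sigma)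
  (sigma_lb : forall x s, Omega x -> singular_value (Dmx Zs x) s -> sigma <= s)
  (c : R)
  (c_lb : ae_on Omega (fun x => 0 <= qs x - c))
  (c_max : forall c', ae_on Omega (fun x => 0 <= qs x - c') -> c' <= c)
  (hq : (Lnorm_on Omega +oo%E (fun x => (qs x - c)%R) <=
         (a * sigma ^+ 2 * (1 + 3 / 2 * (1 + Num.sqrt 3))^-1)%:E)%E) :
  unique_minimizer Omega (W1d_id Omega)
    (fun Z => Lagrangian Omega a S Z (fun x => qs x - c)) Zs.
Proof.
have [Zs_C1 _ _ Zs_det Zs_id] := Zs_diff.
have [mqs _] := qs_Linfty; have [EL _] := Zs_qs_solve.
have mO := open_rV_measurable Omega_open.
set M := a * sigma ^+ 2 * _ in hq.
have M0 : 0 <= M.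
  by rewrite /M mulr_ge0// mulr_ge0 ?sqr_ge0// ltW.
(* The bounds on qbar hold only a.e.; clamping gives a version between 0 and M at every point. *)
pose q x := Num.min (Num.max (qs x - c) 0) M.
have q_bnd x : Omega x -> 0 <= q x <= M.
  by move=> _; rewrite /q le_min le_max lexx orbT M0 ge_min lexx orbT.
have mq : measurable_fun Omega q.
  apply: measurable_minr => //; apply: measurable_maxr => //.
  exact: measurable_funB.
have qq : ae_on Omega (fun x => qs x - c = q x).
  apply: ae_onW2 c_lb (Lnorm_on_le_ae hq) => x Ox q0 qM.
  by rewrite /q (max_idPl q0) min_l// (le_trans (ler_norm _)).
apply: (unique_minimizer_truncated hd Omega_open Omega_bounded a_gt0 S_H1 sigma_gt0
  Zs_C1 Zs_id Zs_det sigma_lb mq q_bnd _ _ qq); last exact: measurable_funB.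
move=> phi tphi.
have Z1 := C1_closure_C1_on Omega_open Zs_C1.
have [C [_ UC dUC _ _]] := displacement_bounded Omega_open Omega_bounded Zs_C1.
have [ip Ip] := piola hd Omega_open Omega_bounded Z1
  (displacement_continuous Zs_C1) Zs_id UC dUC tphi.
have [f2 g2] := euler_lagrange_L2 hd Omega_open Omega_bounded S_H1 Zs_C1 Zs_id mq q_bnd.
have [p2 Dp2] := test_field_L2 Omega_open Omega_bounded tphi.
have iP := integrableD_EFin mO (L2_mx_dot_integrable Omega_open f2 p2)
  (L2_mx_dot_integrable Omega_open g2 Dp2).
have ic := integrableZl_EFin mO c ip.
have := EL phi tphi.
(* Almost everywhere qs = q + c, so the equation for [qs] is the one for [q] plus c times the
   integral in Piola's identity. *)
rewrite (@ae_eq_Rintegral _ _ _ Omega_open _ (fun x =>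
  (dot (Zs x - S x) (phi x) +
   dot (a *: (Dmx Zs x - wD Omega S x) + q x *: cof (Dmx Zs x)) (Dmx phi x)) +
  c * dot (cof (Dmx Zs x)) (Dmx phi x))).
- rewrite (RintegralD mO iP ic) RintegralZl// Ip mulr0 addr0; apply.
(* Only measurability of the original integrand is at stake; it is an integrable function plus a
   product of measurable ones. *)
- rewrite (_ : (fun x => _) = fun x =>
    (dot (Zs x - S x) (phi x) +
     dot (a *: (Dmx Zs x - wD Omega S x) + q x *: cof (Dmx Zs x)) (Dmx phi x)) +
    (qs x - q x) * dot (cof (Dmx Zs x)) (Dmx phi x)).
    apply: measurable_funD; first exact: integrable_measurable_fun iP.
    apply: measurable_funM; last exact: integrable_measurable_fun ip.
    exact: measurable_funB.
  apply/funext => x; rewrite !(dotDl, dotZl) -!addrA; congr (_ + (_ + _)).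
  by rewrite -mulrDl [q x + _]addrC subrK.
- apply: measurable_funD; first exact: integrable_measurable_fun iP.
  exact: integrable_measurable_fun ic.
- apply: ae_onW qq => x Ox qx; rewrite !(dotDl, dotZl) -!addrA; congr (_ + (_ + _)).
  by rewrite -mulrDl -qx subrK.
Qed.
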